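(* Let $q,a,b,k$ be nonzero complex numbers with $|q|<1$, such that no zero factor occurs in any denominator below (including the denominators of the terms of the series) and all the series below converge absolutely. Then $$\frac{(qab/k,kq/b;q)_\infty\,(q,k^2q/a,q^2a,q^2a^2/k^2;q^2)_\infty}{(kq,qa/k;q)_\infty}\;{}_{7}\phi_{6}\left[\begin{matrix}q\sqrt{k},\,-q\sqrt{k},\,\frac{k^2}{ab},\,b,\,\sqrt{qa},\,-\sqrt{qa},\,\frac{k^2}{qa^2}\\ \sqrt{k},\,-\sqrt{k},\,\frac{qab}{k},\,\frac{qk}{b},\,k\sqrt{\frac{q}{a}},\,-k\sqrt{\frac{q}{a}}\end{matrix};q,-\frac{qa}{k}\right]$$ $$=\left(\frac{k^2q}{ab},bq,\frac{a^2bq^2}{k^2},\frac{q^2a}{b};q^2\right)_\infty$$ $$\times\;{}_{16}W_{15}\left(a;\frac{k^2}{ab},b,aq,\frac{k}{aq},\frac{k}{a},a\sqrt{\tfrac{q}{k}},-a\sqrt{\tfrac{q}{k}},\frac{aq}{\sqrt{k}},-\frac{aq}{\sqrt{k}},a\sqrt{\tfrac{q^3}{k}},-a\sqrt{\tfrac{q^3}{k}},\frac{aq^2}{\sqrt{k}},-\frac{aq^2}{\sqrt{k}};\,q^2,\,q^2\right)$$ $$-q\,\frac{(1-aq^2)(1-qa^2/k)(1-q^2a^2/k)(1-k/aq)}{(1-q)(1-k)(1-kq)(1-a^2q^2/k)}\left(\frac{k^2}{ab},b,\frac{a^2bq^3}{k^2},\frac{q^3a}{b};q^2\right)_\infty$$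 $$\times\;{}_{16}W_{15}\left(aq^2;\frac{k^2q}{ab},bq,aq,\frac{kq}{a},\frac{k}{a},a\sqrt{\tfrac{q^3}{k}},-a\sqrt{\tfrac{q^3}{k}},\frac{aq^2}{\sqrt{k}},-\frac{aq^2}{\sqrt{k}},a\sqrt{\tfrac{q^5}{k}},-a\sqrt{\tfrac{q^5}{k}},\frac{aq^3}{\sqrt{k}},-\frac{aq^3}{\sqrt{k}};\,q^2,\,q^2\right).$$
   Context: Notation: $(x;q)_0=1$, $(x;q)_n=\prod_{j=0}^{n-1}(1-xq^j)$, $(x;q)_\infty=\prod_{j\ge 0}(1-xq^j)$, and $(x_1,\dots,x_m;q)_n=(x_1;q)_n\cdots(x_m;q)_n$ for $n$ a nonnegative integer or $\infty$. In expressions such as $k^2/ab$ or $k/aq$ the whole product after the slash is the denominator. Basic hypergeometric series: $${}_{r+1}\phi_r\left[\begin{matrix}a_1,\dots,a_{r+1}\\ b_1,\dots,b_r\end{matrix};p,x\right]=\sum_{n=0}^{\infty}\frac{(a_1,\dots,a_{r+1};p)_n}{(p,b_1,\dots,b_r;p)_n}x^n .$$ The very-well-poised series with base $p$ (here $p=q^2$) is $${}_{r+1}W_{r}(a_1;a_4,\dots,a_{r+1};p,x)=\sum_{n=0}^{\infty}\frac{(a_1,p\sqrt{a_1},-p\sqrt{a_1},a_4,\dots,a_{r+1};p)_n}{(p,\sqrt{a_1},-\sqrt{a_1},\frac{a_1p}{a_4},\dots,\frac{a_1p}{a_{r+1}};p)_n}\,x^n .$$ Square roots denote fixed choices of complex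 square root; each occurs together with its negative, so the choice is immaterial. *)

(* Defs.v *)
From Stdlib Require Import Reals List.
From Coquelicot Require Import Coquelicot.
Import ListNotations.
Open Scope C_scope.

Fixpoint qpoch (x q : C) (n : nat) : C :=
  match n with
  | O => 1
  | S m => qpoch x q m * (1 - x * q ^ m)
  end.

Definition qpoch_inf (x q : C) : C :=
  iota (T := C_CompleteNormedModule)
    (fun l : C => filterlim (fun n => qpoch x q n) eventually (locally l)).

Definition Cprod (l : list C) : C := fold_right Cmult 1 l.

Definition qpochs (xs : list C) (q : C) (n : nat) : C :=
  Cprod (map (fun x => qpoch x q n) xs).

Definition qpochs_inf (xs : list C) (q : C) : C :=
  Cprod (map (fun x => qpoch_inf x q) xs).

(* No factor [1 - x q^j] of the products [(x;q)_n], [n] finite or infinite,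
   is zero. *)
Definition no_zero_factor (xs : list C) (q : C) : Prop :=
  forall x, In x xs -> forall j : nat, 1 - x * q ^ j <> 0.

Definition Cseries (u : nat -> C) : C :=
  iota (T := C_CompleteNormedModule)
    (is_series (V := C_CompleteNormedModule) u).

Definition abs_convergent (u : nat -> C) : Prop :=
  ex_series (fun n => Cmod (u n)).

Definition phi_term (num den : list C) (p x : C) (n : nat) : C :=
  qpochs num p n / qpochs (p :: den) p n * x ^ n.

Definition phi (num den : list C) (p x : C) : C :=
  Cseries (phi_term num den p x).

(* Square roots enter through an arbitrary choice function [rt], with
   [rt z ^ 2 = z]. *)
Definition vwp_num (rt : C -> C) (a1 : C) (l : list C) (p : C) : list C :=
  a1 :: p * rt a1 :: - (p * rt a1) :: l.

Definition vwp_den (rt : C -> C) (a1 : C) (l : list C) (p : C) : list C :=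
  rt a1 :: - rt a1 :: map (fun c => a1 * p / c) l.

(* [l] lists the parameters [a_4, ..., a_{r+1}]. *)
Definition W_term (rt : C -> C) (a1 : C) (l : list C) (p x : C) : nat -> C :=
  phi_term (vwp_num rt a1 l p) (vwp_den rt a1 l p) p x.

Definition W (rt : C -> C) (a1 : C) (l : list C) (p x : C) : C :=
  Cseries (W_term rt a1 l p x).

(* Main.v *)
Require Import Defs.
From Stdlib Require Import Reals List Lra Lia Classical.
From Coquelicot Require Import Coquelicot.
Import ListNotations.
Open Scope C_scope.

(** Put [z = a/k], [A = k^2/(a b)] and [B = b], so that [k = z A B] and
    [a = z^2 A B].

    The left-hand series is [sum beta_n delta_n] with
    [beta_n = (k^2/(q a^2);q)_n / (q;q)_n]. This [beta] is the second half of a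
    well-poised Bailey pair: [beta_n = sum_(r <= n) wp_kernel a k n r * alpha_r],
    where [alpha] is [quad_alpha]. The pair arises from the unit pair, for which
    [beta = (1, 0, 0, ...)], by changing the parameter [q a^2/k] of the kernel
    into [k]; the change is a q-Saalschuetz sum ([wp_kernel_change],
    [unit_orthogonality], [quad_bailey_pair]).

    Insert the pair and sum over [n] first. The inner sum over [n >= r] is a
    very-well-poised [8W7], namely a nonterminating q-analogue of Watson's
    series with parameters [A q^r] and [B q^r] ([kernel_delta]), and it has a
    product value ([watson_sum]). What remains is a single sum over [r], the
    series of [rho]. The products in [rho r] are in base [q^2] and depend on the
    parity of [r]: the even terms make up the first [16W15], the odd ones the
    second ([rho_even], [rho_odd]).

    The Watson sum itself comes from a contiguous relation between the series
    at [z] and at [q z], proved by telescoping ([watson_telescope]). Iteration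
    moves [z] to [0], where the series becomes the q-analogue of Gauss's second
    theorem due to Andrews; this is evaluated by a functional equation in [A]
    and [B] and by the instance [z = 1] of the relation just found, in which
    the Watson series has one term ([gauss_second]).

    Two points need care. The series on the left is only assumed to converge;
    if [|q a/k| >= 1], convergence forces the series to terminate
    ([summable_from_convergence]), and the argument goes through unchanged.
    And the kernel has poles when [a = q^-(2M+1)], a value at which both sides
    of the identity make sense and are finite sums. There the inner sums are
    truncated Watson series. Their values have a second part
    ([watson_truncated]), obtained from an addition formula for theta functions
    ([theta_addition]), which is the Watson sum at [a = 1/q] in disguise.
    Because [alpha_(2M+1-r) = - alpha_r] ([quad_alpha_antisym]), the second part
    for the index [r] is the term of the right-hand side with index [2M+1-r]
    ([rho_reflect]). *)

(** * Limits of complex sequences *)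

Lemma Cmod_minus_sym (x y : C) : Cmod (x - y) = Cmod (y - x).
Proof. rewrite <- (Cmod_opp (x - y)). f_equal. ring. Qed.

Lemma Cmod_triangle_minus (x y : C) : (Cmod (x - y) <= Cmod x + Cmod y)%R.
Proof.
  unfold Cminus. rewrite <- (Cmod_opp y). apply Cmod_triangle.
Qed.

Lemma Cmod_triangle_rev (x y : C) : (Cmod x - Cmod y <= Cmod (x - y))%R.
Proof.
  pose proof (Cmod_triangle (x - y) y) as H.
  replace (x - y + y) with x in H by ring. lra.
Qed.

Definition Clim (u : nat -> C) (l : C) : Prop :=
  forall eps : R, (0 < eps)%R ->
    exists N, forall n, (N <= n)%nat -> (Cmod (u n - l) < eps)%R.

Lemma Clim_ext_from (u v : nat -> C) (N : nat) (l : C) :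
  (forall n, (N <= n)%nat -> u n = v n) -> Clim u l -> Clim v l.
Proof.
  intros He Hu eps Heps. destruct (Hu eps Heps) as [M HM].
  exists (max N M). intros n Hn. rewrite <- He by lia. apply HM. lia.
Qed.

Lemma Clim_ext (u v : nat -> C) (l : C) :
  (forall n, u n = v n) -> Clim u l -> Clim v l.
Proof. intros He. apply Clim_ext_from with 0%nat. auto. Qed.

Lemma Clim_limit_eq (l l' : C) (u : nat -> C) : l = l' -> Clim u l -> Clim u l'.
Proof. now intros ->. Qed.

Lemma Clim_const (c : C) : Clim (fun _ => c) c.
Proof.
  intros eps Heps. exists 0%nat. intros n _.
  replace (c - c) with (RtoC 0) by ring. now rewrite Cmod_0.
Qed.

Lemma Clim_subseq (u : nat -> C) (s : nat -> nat) (l : C) :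
  (forall n, (n <= s n)%nat) -> Clim u l -> Clim (fun n => u (s n)) l.
Proof.
  intros Hs Hu eps Heps. destruct (Hu eps Heps) as [N HN].
  exists N. intros n Hn. apply HN. specialize (Hs n). lia.
Qed.

Lemma Clim_unshift (u : nat -> C) (m : nat) (l : C) :
  Clim (fun n => u (n + m)%nat) l -> Clim u l.
Proof.
  intros Hu eps Heps. destruct (Hu eps Heps) as [N HN].
  exists (N + m)%nat. intros n Hn.
  replace n with (n - m + m)%nat by lia. apply HN. lia.
Qed.

Lemma Clim_unique (u : nat -> C) (l l' : C) : Clim u l -> Clim u l' -> l = l'.
Proof.
  intros H H'.
  destruct (Ceq_dec (l - l') 0) as [E|E].
  { replace l with (l - l' + l') by ring. rewrite E. ring. }
  exfalso. apply Cmod_gt_0 in E.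
  destruct (H (Cmod (l - l') / 2)%R) as [N HN]; [lra|].
  destruct (H' (Cmod (l - l') / 2)%R) as [N' HN']; [lra|].
  specialize (HN (max N N') ltac:(lia)). specialize (HN' (max N N') ltac:(lia)).
  pose proof (Cmod_triangle_minus (u (max N N') - l') (u (max N N') - l)) as T.
  replace (u (max N N') - l' - (u (max N N') - l)) with (l - l') in T by ring.
  lra.
Qed.

Lemma Clim_plus (u v : nat -> C) (l m : C) :
  Clim u l -> Clim v m -> Clim (fun n => u n + v n) (l + m).
Proof.
  intros Hu Hv eps Heps.
  destruct (Hu (eps / 2)%R) as [N HN]; [lra|].
  destruct (Hv (eps / 2)%R) as [M HM]; [lra|].
  exists (max N M). intros n Hn.
  specialize (HN n ltac:(lia)). specialize (HM n ltac:(lia)).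
  replace (u n + v n - (l + m)) with ((u n - l) + (v n - m)) by ring.
  eapply Rle_lt_trans; [apply Cmod_triangle|]. lra.
Qed.

Lemma Clim_squeeze (u : nat -> C) (l : C) (e : nat -> R) :
  (forall n, (Cmod (u n - l) <= e n)%R) -> is_lim_seq e 0 -> Clim u l.
Proof.
  intros Hu He eps Heps.
  apply is_lim_seq_spec in He. destruct (He (mkposreal eps Heps)) as [N HN].
  exists N. intros n Hn. specialize (HN n Hn). simpl in HN.
  rewrite Rminus_0_r in HN. apply Rabs_lt_between in HN.
  specialize (Hu n). lra.
Qed.

Lemma Clim_is_lim_seq (u : nat -> C) (l : C) :
  Clim u l <-> is_lim_seq (fun n => Cmod (u n - l)) 0.
Proof.
  split.
  - intros H. apply is_lim_seq_spec. intros eps.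
    destruct (H eps (cond_pos eps)) as [N HN]. exists N. intros n Hn.
    rewrite Rminus_0_r, Rabs_pos_eq by apply Cmod_ge_0. auto.
  - apply Clim_squeeze. intros; apply Rle_refl.
Qed.

Lemma Clim_bounded (u : nat -> C) (l : C) :
  Clim u l -> exists M N, forall n, (N <= n)%nat -> (Cmod (u n) <= M)%R.
Proof.
  intros H. destruct (H 1%R) as [N HN]; [lra|].
  exists (Cmod l + 1)%R, N. intros n Hn. specialize (HN n Hn).
  pose proof (Cmod_triangle_rev (u n) l). lra.
Qed.

Lemma Clim_mult (u v : nat -> C) (l m : C) :
  Clim u l -> Clim v m -> Clim (fun n => u n * v n) (l * m).
Proof.
  intros Hu Hv. destruct (Clim_bounded v m Hv) as [M [N HM]].
  apply Clim_unshift with N.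
  apply Clim_squeeze with
    (fun n => (Cmod (u (n + N)%nat - l) * M + Cmod l * Cmod (v (n + N)%nat - m)))%R.
  - intros n.
    replace (u (n + N)%nat * v (n + N)%nat - l * m)
      with ((u (n + N)%nat - l) * v (n + N)%nat + l * (v (n + N)%nat - m)) by ring.
    eapply Rle_trans; [apply Cmod_triangle|].
    rewrite !Cmod_mult. apply Rplus_le_compat_r.
    apply Rmult_le_compat_l; [apply Cmod_ge_0|]. apply HM. lia.
  - apply Clim_is_lim_seq in Hu. apply Clim_is_lim_seq in Hv.
    apply (is_lim_seq_incr_n _ N) in Hu. apply (is_lim_seq_incr_n _ N) in Hv.
    replace (Finite 0) with (Finite (0 * M + Cmod l * 0))%R
      by (f_equal; ring).
    apply is_lim_seq_plus'.
    + apply is_lim_seq_mult'; [exact Hu|apply is_lim_seq_const].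
    + apply is_lim_seq_mult'; [apply is_lim_seq_const|exact Hv].
Qed.

Lemma Clim_scal (c : C) (u : nat -> C) (l : C) :
  Clim u l -> Clim (fun n => c * u n) (c * l).
Proof. apply Clim_mult. apply Clim_const. Qed.

Lemma Clim_minus (u v : nat -> C) (l m : C) :
  Clim u l -> Clim v m -> Clim (fun n => u n - v n) (l - m).
Proof.
  intros Hu Hv.
  replace (l - m) with (l + (-(1)) * m) by ring.
  apply Clim_ext with (fun n => u n + (-(1)) * v n); [intros; ring|].
  apply Clim_plus; [exact Hu|]. now apply Clim_scal.
Qed.

Lemma Clim_Cmod_le (u : nat -> C) (l x : C) (M : R) :
  Clim u l -> (forall n, (Cmod (u n - x) <= M)%R) -> (Cmod (l - x) <= M)%R.
Proof.
  intros H HM. apply Rnot_lt_le. intros Hlt.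
  destruct (H (Cmod (l - x) - M)%R) as [N HN]; [lra|].
  specialize (HN N (le_n _)). specialize (HM N).
  pose proof (Cmod_triangle_minus (u N - x) (u N - l)) as T.
  replace (u N - x - (u N - l)) with (l - x) in T by ring. lra.
Qed.

Lemma Clim_Cmod_ge (u : nat -> C) (l : C) (c : R) :
  Clim u l -> (forall n, (c <= Cmod (u n))%R) -> (c <= Cmod l)%R.
Proof.
  intros H HM. apply Rnot_lt_le. intros Hlt.
  destruct (H (c - Cmod l)%R) as [N HN]; [lra|].
  specialize (HN N (le_n _)). specialize (HM N).
  pose proof (Cmod_triangle_rev (u N) l). lra.
Qed.

Lemma Clim_inv (u : nat -> C) (l : C) :
  l <> 0 -> Clim u l -> Clim (fun n => / u n) (/ l).
Proof.
  intros Hl H. assert (Hl' := proj1 (Cmod_gt_0 l) Hl).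
  set (c := (Cmod l / 2)%R). assert (Hc : (0 < c)%R) by (unfold c; lra).
  destruct (H c Hc) as [N HN]. apply Clim_unshift with N.
  assert (Hu : forall n, (c <= Cmod (u (n + N)%nat))%R).
  { intros n. specialize (HN (n + N)%nat ltac:(lia)). rewrite Cmod_minus_sym in HN.
    pose proof (Cmod_triangle_rev l (l - u (n + N)%nat)) as T.
    replace (l - (l - u (n + N)%nat)) with (u (n + N)%nat) in T by ring.
    unfold c in *. lra. }
  assert (Hu0 : forall n, u (n + N)%nat <> 0).
  { intros n. apply Cmod_gt_0. specialize (Hu n). lra. }
  apply Clim_squeeze with (fun n => (/ c * / c * Cmod (u (n + N)%nat - l))%R).
  - intros n.
    replace (/ u (n + N)%nat - / l)
      with (/ u (n + N)%nat * / l * (l - u (n + N)%nat)) by (field; auto).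
    rewrite !Cmod_mult, !Cmod_inv, (Cmod_minus_sym l) by auto.
    apply Rmult_le_compat_r; [apply Cmod_ge_0|].
    assert (Hn := Hu n).
    apply Rmult_le_compat;
      try (left; apply Rinv_0_lt_compat; lra);
      apply Rinv_le_contravar; unfold c in *; lra.
  - replace (Finite 0) with (Finite (/ c * / c * 0)%R) by (f_equal; ring).
    apply is_lim_seq_mult'; [apply is_lim_seq_const|].
    apply Clim_is_lim_seq. apply (Clim_subseq u (fun n => (n + N)%nat));
      [intros; lia|exact H].
Qed.

Lemma Clim_geom (x : C) : (Cmod x < 1)%R -> Clim (fun n => x ^ n) 0.
Proof.
  intros Hx. apply Clim_squeeze with (fun n => (Cmod x ^ n)%R).
  - intros n. replace (x ^ n - 0) with (x ^ n) by ring.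
    rewrite Cmod_pow. apply Rle_refl.
  - apply is_lim_seq_geom. rewrite Rabs_pos_eq; [exact Hx|apply Cmod_ge_0].
Qed.

(** [locally] on [C] uses the box metric, [Clim] the modulus. *)
Lemma Clim_filterlim (u : nat -> C) (l : C) :
  filterlim u eventually (locally (T := C_UniformSpace) l) <-> Clim u l.
Proof.
  split.
  - intros H eps Heps.
    assert (He : (0 < eps / sqrt 2)%R).
    { apply Rdiv_lt_0_compat; [lra|apply Rlt_sqrt2_0]. }
    destruct (H (fun y => ball (M := C_UniformSpace) l
                (mkposreal _ He) y)) as [N HN].
    { now exists (mkposreal _ He). }
    exists N. intros n Hn. specialize (HN n Hn).
    apply C_NormedModule_mixin_compat2 in HN.
    replace (u n - l) with (minus (G := C_AbelianGroup) (u n) l) by reflexivity.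
    eapply Rlt_le_trans; [exact HN|]. simpl. right. field.
    apply Rgt_not_eq, Rlt_sqrt2_0.
  - intros H P [eps HP]. destruct (H eps (cond_pos eps)) as [N HN].
    exists N. intros n Hn. apply HP. apply C_NormedModule_mixin_compat1.
    exact (HN n Hn).
Qed.

(** * Finite and infinite sums *)

Fixpoint csum (f : nat -> C) (n : nat) : C :=
  match n with
  | O => 0
  | S m => csum f m + f m
  end.

Lemma csum_S (f : nat -> C) (n : nat) : csum f (S n) = csum f n + f n.
Proof. reflexivity. Qed.

Lemma csum_ext (f g : nat -> C) (n : nat) :
  (forall i, (i < n)%nat -> f i = g i) -> csum f n = csum g n.
Proof.
  induction n as [|n IH]; intros H; [reflexivity|].
  simpl. rewrite IH, H; auto.
Qed.

Lemma csum_scal (c : C) (f : nat -> C) (n : nat) :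
  csum (fun i => c * f i) n = c * csum f n.
Proof. induction n as [|n IH]; simpl; [ring|]. rewrite IH. ring. Qed.

Lemma csum_plus (f g : nat -> C) (n : nat) :
  csum (fun i => f i + g i) n = csum f n + csum g n.
Proof. induction n as [|n IH]; simpl; [ring|]. rewrite IH. ring. Qed.

Lemma csum_minus_scal (c d : C) (f g : nat -> C) (n : nat) :
  csum (fun i => c * f i - d * g i) n = c * csum f n - d * csum g n.
Proof. induction n as [|n IH]; simpl; [ring|]. rewrite IH. ring. Qed.

Lemma csum_S_l (f : nat -> C) (n : nat) :
  csum f (S n) = f 0%nat + csum (fun i => f (S i)) n.
Proof.
  induction n as [|n IH]; [simpl; ring|].
  change (csum f (S (S n))) with (csum f (S n) + f (S n)).
  rewrite IH. simpl. ring.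
Qed.

Lemma csum_zero (f : nat -> C) (n : nat) :
  (forall i, (i < n)%nat -> f i = 0) -> csum f n = 0.
Proof.
  intros H. rewrite (csum_ext f (fun _ => 0)) by exact H.
  clear H. induction n as [|n IH]; simpl; [reflexivity|]. rewrite IH. ring.
Qed.

Lemma csum_stable (f : nat -> C) (n m : nat) :
  (n <= m)%nat -> (forall i, (n <= i)%nat -> f i = 0) -> csum f m = csum f n.
Proof.
  intros Hnm H. induction Hnm as [|m Hnm IH]; [reflexivity|].
  simpl. rewrite IH, H by lia. ring.
Qed.

(** Interchange of summation over the triangle [r <= n < L], with [n = r + j]. *)
Lemma csum_triangle (f : nat -> nat -> C) (L : nat) :
  csum (fun n => csum (fun r => f n r) (S n)) L
  = csum (fun r => csum (fun j => f (r + j)%nat r) (L - r)) L.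
Proof.
  induction L as [|L IH]; [reflexivity|].
  rewrite !(csum_S _ L), IH.
  rewrite (csum_ext (fun r => csum (fun j => f (r + j)%nat r) (S L - r))
             (fun r => csum (fun j => f (r + j)%nat r) (L - r) + f L r)).
  2:{ intros r Hr. replace (S L - r)%nat with (S (L - r)) by lia. cbn [csum].
      replace (r + (L - r))%nat with L by lia. reflexivity. }
  rewrite csum_plus. replace (S L - L)%nat with 1%nat by lia.
  rewrite (csum_S _ 0), Nat.add_0_r. simpl (csum _ 0).
  change (fun r => f L r) with (f L). ring.
Qed.

Lemma csum_even_odd (f : nat -> C) (n : nat) :
  csum f (2 * n)
  = csum (fun i => f (2 * i)%nat) n + csum (fun i => f (2 * i + 1)%nat) n.
Proof.
  induction n as [|n IH]; [simpl; ring|].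
  replace (2 * S n)%nat with (S (S (2 * n))) by lia. cbn [csum].
  rewrite IH. replace (2 * n + 1)%nat with (S (2 * n)) by lia. ring.
Qed.

(** For sums whose terms are related by the reflection [r -> 2M+1-r]. *)
Lemma csum_fold (f : nat -> C) (M : nat) :
  csum f (2 * M + 2) = csum (fun r => f r + f (2 * M + 1 - r)%nat) (S M).
Proof.
  assert (H : forall j, (j <= S M)%nat ->
    csum f (2 * M + 2)
    = csum (fun r => f r + f (2 * M + 1 - r)%nat) j
      + csum (fun i => f (j + i)%nat) (2 * (S M - j))).
  { induction j as [|j IH]; intros Hj.
    - simpl csum at 2. replace (2 * (S M - 0))%nat with (2 * M + 2)%nat by lia.
      cbn [Nat.add]. change (fun i => f i) with f. ring.
    - rewrite IH by lia.
      replace (2 * (S M - j))%nat with (S (S (2 * (S M - S j)))) by lia.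
      rewrite csum_S_l.
      change (csum (fun i => f (j + S i)%nat) (S (2 * (S M - S j))))
        with (csum (fun i => f (j + S i)%nat) (2 * (S M - S j))
              + f (j + S (2 * (S M - S j)))%nat).
      replace (j + S (2 * (S M - S j)))%nat with (2 * M + 1 - j)%nat by lia.
      rewrite (csum_ext (fun i => f (j + S i)%nat) (fun i => f (S j + i)%nat))
        by (intros; f_equal; lia).
      rewrite Nat.add_0_r, (csum_S _ j). ring. }
  rewrite (H (S M)) by lia. rewrite Nat.sub_diag. simpl. ring.
Qed.

Lemma csum_sum_n (u : nat -> C) (n : nat) :
  sum_n (G := C_AbelianGroup) u n = csum u (S n).
Proof.
  induction n as [|n IH].
  - rewrite sum_O. simpl. ring.
  - rewrite sum_Sn, IH. reflexivity.
Qed.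

Lemma is_series_Clim (u : nat -> C) (l : C) :
  is_series (V := C_NormedModule) u l <-> Clim (csum u) l.
Proof.
  unfold is_series.
  transitivity (Clim (fun n => csum u (S n)) l).
  - rewrite <- Clim_filterlim. split; apply filterlim_ext;
      intros n; rewrite csum_sum_n; reflexivity.
  - split; intros H.
    + apply Clim_unshift with 1%nat. eapply Clim_ext; [|exact H].
      intros n. now rewrite Nat.add_1_r.
    + apply (Clim_subseq (csum u) S); [intros; lia|exact H].
Qed.

(** How a linear relation between two sums follows from closed forms of its
    partial sums. *)
Lemma telescoping_relation (f g cert : nat -> C) (c d F G : C) :
  (forall n, csum (fun i => c * f i - d * g i) (S n) = cert n) ->
  Clim cert 0 -> Clim (csum f) F -> Clim (csum g) G -> c * F = d * G.
Proof.
  intros H H0 HF HG.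
  assert (E : c * F - d * G = 0).
  { apply (Clim_unique (fun n => c * csum f (S n) - d * csum g (S n))).
    - apply Clim_minus; apply Clim_scal.
      + apply (Clim_subseq (csum f) S); [intros; lia|exact HF].
      + apply (Clim_subseq (csum g) S); [intros; lia|exact HG].
    - apply Clim_ext with cert; [|exact H0].
      intros n. now rewrite <- H, csum_minus_scal. }
  replace (c * F) with (c * F - d * G + d * G) by ring. rewrite E. ring.
Qed.

Lemma Cseries_Clim (u : nat -> C) (l : C) :
  Clim (csum u) l -> Cseries u = l.
Proof.
  intros H. unfold Cseries.
  apply (iota_unique (V := C_CompleteNormedModule)).
  - intros y Hy. apply is_series_Clim in Hy. eapply Clim_unique; eauto.
  - now apply is_series_Clim.
Qed.

Lemma abs_convergent_Clim (u : nat -> C) :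
  abs_convergent u -> Clim (csum u) (Cseries u).
Proof.
  intros H.
  assert (E : ex_series (V := C_CompleteNormedModule) u).
  { apply ex_series_le with (fun n => Cmod (u n)); [|exact H].
    intros n. apply Rle_refl. }
  destruct E as [l Hl]. apply is_series_Clim in Hl.
  now rewrite (Cseries_Clim u l Hl).
Qed.

Lemma csum_Cmod_geom (f : nat -> C) (M r : R) (R0 n : nat) :
  (0 <= M)%R -> (0 < r < 1)%R ->
  (forall i, (Cmod (f i) <= M * r ^ i)%R) ->
  (R0 <= n)%nat -> (Cmod (csum f n - csum f R0) <= M * r ^ R0 / (1 - r))%R.
Proof.
  intros HM Hr Hf Hn.
  assert (H : (Cmod (csum f n - csum f R0)
               <= M * (r ^ R0 - r ^ n) / (1 - r))%R).
  { induction Hn as [|n Hn IH].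
    - replace (csum f R0 - csum f R0) with (RtoC 0) by ring.
      rewrite Cmod_0. right. field. lra.
    - simpl csum.
      replace (csum f n + f n - csum f R0)
        with ((csum f n - csum f R0) + f n) by ring.
      eapply Rle_trans; [apply Cmod_triangle|].
      eapply Rle_trans; [apply Rplus_le_compat; [exact IH|apply Hf]|].
      right. simpl. field. lra. }
  eapply Rle_trans; [exact H|].
  unfold Rdiv. apply Rmult_le_compat_r.
  - left. apply Rinv_0_lt_compat. lra.
  - assert (0 <= r ^ n)%R by (apply pow_le; lra). nra.
Qed.

Lemma geom_bound_Clim (f : nat -> C) (M r : R) :
  (0 < r < 1)%R -> (forall i, (Cmod (f i) <= M * r ^ i)%R) ->
  exists s, Clim (csum f) s.
Proof.
  intros Hr Hf.
  assert (E : ex_series (V := C_CompleteNormedModule) f).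
  { apply ex_series_le with (fun n => (M * r ^ n)%R); [exact Hf|].
    apply (ex_series_scal (K := R_AbsRing) (V := R_NormedModule) M).
    apply ex_series_geom. rewrite Rabs_pos_eq; lra. }
  destruct E as [s Hs]. exists s. now apply is_series_Clim.
Qed.

Lemma pow_lt_eps (r eps : R) :
  (0 < r < 1)%R -> (0 < eps)%R -> exists N, forall n, (N <= n)%nat -> (r ^ n < eps)%R.
Proof.
  intros Hr He.
  assert (H : is_lim_seq (fun n => r ^ n)%R 0)
    by (apply is_lim_seq_geom; rewrite Rabs_pos_eq; lra).
  apply is_lim_seq_spec in H. destruct (H (mkposreal eps He)) as [N HN].
  exists N. intros n Hn. specialize (HN n Hn). simpl in HN.
  rewrite Rminus_0_r in HN. apply Rabs_lt_between in HN. lra.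
Qed.

Lemma Clim_csum (f : nat -> nat -> C) (g : nat -> C) (n : nat) :
  (forall r, Clim (fun L => f L r) (g r)) ->
  Clim (fun L => csum (f L) n) (csum g n).
Proof.
  intros H. induction n as [|n IH]; simpl.
  - apply Clim_const.
  - now apply Clim_plus.
Qed.

(** Tannery's theorem: the geometric bound makes the tails small uniformly in
    [L], and finitely many terms converge one by one. *)
Lemma tannery (f : nat -> nat -> C) (g s : nat -> C) (M r : R) (t : C) :
  (0 <= M)%R -> (0 < r < 1)%R ->
  (forall L i, (Cmod (f L i) <= M * r ^ i)%R) ->
  (forall i, Clim (fun L => f L i) (g i)) ->
  (forall L, Clim (csum (f L)) (s L)) ->
  Clim (csum g) t -> Clim s t.
Proof.
  intros HM Hr Hf Hg Hs Ht eps Heps.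
  assert (Hgb : forall i, (Cmod (g i) <= M * r ^ i)%R).
  { intros i. replace (g i) with (g i - 0) by ring.
    apply Clim_Cmod_le with (fun L => f L i); [apply Hg|].
    intros L. replace (f L i - 0) with (f L i) by ring. apply Hf. }
  assert (Hd : (0 < eps / 3 * (1 - r) / (M + 1))%R).
  { apply Rdiv_lt_0_compat; [|lra]. nra. }
  destruct (pow_lt_eps r _ Hr Hd) as [N HN]. specialize (HN N (le_n _)).
  assert (Htail : (M * r ^ N / (1 - r) < eps / 3)%R).
  { assert (Hp : (0 <= r ^ N)%R) by (apply pow_le; lra).
    apply Rlt_div_l; [lra|]. apply Rlt_div_r in HN; [|lra]. nra. }
  destruct (Clim_csum f g N Hg (eps / 3)%R) as [L0 HL0]; [lra|].
  exists L0. intros L HL. specialize (HL0 L HL).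
  assert (H1 : (Cmod (s L - csum (f L) N) <= M * r ^ N / (1 - r))%R).
  { apply Clim_Cmod_le with (fun n => csum (f L) (n + N)%nat).
    - apply (Clim_subseq (csum (f L)) (fun n => (n + N)%nat));
        [intros; lia|apply Hs].
    - intros n. apply csum_Cmod_geom; auto. lia. }
  assert (H2 : (Cmod (t - csum g N) <= M * r ^ N / (1 - r))%R).
  { apply Clim_Cmod_le with (fun n => csum g (n + N)%nat).
    - apply (Clim_subseq (csum g) (fun n => (n + N)%nat));
        [intros; lia|apply Ht].
    - intros n. apply csum_Cmod_geom; auto. lia. }
  replace (s L - t) with ((s L - csum (f L) N) + (csum (f L) N - csum g N)
    - (t - csum g N)) by ring.
  eapply Rle_lt_trans; [apply Cmod_triangle_minus|].
  pose proof (Cmod_triangle (s L - csum (f L) N) (csum (f L) N - csum g N)).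
  lra.
Qed.

(** The truncated sums are the sums of the families cut off at [L], to which
    Tannery's theorem applies. *)
Lemma tannery_trunc (f : nat -> nat -> C) (g : nat -> C) (M r : R) (t : C) :
  (0 <= M)%R -> (0 < r < 1)%R ->
  (forall L i, (Cmod (f L i) <= M * r ^ i)%R) ->
  (forall i, Clim (fun L => f L i) (g i)) ->
  Clim (fun L => csum (f L) L) t -> Clim (csum g) t.
Proof.
  intros HM Hr Hf Hg Ht.
  assert (Hgb : forall i, (Cmod (g i) <= M * r ^ i)%R).
  { intros i. replace (g i) with (g i - 0) by ring.
    apply Clim_Cmod_le with (fun L => f L i); [apply Hg|].
    intros L. replace (f L i - 0) with (f L i) by ring. apply Hf. }
  destruct (geom_bound_Clim g M r Hr Hgb) as [t' Ht'].
  set (f' := fun L i => if (i <? L)%nat then f L i else 0).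
  assert (H : Clim (fun L => csum (f L) L) t').
  { apply tannery with f' g M r; auto.
    - intros L i. unfold f'. destruct (i <? L)%nat; [apply Hf|].
      rewrite Cmod_0. apply Rmult_le_pos; [lra|apply pow_le; lra].
    - intros i. apply Clim_ext_from with (fun L => f L i) (S i); [|apply Hg].
      intros L HL. unfold f'. now rewrite (proj2 (Nat.ltb_lt i L) HL).
    - intros L.
      apply Clim_ext_from with (fun _ => csum (f L) L) L; [|apply Clim_const].
      intros n Hn. symmetry. rewrite (csum_stable _ L n Hn).
      + apply csum_ext. intros i Hi. unfold f'.
        now rewrite (proj2 (Nat.ltb_lt i L) Hi).
      + intros i Hi. unfold f'. now rewrite (proj2 (Nat.ltb_ge i L) Hi). }
  now rewrite (Clim_unique _ _ _ Ht H).
Qed.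

(** * Finite q-shifted factorials *)

Lemma qpow_double (q : C) (n : nat) : (q ^ 2) ^ n = (q ^ n) ^ 2.
Proof. rewrite <- !Cpow_mult_r. f_equal. lia. Qed.

Lemma qpow_sqr (q : C) (n : nat) : (q ^ n) ^ 2 = q ^ (2 * n).
Proof. rewrite <- !Cpow_mult_r. f_equal. lia. Qed.

Lemma qpoch_S (x p : C) (n : nat) :
  qpoch x p (S n) = qpoch x p n * (1 - x * p ^ n).
Proof. reflexivity. Qed.

Lemma qpoch_add (x p : C) (n m : nat) :
  qpoch x p (n + m) = qpoch x p n * qpoch (x * p ^ n) p m.
Proof.
  induction m as [|m IH].
  - rewrite Nat.add_0_r. simpl. ring.
  - rewrite Nat.add_succ_r. simpl. rewrite IH, Cpow_add_r. ring.
Qed.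

Lemma qpoch_S_l (x p : C) (n : nat) :
  qpoch x p (S n) = (1 - x) * qpoch (x * p) p n.
Proof.
  change (S n) with (1 + n)%nat. rewrite qpoch_add, Cpow_1_r. simpl. ring.
Qed.

Lemma qpoch_double (x q : C) (n : nat) :
  qpoch x q (2 * n) = qpoch x (q ^ 2) n * qpoch (x * q) (q ^ 2) n.
Proof.
  induction n as [|n IH]; [simpl; ring|].
  replace (2 * S n)%nat with (S (S (2 * n))) by lia.
  rewrite !qpoch_S, IH, (Cpow_S q (2 * n)), Cpow_mult_r. ring.
Qed.

Lemma qpoch_pm (x q : C) (n : nat) :
  qpoch x q n * qpoch (- x) q n = qpoch (x ^ 2) (q ^ 2) n.
Proof.
  induction n as [|n IH]; [simpl; ring|].
  rewrite !qpoch_S, <- IH, <- (Cpow_mult_r q 2), Nat.mul_comm, Cpow_mult_r. ring.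
Qed.

Lemma qpoch_neq_0 (x p : C) (n : nat) :
  (forall j, (j < n)%nat -> 1 - x * p ^ j <> 0) -> qpoch x p n <> 0.
Proof.
  induction n as [|n IH]; intros H.
  - simpl. intros E. injection E. lra.
  - simpl. apply Cmult_neq_0; auto.
Qed.

Lemma qpoch_shift_neq_0 (x p : C) (m n : nat) :
  (forall j, 1 - x * p ^ j <> 0) -> qpoch (x * p ^ m) p n <> 0.
Proof.
  intros H. apply qpoch_neq_0. intros j _.
  rewrite <- Cmult_assoc, <- Cpow_add_r. apply H.
Qed.

Lemma qpoch_eq_0 (x p : C) (n j : nat) :
  (j < n)%nat -> 1 - x * p ^ j = 0 -> qpoch x p n = 0.
Proof.
  intros Hj E. replace n with (S j + (n - S j))%nat by lia.
  rewrite qpoch_add, qpoch_S, E. ring.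
Qed.

(** * Infinite products *)

Section Product.

Variable p : C.
Hypothesis Hp : (Cmod p < 1)%R.

Let s := (/ (1 - Cmod p))%R.

Lemma inv_gap_pos : (0 < s)%R.
Proof. apply Rinv_0_lt_compat. lra. Qed.

Lemma geom_partial (n : nat) :
  (s * (1 - Cmod p ^ S n) = s * (1 - Cmod p ^ n) + Cmod p ^ n)%R.
Proof. unfold s. simpl. field. lra. Qed.

Lemma geom_partial_le (n : nat) : (s * (1 - Cmod p ^ n) <= s)%R.
Proof.
  pose proof inv_gap_pos.
  assert (0 <= Cmod p ^ n)%R by (apply pow_le, Cmod_ge_0). nra.
Qed.

(** [|1 - x p^j| <= exp(|x| |p|^j)], and the exponents form a geometric
    series. *)
Lemma qpoch_bound (r : R) :
  exists M, (1 <= M)%R /\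
    forall x, (Cmod x <= r)%R -> forall n, (Cmod (qpoch x p n) <= M)%R.
Proof.
  assert (Hs := inv_gap_pos).
  exists (exp (Rmax r 0 * s)). split.
  { rewrite <- exp_0. assert (0 <= Rmax r 0)%R by apply Rmax_r.
    destruct (Rle_lt_or_eq_dec 0 (Rmax r 0 * s)) as [H'|H'].
    - nra.
    - left. now apply exp_increasing.
    - right. now rewrite <- H'. }
  intros x Hx n.
  assert (Hx0 := Cmod_ge_0 x).
  apply Rle_trans with (exp (Cmod x * (s * (1 - Cmod p ^ n)))).
  - induction n as [|n IH].
    + simpl. rewrite Cmod_1. replace (Cmod x * (s * (1 - 1)))%R with 0%R by ring.
      rewrite exp_0. lra.
    + rewrite qpoch_S, Cmod_mult, geom_partial, Rmult_plus_distr_l, exp_plus.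
      apply Rmult_le_compat; try apply Cmod_ge_0; [exact IH|].
      eapply Rle_trans; [apply Cmod_triangle_minus|].
      rewrite Cmod_1, Cmod_mult, Cmod_pow.
      apply exp_ineq1_le.
  - assert (H := geom_partial_le n).
    assert (Hr : (r <= Rmax r 0)%R) by apply Rmax_l.
    assert (0 <= s * (1 - Cmod p ^ n))%R.
    { assert (Cmod p ^ n <= 1)%R; [|nra].
      rewrite <- (pow1 n). apply pow_incr. split; [apply Cmod_ge_0|lra]. }
    assert (Cmod x * (s * (1 - Cmod p ^ n)) <= Rmax r 0 * s)%R
      by (apply Rmult_le_compat; lra).
    destruct (Rle_lt_or_eq_dec _ _ H1) as [H'|H'].
    + left. now apply exp_increasing.
    + rewrite H'. lra.
Qed.

(** By the inequality [prod (1 - t_j) >= 1 - sum t_j]. *)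
Lemma qpoch_near_1 (x : C) (n : nat) :
  (Cmod x * s <= 1 / 2)%R -> (1 / 2 <= Cmod (qpoch x p n))%R.
Proof.
  intros Hx.
  assert (H : (1 - Cmod x * (s * (1 - Cmod p ^ n)) <= Cmod (qpoch x p n))%R).
  { induction n as [|n IH].
    - simpl. rewrite Cmod_1. lra.
    - rewrite qpoch_S, Cmod_mult, geom_partial.
      assert (H1 : (1 - Cmod x * Cmod p ^ n <= Cmod (1 - x * p ^ n))%R).
      { eapply Rle_trans; [|apply Cmod_triangle_rev].
        rewrite Cmod_1, Cmod_mult, Cmod_pow. lra. }
      assert (H0 := Cmod_ge_0 x).
      assert (H2 := geom_partial_le n).
      assert (H2' := geom_partial_le (S n)).
      rewrite geom_partial in H2'.
      assert (Hn : (0 <= Cmod p ^ n)%R) by apply pow_le, Cmod_ge_0.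
      assert (Hn1 : (0 <= s * (1 - Cmod p ^ n))%R).
      { assert (Cmod p ^ n <= 1)%R; [|pose proof inv_gap_pos; nra].
        rewrite <- (pow1 n). apply pow_incr. split; [apply Cmod_ge_0|lra]. }
      set (u := (s * (1 - Cmod p ^ n))%R) in *.
      set (v := (Cmod p ^ n)%R) in *.
      assert (Cmod x * u <= Cmod x * s)%R by (apply Rmult_le_compat_l; lra).
      assert (Cmod x * v <= Cmod x * s)%R by (apply Rmult_le_compat_l; lra).
      assert (0 <= Cmod x * u)%R by nra. assert (0 <= Cmod x * v)%R by nra.
      apply Rle_trans with ((1 - Cmod x * u) * (1 - Cmod x * v))%R; [nra|].
      apply Rmult_le_compat; lra. }
  assert (H0 := Cmod_ge_0 x).
  assert (H2 := geom_partial_le n).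
  assert (Cmod x * (s * (1 - Cmod p ^ n)) <= Cmod x * s)%R
    by (apply Rmult_le_compat_l; lra).
  lra.
Qed.

Lemma shift_small (x : C) (eps : R) :
  (0 < eps)%R -> exists n, (Cmod (x * p ^ n) <= eps)%R.
Proof.
  intros He.
  assert (H := Clim_scal x _ _ (Clim_geom p Hp)).
  destruct (H eps He) as [N HN]. exists N.
  specialize (HN N (le_n _)). replace (x * p ^ N) with (x * p ^ N - x * 0) by ring.
  lra.
Qed.

(** A product without zero factors is bounded away from zero, because its
    tail is and the factors split off are bounded. *)
Lemma qpoch_away (x : C) :
  (forall j, 1 - x * p ^ j <> 0) ->
  exists c, (0 < c)%R /\ forall n, (c <= Cmod (qpoch x p n))%R.
Proof.
  intros Hx. assert (Hs := inv_gap_pos).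
  destruct (shift_small x (/ (2 * s))) as [n0 Hn0].
  { apply Rinv_0_lt_compat. lra. }
  assert (Ht : (Cmod (x * p ^ n0) * s <= 1 / 2)%R).
  { apply Rle_trans with (/ (2 * s) * s)%R.
    - apply Rmult_le_compat_r; lra.
    - right. field. lra. }
  destruct (qpoch_bound (Cmod x)) as [M [HM1 HM]].
  assert (Hq : (0 < Cmod (qpoch x p n0))%R).
  { apply Cmod_gt_0, qpoch_neq_0. auto. }
  exists (Cmod (qpoch x p n0) * (1 / 2) * / M)%R. split.
  { apply Rmult_lt_0_compat; [lra|]. apply Rinv_0_lt_compat. lra. }
  intros n. destruct (Nat.le_gt_cases n0 n) as [H|H].
  - replace n with (n0 + (n - n0))%nat by lia.
    rewrite qpoch_add, Cmod_mult, Rmult_assoc.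
    apply Rmult_le_compat_l; [lra|].
    apply Rle_trans with (1 / 2)%R; [|now apply qpoch_near_1].
    apply Rle_trans with (1 / 2 * / 1)%R; [|lra].
    apply Rmult_le_compat_l; [lra|]. apply Rinv_le_contravar; lra.
  - replace (Cmod (qpoch x p n0))
      with (Cmod (qpoch x p n) * Cmod (qpoch (x * p ^ n) p (n0 - n)))%R.
    2:{ rewrite <- Cmod_mult, <- qpoch_add. do 2 f_equal. lia. }
    assert (Hb : (Cmod (qpoch (x * p ^ n) p (n0 - n)) <= M)%R).
    { apply HM. rewrite Cmod_mult, Cmod_pow.
      rewrite <- (Rmult_1_r (Cmod x)) at 2.
      apply Rmult_le_compat_l; [apply Cmod_ge_0|].
      rewrite <- (pow1 n). apply pow_incr. split; [apply Cmod_ge_0|lra]. }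
    assert (H1 := Cmod_ge_0 (qpoch x p n)).
    assert (H2 := Cmod_ge_0 (qpoch (x * p ^ n) p (n0 - n))).
    assert (Hi : (0 < / M)%R) by (apply Rinv_0_lt_compat; lra).
    assert (Hi1 : (Cmod (qpoch (x * p ^ n) p (n0 - n)) * / M <= 1)%R).
    { apply Rle_trans with (M * / M)%R; [nra|]. right. field. lra. }
    assert (0 <= Cmod (qpoch (x * p ^ n) p (n0 - n)) * / M)%R by nra.
    nra.
Qed.

Lemma qpoch_diff_le (x : C) (M : R) (n : nat) :
  (forall m, (Cmod (qpoch x p m) <= M)%R) ->
  (Cmod (qpoch x p n - 1) <= Cmod x * M * s)%R.
Proof.
  intros HM.
  assert (H0 := Cmod_ge_0 x).
  assert (HM0 : (0 <= M)%R).
  { eapply Rle_trans; [apply Cmod_ge_0|apply (HM 0%nat)]. }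
  assert (H : (Cmod (qpoch x p n - 1)
               <= Cmod x * M * (s * (1 - Cmod p ^ n)))%R).
  { induction n as [|n IH].
    - simpl. replace (1 - 1) with (RtoC 0) by ring. rewrite Cmod_0. lra.
    - rewrite qpoch_S, geom_partial.
      replace (qpoch x p n * (1 - x * p ^ n) - 1)
        with ((qpoch x p n - 1) - x * qpoch x p n * p ^ n) by ring.
      eapply Rle_trans; [apply Cmod_triangle_minus|].
      rewrite Rmult_plus_distr_l.
      apply Rplus_le_compat; [exact IH|].
      rewrite !Cmod_mult, Cmod_pow.
      apply Rmult_le_compat_r; [apply pow_le, Cmod_ge_0|].
      apply Rmult_le_compat_l; [exact H0|apply HM]. }
  eapply Rle_trans; [exact H|].
  apply Rmult_le_compat_l; [nra|apply geom_partial_le].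
Qed.

(** The partial products differ by [- x p^n (x;p)_n], which is bounded
    geometrically. *)
Lemma qpoch_inf_Clim (x : C) : Clim (qpoch x p) (qpoch_inf x p).
Proof.
  assert (E : exists l, Clim (qpoch x p) l).
  { destruct (qpoch_bound (Cmod x)) as [M [HM1 HM]].
    specialize (HM x (Rle_refl _)).
    destruct (Ceq_dec p 0) as [E0|E0].
    { exists (1 - x). apply Clim_ext_from with (fun _ => 1 - x) 1%nat;
        [|apply Clim_const].
      intros [|n] Hn; [lia|]. clear Hn. induction n as [|n IH].
      - simpl. ring.
      - rewrite qpoch_S, <- IH, E0, Cpow_S. ring. }
    destruct (geom_bound_Clim (fun n => - x * p ^ n * qpoch x p n)
                (Cmod x * M) (Cmod p)) as [t Ht].
    - split; [now apply Cmod_gt_0|exact Hp].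
    - intros i. rewrite !Cmod_mult, Cmod_opp, Cmod_pow.
      rewrite !Rmult_assoc. apply Rmult_le_compat_l; [apply Cmod_ge_0|].
      rewrite Rmult_comm. apply Rmult_le_compat_r; [apply pow_le, Cmod_ge_0|].
      apply HM.
    - exists (1 + t).
      apply Clim_ext with
        (fun n => 1 + csum (fun n => - x * p ^ n * qpoch x p n) n).
      + induction n as [|n IH]; [simpl; ring|].
        rewrite csum_S, qpoch_S, <- IH. ring.
      + apply Clim_plus; [apply Clim_const|exact Ht]. }
  destruct E as [l Hl].
  replace (qpoch_inf x p) with l; [exact Hl|].
  symmetry. unfold qpoch_inf.
  apply (iota_unique (V := C_CompleteNormedModule)).
  - intros y Hy. apply Clim_filterlim in Hy. eapply Clim_unique; eauto.
  - now apply Clim_filterlim.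
Qed.

Lemma qpoch_inf_split (x : C) (n : nat) :
  qpoch_inf x p = qpoch x p n * qpoch_inf (x * p ^ n) p.
Proof.
  apply (Clim_unique (fun m => qpoch x p (n + m))).
  - apply (Clim_subseq (qpoch x p) (fun m => (n + m)%nat));
      [intros; lia|apply qpoch_inf_Clim].
  - apply Clim_ext with (fun m => qpoch x p n * qpoch (x * p ^ n) p m).
    + intros m. symmetry. apply qpoch_add.
    + apply Clim_scal, qpoch_inf_Clim.
Qed.

Lemma qpoch_inf_S (x : C) :
  qpoch_inf x p = (1 - x) * qpoch_inf (x * p) p.
Proof.
  rewrite (qpoch_inf_split x 1), Cpow_1_r. simpl. ring.
Qed.

Lemma qpoch_inf_neq_0 (x : C) :
  (forall j, 1 - x * p ^ j <> 0) -> qpoch_inf x p <> 0.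
Proof.
  intros H. destruct (qpoch_away x H) as [c [Hc Hb]].
  apply Cmod_gt_0. apply Rlt_le_trans with c; [exact Hc|].
  eapply Clim_Cmod_ge; [apply qpoch_inf_Clim|exact Hb].
Qed.

Lemma qpoch_inf_shift_Clim (x : C) :
  Clim (fun m => qpoch_inf (x * p ^ m) p) 1.
Proof.
  destruct (qpoch_bound (Cmod x)) as [M [HM1 HM]].
  apply Clim_squeeze with (fun m => (Cmod (x * p ^ m - x * 0) * (M * s))%R).
  - intros m. apply Clim_Cmod_le with (qpoch (x * p ^ m) p);
      [apply qpoch_inf_Clim|].
    intros n. replace (x * p ^ m - x * 0) with (x * p ^ m) by ring.
    rewrite <- Rmult_assoc. apply qpoch_diff_le. intros k. apply HM.
    rewrite Cmod_mult, Cmod_pow.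
    rewrite <- (Rmult_1_r (Cmod x)) at 2.
    apply Rmult_le_compat_l; [apply Cmod_ge_0|].
    rewrite <- (pow1 m). apply pow_incr. split; [apply Cmod_ge_0|lra].
  - replace (Finite 0) with (Finite (0 * (M * s))%R) by (f_equal; ring).
    apply is_lim_seq_mult'; [|apply is_lim_seq_const].
    apply Clim_is_lim_seq. apply Clim_scal. now apply Clim_geom.
Qed.

End Product.

Lemma Cmod_sqr_lt_1 (q : C) : (Cmod q < 1)%R -> (Cmod (q ^ 2) < 1)%R.
Proof.
  intros H. rewrite Cmod_pow. assert (H0 := Cmod_ge_0 q). simpl. nra.
Qed.

Lemma qpoch_inf_double (x q : C) :
  (Cmod q < 1)%R ->
  qpoch_inf x q = qpoch_inf x (q ^ 2) * qpoch_inf (x * q) (q ^ 2).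
Proof.
  intros Hq. assert (Hq2 := Cmod_sqr_lt_1 q Hq).
  apply (Clim_unique (fun m => qpoch x q (2 * m))).
  - apply (Clim_subseq (qpoch x q) (fun m => (2 * m)%nat));
      [intros; lia|now apply qpoch_inf_Clim].
  - eapply Clim_ext; [intros m; symmetry; apply qpoch_double|].
    apply Clim_mult; now apply qpoch_inf_Clim.
Qed.

Lemma qpoch_inf_pm (x q : C) :
  (Cmod q < 1)%R ->
  qpoch_inf x q * qpoch_inf (- x) q = qpoch_inf (x ^ 2) (q ^ 2).
Proof.
  intros Hq. assert (Hq2 := Cmod_sqr_lt_1 q Hq).
  apply (Clim_unique (fun m => qpoch x q m * qpoch (- x) q m)).
  - apply Clim_mult; now apply qpoch_inf_Clim.
  - eapply Clim_ext; [intros m; symmetry; apply qpoch_pm|].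
    now apply qpoch_inf_Clim.
Qed.

(** * A well-poised Bailey pair *)

Lemma C1_neq_0 : RtoC 1 <> 0.
Proof. intros E. injection E. lra. Qed.

Lemma Cmult_cancel_l (c x y : C) : c * x = c * y -> c <> 0 -> x = y.
Proof.
  intros E Hc. replace x with (/ c * (c * x)) by (field; exact Hc).
  rewrite E. field. exact Hc.
Qed.

Lemma one_minus_neq_0 (x : C) : (Cmod x < 1)%R -> 1 - x <> 0.
Proof.
  intros Hx E. replace x with (RtoC 1) in Hx.
  - rewrite Cmod_1 in Hx. lra.
  - replace (RtoC 1) with (1 - x + x) by ring. rewrite E. ring.
Qed.

Lemma one_minus_qpow_neq_0 (q : C) (j : nat) :
  (Cmod q < 1)%R -> 1 - q * q ^ j <> 0.
Proof.
  intros Hq. apply one_minus_neq_0. rewrite Cmod_mult, Cmod_pow.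
  assert (H0 := Cmod_ge_0 q).
  assert (Cmod q ^ j <= 1)%R.
  { rewrite <- (pow1 j). apply pow_incr. lra. }
  assert (0 <= Cmod q ^ j)%R by (apply pow_le; lra). nra.
Qed.

Lemma qpoch_qq_neq_0 (q : C) (n : nat) : (Cmod q < 1)%R -> qpoch q q n <> 0.
Proof. intros Hq. apply qpoch_neq_0. intros. now apply one_minus_qpow_neq_0. Qed.

(* Closes [1 - v <> 0] by [H : 1 - u <> 0] when [u = v] by ring after expanding
   the exponents. *)
Ltac nz_from H :=
  let E := fresh in
  assert (E := H);
  match type of E with
  | Cminus _ ?u <> _ =>
      match goal with
      | |- Cminus _ ?v <> _ =>
          replace v with u;
          [exact E|rewrite ?Cpow_S, ?Cpow_add_r, ?Cpow_S; ring]
      end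
  end.

(* [field] with the shifted factorials and the symbolic powers as atoms. *)
Ltac qatoms :=
  repeat match goal with
  | |- context [qpoch ?x ?p ?n] => generalize dependent (qpoch x p n); intros
  end;
  repeat match goal with
  | |- context [Cpow ?c ?n] =>
      lazymatch n with
      | O => fail
      | S _ => fail
      | _ => generalize dependent (Cpow c n); intros
      end
  end.

Ltac qfield := qatoms; field; repeat split; auto using C1_neq_0.

(** Up to a factor free of [j], the general term of
    [3phi2(q^-n, A, B; e A B, q^(1-n)/e; q, q)], with the negative powers of [q]
    turned over. *)
Definition saal_term (q e A B : C) (n j : nat) : C :=
  qpoch e q (n - j) * e ^ j * qpoch A q j * qpoch B q j
  / (qpoch q q (n - j) * qpoch q q j * qpoch (e * A * B) q j).

Section Bailey.

Variable q : C.
Hypothesis Hq : (Cmod q < 1)%R.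

(** The recurrence in [n = d + J] that the value of the sum satisfies, applied
    under the summation sign, telescopes in [j]. Writing [n] as a sum keeps
    the subtractions [n - j] exact. *)
Lemma saal_partial (e A B : C) (J d : nat) :
  (forall j, (j < S (d + J))%nat -> 1 - e * A * B * q ^ j <> 0) ->
  csum (fun j => (1 - q * q ^ (d + J)) * (1 - e * A * B * q ^ (d + J))
                   * saal_term q e A B (S (d + J)) j
                 - (1 - e * A * q ^ (d + J)) * (1 - e * B * q ^ (d + J))
                   * saal_term q e A B (d + J) j) (S J)
  = - (q ^ d * e * (1 - A * q ^ J) * (1 - B * q ^ J) * saal_term q e A B (d + J) J).
Proof.
  revert d. induction J as [|J IH]; intros d HC; unfold saal_term in *.
  - rewrite csum_S. cbn [csum]. rewrite Nat.add_0_r, !Nat.sub_0_r, !qpoch_S.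
    cbn [qpoch Cpow].
    assert (H1 := qpoch_qq_neq_0 q d Hq).
    assert (H2 := one_minus_qpow_neq_0 q d Hq).
    qfield.
  - rewrite csum_S.
    replace (d + S J)%nat with (S d + J)%nat in * by lia.
    rewrite IH by exact HC. clear IH.
    replace (S (S d + J) - S J)%nat with (S d) by lia.
    replace (S d + J - S J)%nat with d by lia.
    replace (S d + J - J)%nat with (S d) by lia.
    assert (H1 := qpoch_qq_neq_0 q d Hq).
    assert (H2 := one_minus_qpow_neq_0 q d Hq).
    assert (H3 := qpoch_qq_neq_0 q J Hq).
    assert (H4 := one_minus_qpow_neq_0 q J Hq).
    assert (H5 : qpoch (e * A * B) q J <> 0).
    { apply qpoch_neq_0. intros j Hj. apply HC. lia. }
    assert (H6 : 1 - e * A * B * q ^ J <> 0) by (apply HC; lia).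
    rewrite !qpoch_S, !Cpow_add_r, !Cpow_S.
    qfield.
Qed.

(** The q-Pfaff-Saalschuetz sum: both sides satisfy the same first-order
    recurrence in [n]. *)
Lemma saalschutz (e A B : C) (n : nat) :
  (forall j, (j < n)%nat -> 1 - e * A * B * q ^ j <> 0) ->
  csum (saal_term q e A B n) (S n)
  = qpoch (e * A) q n * qpoch (e * B) q n
    / (qpoch q q n * qpoch (e * A * B) q n).
Proof.
  induction n as [|n IH]; intros HC.
  - unfold saal_term. cbn [csum qpoch Nat.sub Cpow]. field.
  - assert (HP := saal_partial e A B n 0 HC). cbn [Nat.add Cpow] in HP.
    rewrite (csum_ext _ (fun j => (1 - q * q ^ n) * (1 - e * A * B * q ^ n)
                                    * saal_term q e A B (S n) j
       + (- ((1 - e * A * q ^ n) * (1 - e * B * q ^ n)) * saal_term q e A B n j)))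
      in HP by (intros; ring).
    rewrite csum_plus, !csum_scal, IH in HP by (intros; apply HC; lia).
    rewrite csum_S.
    assert (H1 := qpoch_qq_neq_0 q n Hq).
    assert (H2 := one_minus_qpow_neq_0 q n Hq).
    assert (H5 : qpoch (e * A * B) q n <> 0).
    { apply qpoch_neq_0. intros j Hj. apply HC. lia. }
    assert (H6 : 1 - e * A * B * q ^ n <> 0) by (apply HC; lia).
    replace (csum (saal_term q e A B (S n)) (S n)) with
      (((1 - e * A * q ^ n) * (1 - e * B * q ^ n) *
         (qpoch (e * A) q n * qpoch (e * B) q n
          / (qpoch q q n * qpoch (e * A * B) q n))
        - (1 * e * (1 - A * q ^ n) * (1 - B * q ^ n) * saal_term q e A B n n))
       / ((1 - q * q ^ n) * (1 - e * A * B * q ^ n))).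
    2:{ apply (Cmult_cancel_l ((1 - q * q ^ n) * (1 - e * A * B * q ^ n)));
          [|now apply Cmult_neq_0].
        replace ((1 - q * q ^ n) * (1 - e * A * B * q ^ n)
                 * csum (saal_term q e A B (S n)) (S n))
          with ((1 - q * q ^ n) * (1 - e * A * B * q ^ n)
                 * csum (saal_term q e A B (S n)) (S n)
                + - ((1 - e * A * q ^ n) * (1 - e * B * q ^ n)) *
                  (qpoch (e * A) q n * qpoch (e * B) q n
                   / (qpoch q q n * qpoch (e * A * B) q n))
                + ((1 - e * A * q ^ n) * (1 - e * B * q ^ n)) *
                  (qpoch (e * A) q n * qpoch (e * B) q n
                   / (qpoch q q n * qpoch (e * A * B) q n))) by ring.
        rewrite HP. qfield. }
    unfold saal_term. rewrite !Nat.sub_diag, !qpoch_S, !Cpow_S.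
    cbn [qpoch].
    clear HP. qfield.
Qed.

(** A pair [(alpha, beta)] with [beta_n = sum_r wp_kernel a k n r * alpha_r] is a
    well-poised Bailey pair relative to [(a, k)]. *)
Definition wp_kernel (a k : C) (n r : nat) : C :=
  qpoch (k / a) q (n - r) * qpoch k q (n + r)
  / (qpoch q q (n - r) * qpoch (a * q) q (n + r)).

(** The [alpha] that belongs to [beta = (1, 0, 0, ...)] relative to [(a, m)]. *)
Definition unit_alpha (a m : C) (r : nat) : C :=
  (1 - a * (q ^ r) ^ 2) / (1 - a)
  * (qpoch a q r * qpoch (a / m) q r / (qpoch q q r * qpoch (m * q) q r))
  * (m / a) ^ r.

Lemma unit_partial (a m : C) (r d : nat) :
  a <> 0 -> m <> 0 -> 1 - a <> 0 ->
  (forall i, (i < S d + r + r)%nat -> 1 - a * q * q ^ i <> 0) ->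
  (forall i, (i < r)%nat -> 1 - m * q * q ^ i <> 0) ->
  (1 - q ^ (S d + r)) * (1 - m * q ^ (S d + r))
  * csum (fun i => wp_kernel a m (S d + r) i * unit_alpha a m i) (S r)
  = qpoch (m / a) q (S d) * qpoch m q (S (S d + r + r)) * qpoch (a * q) q r
    * qpoch (a * q / m) q r * (m / a) ^ r
    / (qpoch q q d * qpoch (a * q) q (S d + r + r) * qpoch q q r
       * qpoch (m * q) q r).
Proof.
  intros Ha Hm H1a. revert d.
  induction r as [|r IH]; intros d HA HM; unfold wp_kernel, unit_alpha in *.
  - rewrite csum_S. cbn [csum]. rewrite !Nat.add_0_r, !Nat.sub_0_r, !qpoch_S.
    cbn [qpoch].
    assert (H1 := qpoch_qq_neq_0 q d Hq).
    assert (H2 := one_minus_qpow_neq_0 q d Hq).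
    assert (H3 : qpoch (a * q) q d <> 0)
      by (apply qpoch_neq_0; intros; apply HA; lia).
    assert (H4 : 1 - a * q * q ^ d <> 0) by (apply HA; lia).
    rewrite !Cpow_S. cbn [Cpow].
    qfield.
  - rewrite csum_S, Cmult_plus_distr_l.
    replace (S d + S r)%nat with (S (S d) + r)%nat by lia.
    rewrite IH by (intros; (apply HA || apply HM); lia). clear IH.
    replace (S (S d) + r - S r)%nat with (S d) by lia.
    replace (S (S d) + r + S r)%nat with (S (S (S d) + r + r)) by lia.
    set (N := (S d + r + r)%nat).
    replace (S (S d) + r + r)%nat with (S N) by (unfold N; lia).
    assert (H1 := qpoch_qq_neq_0 q d Hq).
    assert (H2 := one_minus_qpow_neq_0 q d Hq).
    assert (H3 := qpoch_qq_neq_0 q r Hq).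
    assert (H4 := one_minus_qpow_neq_0 q r Hq).
    assert (H5 : qpoch (a * q) q N <> 0)
      by (apply qpoch_neq_0; intros; apply HA; unfold N in *; lia).
    assert (H6 : 1 - a * q * q ^ N <> 0) by (apply HA; unfold N; lia).
    assert (H6' : 1 - a * q * q ^ S N <> 0) by (apply HA; unfold N; lia).
    assert (H7 : qpoch (m * q) q r <> 0)
      by (apply qpoch_neq_0; intros; apply HM; lia).
    assert (H8 : 1 - m * q * q ^ r <> 0) by (apply HM; lia).
    (* Split off on the left, these leave the [(a q;q)_r] and [(a q/m;q)_r] of
       the induction hypothesis. *)
    rewrite (qpoch_S_l a q r), (qpoch_S_l (a / m) q r).
    replace (a / m * q) with (a * q / m) by (field; auto).
    rewrite !qpoch_S, !Cpow_add_r, !Cpow_S in *.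
    replace (q ^ N) with (q * q ^ d * (q ^ r * q ^ r)) in *
      by (unfold N; rewrite !Cpow_add_r, Cpow_S; ring).
    qfield.
Qed.

(** The unit Bailey pair: all partial sums being products, the full sum is a
    product with a zero factor. *)
Lemma unit_orthogonality (a m : C) (n : nat) :
  a <> 0 -> m <> 0 -> 1 - a <> 0 -> (0 < n)%nat ->
  (forall i, (i < 2 * n)%nat -> 1 - a * q * q ^ i <> 0) ->
  (forall i, (i < S n)%nat -> 1 - m * q * q ^ i <> 0) ->
  csum (fun r => wp_kernel a m n r * unit_alpha a m r) (S n) = 0.
Proof.
  intros Ha Hm H1a Hn HA HM. destruct n as [|r]; [lia|]. clear Hn.
  assert (HP := unit_partial a m r 0 Ha Hm H1a
                  ltac:(intros; apply HA; lia) ltac:(intros; apply HM; lia)).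
  cbn [Nat.add] in HP.
  assert (H4 := one_minus_qpow_neq_0 q r Hq). rewrite <- Cpow_S in H4.
  assert (H9 : 1 - m * q ^ S r <> 0).
  { rewrite Cpow_S, Cmult_assoc. apply HM. lia. }
  apply (Cmult_cancel_l ((1 - q ^ S r) * (1 - m * q ^ S r)));
    [|now apply Cmult_neq_0].
  rewrite csum_S, Cmult_plus_distr_l, HP. clear HP.
  unfold wp_kernel, unit_alpha. rewrite Nat.sub_diag.
  replace (S r + S r)%nat with (S (S (r + r))) by lia.
  assert (H3 := qpoch_qq_neq_0 q r Hq).
  set (N := (r + r)%nat).
  assert (H5 : qpoch (a * q) q N <> 0)
    by (apply qpoch_neq_0; intros; apply HA; unfold N in *; lia).
  assert (H6 : 1 - a * q * q ^ N <> 0) by (apply HA; unfold N; lia).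
  assert (H6' : 1 - a * q * q ^ S N <> 0) by (apply HA; unfold N; lia).
  assert (H7 : qpoch (m * q) q r <> 0)
    by (apply qpoch_neq_0; intros; apply HM; lia).
  assert (H8 : 1 - m * q * q ^ r <> 0) by (apply HM; lia).
  rewrite (qpoch_S_l a q r), (qpoch_S_l (a / m) q r).
  replace (a / m * q) with (a * q / m) by (field; auto).
  rewrite !qpoch_S, !Cpow_S in *. cbn [qpoch Cpow].
  replace (q ^ N) with (q ^ r * q ^ r) in *
    by (unfold N; rewrite !Cpow_add_r; ring).
  qfield.
Qed.

(** With [m = q a^2/k] this is [unit_alpha a m r] times
    [(m;q)_(2r) / (k;q)_(2r) * (k/m)^r], the factor that a change of the
    kernel from [m] to [k] calls for. *)
Definition quad_alpha (a k : C) (r : nat) : C :=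
  (1 - a * (q ^ r) ^ 2) / (1 - a)
  * (qpoch a q r * qpoch (k / (a * q)) q r
     / (qpoch q q r * qpoch (a ^ 2 * q ^ 2 / k) q r))
  * (qpoch (q * a ^ 2 / k) q (2 * r) / qpoch k q (2 * r))
  * (k / a) ^ r.

(** The condition [k m = q a^2] is what makes the sum over [j] balanced, hence
    a q-Saalschuetz sum. *)
Lemma wp_kernel_change (a k m : C) (n r : nat) :
  a <> 0 -> k <> 0 -> m <> 0 -> k * m = q * a ^ 2 -> (r <= n)%nat ->
  (forall i, (i < 2 * n)%nat -> 1 - a * q * q ^ i <> 0) ->
  (forall i, 1 - k * q ^ i <> 0) ->
  wp_kernel a k n r * (qpoch m q (2 * r) / qpoch k q (2 * r)) * (k / m) ^ r
  = csum (fun j => qpoch (k / m) q (n - (r + j)) / qpoch q q (n - (r + j))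
                   * (k / m) ^ (r + j) * wp_kernel a m (r + j) r) (S (n - r)).
Proof.
  intros Ha Hk Hm Hkm Hr HA HK.
  assert (E : k / m * (m / a) * (m * q ^ (2 * r)) = a * q * q ^ (2 * r)).
  { replace (k / m * (m / a) * (m * q ^ (2 * r)))
      with (k * m * q ^ (2 * r) / a) by (field; auto).
    rewrite Hkm. field. auto. }
  assert (HS := saalschutz (k / m) (m / a) (m * q ^ (2 * r)) (n - r)).
  rewrite E in HS.
  specialize (HS ltac:(intros j Hj; rewrite <- Cmult_assoc, <- Cpow_add_r;
                       apply HA; lia)).
  replace (k / m * (m / a)) with (k / a) in HS by (field; auto).
  replace (k / m * (m * q ^ (2 * r))) with (k * q ^ (2 * r)) in HS by (field; auto).
  assert (H1 : qpoch (a * q) q (2 * r) <> 0)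
    by (apply qpoch_neq_0; intros; apply HA; lia).
  assert (H2 : qpoch k q (2 * r) <> 0) by (apply qpoch_neq_0; auto).
  assert (H3 := qpoch_qq_neq_0 q (n - r) Hq).
  assert (H4 : qpoch (a * q * q ^ (2 * r)) q (n - r) <> 0).
  { apply qpoch_neq_0. intros. rewrite <- Cmult_assoc, <- Cpow_add_r.
    apply HA. lia. }
  transitivity ((k / m) ^ r * (qpoch m q (2 * r) / qpoch (a * q) q (2 * r))
                * csum (saal_term q (k / m) (m / a) (m * q ^ (2 * r)) (n - r))
                    (S (n - r))).
  - rewrite HS. unfold wp_kernel.
    replace (n + r)%nat with (2 * r + (n - r))%nat by lia.
    rewrite !qpoch_add. qfield.
  - rewrite <- csum_scal. apply csum_ext. intros j Hj.
    unfold saal_term, wp_kernel. rewrite E.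
    replace (n - (r + j))%nat with (n - r - j)%nat by lia.
    replace (r + j - r)%nat with j by lia.
    replace (r + j + r)%nat with (2 * r + j)%nat by lia.
    rewrite !qpoch_add, Cpow_add_r.
    assert (H5 : qpoch (a * q * q ^ (2 * r)) q j <> 0).
    { apply qpoch_neq_0. intros. rewrite <- Cmult_assoc, <- Cpow_add_r.
      apply HA. lia. }
    assert (H6 := qpoch_qq_neq_0 q (n - r - j) Hq).
    assert (H7 := qpoch_qq_neq_0 q j Hq).
    qfield.
Qed.

(** The change of the kernel carries the unit pair to this one: in the double
    sum that results, orthogonality leaves a single term. *)
Lemma quad_bailey_pair (a k : C) (n : nat) :
  q <> 0 -> a <> 0 -> k <> 0 -> 1 - a <> 0 ->
  (forall i, (i < 2 * n)%nat -> 1 - a * q * q ^ i <> 0) ->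
  (forall i, 1 - k * q ^ i <> 0) ->
  (forall i, 1 - a ^ 2 * q ^ 2 / k * q ^ i <> 0) ->
  csum (fun r => wp_kernel a k n r * quad_alpha a k r) (S n)
  = qpoch (k ^ 2 / (q * a ^ 2)) q n / qpoch q q n.
Proof.
  intros Hq0 Ha Hk H1a HA HK HM.
  set (m := q * a ^ 2 / k).
  assert (Ha2 : a ^ 2 <> 0) by now apply Cpow_nz.
  assert (Hm : m <> 0).
  { unfold m. intros E.
    apply (Cmult_neq_0 q (a ^ 2) Hq0 Ha2).
    replace (q * a ^ 2) with (q * a ^ 2 / k * k) by (field; auto).
    rewrite E. ring. }
  assert (Hkm : k * m = q * a ^ 2) by (unfold m; field; auto).
  assert (Emq : m * q = a ^ 2 * q ^ 2 / k) by (unfold m; field; auto).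
  assert (Eam : a / m = k / (a * q)) by (unfold m; field; auto).
  set (f := fun n' r => qpoch (k / m) q (n - n') / qpoch q q (n - n')
                   * (k / m) ^ n' * (wp_kernel a m n' r * unit_alpha a m r)).
  transitivity (csum (fun n' => csum (fun r => f n' r) (S n')) (S n)).
  - rewrite csum_triangle. apply csum_ext. intros r Hr.
    transitivity (unit_alpha a m r *
      (wp_kernel a k n r * (qpoch m q (2 * r) / qpoch k q (2 * r))
        * (k / m) ^ r)).
    + unfold quad_alpha, unit_alpha. fold m. rewrite Emq, Eam.
      replace ((k / a) ^ r) with ((m / a) ^ r * (k / m) ^ r).
      2:{ rewrite <- Cpow_mult_l. f_equal. field. auto. }
      unfold Cdiv. ring.
    + rewrite (wp_kernel_change a k m n r) by (auto; lia).
      rewrite <- csum_scal. replace (S n - r)%nat with (S (n - r)) by lia.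
      apply csum_ext. intros j Hj. unfold f. ring.
  - rewrite csum_S_l, (csum_zero (fun i => csum (fun r => f (S i) r) (S (S i)))).
    + replace (k ^ 2 / (q * a ^ 2)) with (k / m) by (unfold m; field; auto).
      unfold f, wp_kernel, unit_alpha. rewrite Nat.sub_0_r.
      cbn [csum qpoch Nat.sub Nat.add Cpow].
      assert (H1 := qpoch_qq_neq_0 q n Hq). qfield.
    + intros i Hi. unfold f. rewrite csum_scal, unit_orthogonality; auto.
      * ring.
      * lia.
      * intros j Hj. apply HA. lia.
      * intros j Hj. rewrite Emq. apply HM.
Qed.

End Bailey.

(** * The summation theorem of q-Watson type: telescoping in [z] *)

(** [(1/z;q)_n (- q z)^n], which stays meaningful at [z = 0]. *)
Fixpoint hpoch (q z : C) (n : nat) : C :=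
  match n with
  | O => 1
  | S m => hpoch q z m * (q * (q ^ m - z))
  end.

(** [(a q;q^2)_n / (a q;q)_n] with the common factor [1 - a q] cancelled, so
    that the value [a = 1/q] is admitted. *)
Definition reg_ratio (q a : C) (n : nat) : C :=
  match n with
  | O => 1
  | S m => qpoch (a * q ^ 3) (q ^ 2) m / qpoch (a * q ^ 2) q m
  end.

(** With [k = z A B] and [a = z^2 A B], the general term of the very-well-poised
    series [8W7(k; A, B, 1/z, sqrt(a q), - sqrt(a q); q, - q z)]. *)
Definition watson_term (q z A B : C) (n : nat) : C :=
  (1 - z * A * B * (q ^ n) ^ 2) / (1 - z * A * B)
  * qpoch (z * A * B) q n * reg_ratio q (z ^ 2 * A * B) n
  / (qpoch (q * z * A) q n * qpoch (q * z * B) q n)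
  * hpoch q z n
  * (qpoch A q n * qpoch B q n / (qpoch q q n * qpoch (q * (A * B)) (q ^ 2) n)).

(** The contiguous relation between the series at [z] and at [q z] telescopes;
    these hypergeometric terms are its partial sums. *)
Definition watson_cert (q z A B : C) (n : nat) : C :=
  q * z * (1 - q ^ 3 * (z ^ 2 * A * B) * z * q ^ n)
  * qpoch (q * (z * A * B)) q n * qpoch (z ^ 2 * A * B * q ^ 3) (q ^ 2) n
  / ((1 - q * (z * A * B)) * qpoch q q n * qpoch (q * (A * B)) (q ^ 2) n
     * qpoch (z ^ 2 * A * B * q ^ 3) q n
     * qpoch (q * (q * z) * A) q n * qpoch (q * (q * z) * B) q n)
  * (qpoch A q (S n) * qpoch B q (S n) * hpoch q z n).

Lemma hpoch_shift (q z : C) (n : nat) :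
  hpoch q (q * z) (S n) = q * (1 - q * z) * q ^ n * hpoch q z n.
Proof.
  induction n as [|n IH].
  - cbn [hpoch Cpow]. ring.
  - change (hpoch q (q * z) (S (S n)))
      with (hpoch q (q * z) (S n) * (q * (q ^ S n - q * z))).
    rewrite IH. cbn [hpoch]. rewrite Cpow_S. ring.
Qed.

(** The ratios at [z] and at [q z] in terms of the same two products
    [(a q^3;q^2)_n] and [(a q^3;q)_n]. *)
Lemma reg_ratio_eq (q a : C) (n : nat) :
  1 - a * q ^ 2 <> 0 ->
  (forall j, (j < n)%nat -> 1 - a * q ^ 3 * q ^ j <> 0) ->
  reg_ratio q a (S n)
  = qpoch (a * q ^ 3) (q ^ 2) n * (1 - a * q ^ 2 * q ^ n)
    / ((1 - a * q ^ 2) * qpoch (a * q ^ 3) q n).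
Proof.
  intros H2 H3. cbn [reg_ratio].
  assert (E : qpoch (a * q ^ 2) q n * (1 - a * q ^ 2 * q ^ n)
              = (1 - a * q ^ 2) * qpoch (a * q ^ 3) q n).
  { rewrite <- qpoch_S, qpoch_S_l. do 2 f_equal. ring. }
  assert (Hn : qpoch (a * q ^ 3) q n <> 0) by now apply qpoch_neq_0.
  assert (Hp : qpoch (a * q ^ 2) q n <> 0).
  { apply qpoch_neq_0. intros [|j] Hj.
    - simpl (q ^ 0). now rewrite Cmult_1_r.
    - nz_from (H3 j ltac:(lia)). }
  rewrite <- E. field. split; [|exact Hp].
  intros E0. rewrite E0, Cmult_0_r in E.
  symmetry in E. revert E. now apply Cmult_neq_0.
Qed.

Lemma reg_ratio_eq' (q a : C) (n : nat) :
  (forall j, (j < S n)%nat -> 1 - a * q ^ 3 * q ^ j <> 0) ->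
  reg_ratio q (a * q ^ 2) (S n)
  = qpoch (a * q ^ 3) (q ^ 2) n * (1 - a * q ^ 3 * (q ^ n) ^ 2)
    / (qpoch (a * q ^ 3) q n * (1 - a * q ^ 3 * q ^ n)).
Proof.
  intros H3. cbn [reg_ratio].
  assert (H0 : 1 - a * q ^ 3 <> 0).
  { nz_from (H3 0%nat ltac:(lia)). }
  assert (E1 : qpoch (a * q ^ 3) (q ^ 2) n * (1 - a * q ^ 3 * (q ^ n) ^ 2)
     = (1 - a * q ^ 3) * qpoch (a * q ^ 2 * q ^ 3) (q ^ 2) n).
  { replace ((q ^ n) ^ 2) with ((q ^ 2) ^ n)
      by (rewrite <- !Cpow_mult_r; f_equal; lia).
    rewrite <- qpoch_S, qpoch_S_l. do 2 f_equal. ring. }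
  assert (E2 : qpoch (a * q ^ 3) q n * (1 - a * q ^ 3 * q ^ n)
     = (1 - a * q ^ 3) * qpoch (a * q ^ 2 * q ^ 2) q n).
  { rewrite <- qpoch_S, qpoch_S_l. do 2 f_equal. ring. }
  rewrite E1, E2. field. split; [|exact H0].
  intros E. rewrite E, Cmult_0_r in E2. revert E2.
  rewrite <- qpoch_S. now apply qpoch_neq_0.
Qed.

Section Watson.

Variable q : C.
Hypothesis Hq : (Cmod q < 1)%R.

Section Telescope.

Variables z A B : C.
Hypothesis HK : forall j, 1 - z * A * B * q ^ j <> 0.
Hypothesis HA : forall j, 1 - q * z * A * q ^ j <> 0.
Hypothesis HB : forall j, 1 - q * z * B * q ^ j <> 0.
Hypothesis HAB : forall j, 1 - q * (A * B) * (q ^ 2) ^ j <> 0.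
Hypothesis Ha2 : 1 - z ^ 2 * A * B * q ^ 2 <> 0.

Let k := z * A * B.
Let a := z ^ 2 * A * B.

Let L := (1 - q * z * A) * (1 - q * z * B) * (1 - a * q ^ 2) * (1 + q * z)
         / (1 - q * k).
Let R := (1 - q ^ 2 * z ^ 2 * A) * (1 - q ^ 2 * z ^ 2 * B).

Lemma watson_k_neq : 1 - z * A * B <> 0 /\ 1 - q * (z * A * B) <> 0.
Proof.
  split.
  - nz_from (HK 0%nat).
  - nz_from (HK 1%nat).
Qed.

(** All terms are rational multiples of one product, so that the induction
    step is an identity of rational functions of [q^n]. The factor [L] is the
    quotient of the normalizing products of the value at [z] and at [q z]. *)
Lemma watson_telescope (n : nat) :
  (forall j, (j < n)%nat -> 1 - a * q ^ 3 * q ^ j <> 0) ->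
  csum (fun i => L * watson_term q z A B i - R * watson_term q (q * z) A B i) (S n)
  = watson_cert q z A B n.
Proof.
  destruct watson_k_neq as [Hk0 Hk1].
  induction n as [|n IH]; intros H3.
  - unfold watson_term, watson_cert, L, R, k, a.
    cbn [csum qpoch hpoch reg_ratio Cpow].
    replace (q * z * A * B) with (q * (z * A * B)) by ring.
    field. auto.
  - rewrite csum_S, IH by (intros; apply H3; lia). clear IH.
    unfold watson_term, watson_cert.
    replace ((q * z) ^ 2 * A * B) with (z ^ 2 * A * B * q ^ 2) by ring.
    rewrite (reg_ratio_eq q (z ^ 2 * A * B)), (reg_ratio_eq' q (z ^ 2 * A * B));
      try (intros; apply H3; lia); [|exact Ha2].
    rewrite hpoch_shift.
    rewrite (qpoch_S_l (z * A * B)), (qpoch_S_l (q * z * A)),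
      (qpoch_S_l (q * z * B)).
    replace (z * A * B * q) with (q * (z * A * B)) by ring.
    replace (q * z * A * q) with (q * (q * z) * A) by ring.
    replace (q * z * B * q) with (q * (q * z) * B) by ring.
    replace (q * z * A * B) with (q * (z * A * B)) by ring.
    assert (H1 := qpoch_qq_neq_0 q n Hq).
    assert (H2 := one_minus_qpow_neq_0 q n Hq).
    assert (H4 : qpoch (q * (A * B)) (q ^ 2) n <> 0)
      by (apply qpoch_neq_0; intros; apply HAB).
    assert (H5 : 1 - q * (A * B) * (q ^ 2) ^ n <> 0) by apply HAB.
    assert (H6 : qpoch (z ^ 2 * A * B * q ^ 3) q n <> 0)
      by (apply qpoch_neq_0; intros; apply H3; lia).
    assert (H7 : 1 - z ^ 2 * A * B * q ^ 3 * q ^ n <> 0) by (apply H3; lia).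
    assert (H8 : forall j, 1 - q * (q * z) * A * q ^ j <> 0).
    { intros j. nz_from (HA (S j)). }
    assert (H9 : forall j, 1 - q * (q * z) * B * q ^ j <> 0).
    { intros j. nz_from (HB (S j)). }
    assert (H10 : qpoch (q * (q * z) * A) q n <> 0) by (apply qpoch_neq_0; auto).
    assert (H11 : qpoch (q * (q * z) * B) q n <> 0) by (apply qpoch_neq_0; auto).
    specialize (H8 n). specialize (H9 n).
    assert (H12 := HA 0). assert (H13 := HB 0).
    cbn [Cpow] in H12, H13. rewrite Cmult_1_r in H12, H13.
    rewrite !qpoch_S. cbn [hpoch].
    rewrite (qpow_double q n) in *.
    rewrite (Cpow_S q n).
    unfold L, R, k, a.
    clear HK HA HB HAB H3.
    generalize dependent (qpoch (z ^ 2 * A * B * q ^ 3) q n).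
    generalize dependent (qpoch (z ^ 2 * A * B * q ^ 3) (q ^ 2) n).
    generalize dependent (qpoch (q * (A * B)) (q ^ 2) n).
    generalize dependent (qpoch (q * (q * z) * A) q n).
    generalize dependent (qpoch (q * (q * z) * B) q n).
    generalize dependent (qpoch (q * (z * A * B)) q n).
    generalize dependent (qpoch q q n). generalize dependent (qpoch A q n).
    generalize dependent (qpoch B q n). generalize dependent (hpoch q z n).
    generalize dependent (q ^ n). intros.
    field. repeat split; auto.
Qed.

(** When [a q^(2n+3) = 1] the series at [q z] ends one term before the series
    at [z], and the extra term closes the telescoping. *)
Lemma watson_telescope_last (n : nat) :
  (forall j, (j < n)%nat -> 1 - a * q ^ 3 * q ^ j <> 0) ->
  a * q ^ 3 * (q ^ n) ^ 2 = 1 ->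
  watson_cert q z A B n + L * watson_term q z A B (S n) = 0.
Proof.
  destruct watson_k_neq as [Hk0 Hk1]. intros H3 E.
  unfold watson_term, watson_cert.
  rewrite (reg_ratio_eq q (z ^ 2 * A * B)) by assumption.
  rewrite (qpoch_S_l (z * A * B)), (qpoch_S_l (q * z * A)),
    (qpoch_S_l (q * z * B)).
  replace (z * A * B * q) with (q * (z * A * B)) by ring.
  replace (q * z * A * q) with (q * (q * z) * A) by ring.
  replace (q * z * B * q) with (q * (q * z) * B) by ring.
  assert (H1 := qpoch_qq_neq_0 q n Hq).
  assert (H2 := one_minus_qpow_neq_0 q n Hq).
  assert (H4 : qpoch (q * (A * B)) (q ^ 2) n <> 0)
    by (apply qpoch_neq_0; intros; apply HAB).
  assert (H5 : 1 - q * (A * B) * (q ^ 2) ^ n <> 0) by apply HAB.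
  assert (H6 : qpoch (z ^ 2 * A * B * q ^ 3) q n <> 0)
    by (apply qpoch_neq_0; intros; apply H3; lia).
  assert (H10 : qpoch (q * (q * z) * A) q n <> 0).
  { apply qpoch_neq_0. intros j _.
    nz_from (HA (S j)). }
  assert (H11 : qpoch (q * (q * z) * B) q n <> 0).
  { apply qpoch_neq_0. intros j _.
    nz_from (HB (S j)). }
  assert (H12 := HA 0). assert (H13 := HB 0).
  cbn [Cpow] in H12, H13. rewrite Cmult_1_r in H12, H13.
  rewrite !qpoch_S. cbn [hpoch].
  rewrite (qpow_double q n) in *.
  rewrite (Cpow_S q n).
  unfold L, R, k, a in *.
  clear HK HA HB HAB H3 L R k a.
  set (an := qpoch (z ^ 2 * A * B * q ^ 3) q n) in *.
  set (a2 := qpoch (z ^ 2 * A * B * q ^ 3) (q ^ 2) n).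
  set (qAB := qpoch (q * (A * B)) (q ^ 2) n) in *.
  set (qA := qpoch (q * (q * z) * A) q n) in *.
  set (qB := qpoch (q * (q * z) * B) q n) in *.
  set (kn := qpoch (q * (z * A * B)) q n). set (qn := qpoch q q n) in *.
  set (An := qpoch A q n). set (Bn := qpoch B q n). set (h := hpoch q z n).
  set (X := q ^ n) in *.
  clearbody an a2 qAB qA qB kn qn An Bn h X.
  apply (Cmult_cancel_l
    ((1 - q * (z * A * B)) * (1 - q * X) * (1 - q * (A * B) * X ^ 2))).
  2:{ repeat apply Cmult_neq_0; auto. }
  rewrite Cmult_0_r.
  (* The sum is divisible by [1 - a q^3 X^2], which vanishes. *)
  transitivity (
    (1 - z ^ 2 * A * B * q ^ 3 * X ^ 2)
    * (- (q ^ 2 * z ^ 2) + (q + z ^ 2 * A * B * q ^ 3 * z) * X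
       - q ^ 2 * (z * A * B) * X ^ 2)
    * (kn * a2 / (qn * qAB * an * qA * qB)
       * (An * (1 - A * X)) * (Bn * (1 - B * X)) * h)).
  - field. repeat split; auto.
  - rewrite E. ring.
Qed.

End Telescope.
End Watson.

(** * The summation theorem of q-Watson type: the limit [z -> 0] *)

(** The dominated limits below need bounds that are uniform in two indices. *)
Definition bdd (f : nat -> nat -> C) : Prop :=
  exists M, (0 <= M)%R /\ forall m n, (Cmod (f m n) <= M)%R.

Lemma bdd_ext (f g : nat -> nat -> C) :
  (forall m n, f m n = g m n) -> bdd f -> bdd g.
Proof.
  intros E [M [HM H]]. exists M. split; [exact HM|].
  intros m n. rewrite <- E. apply H.
Qed.

Lemma bdd_const (c : C) : bdd (fun _ _ => c).
Proof. exists (Cmod c). split; [apply Cmod_ge_0|]. intros; apply Rle_refl. Qed.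

Lemma bdd_mult (f g : nat -> nat -> C) :
  bdd f -> bdd g -> bdd (fun m n => f m n * g m n).
Proof.
  intros [M [HM H]] [N [HN H']]. exists (M * N)%R.
  split; [nra|]. intros m n. rewrite Cmod_mult.
  apply Rmult_le_compat; auto using Cmod_ge_0.
Qed.

(* Splitting only at visible products: [qpoch x p 1] unfolds to one. *)
Ltac split_bdd :=
  repeat match goal with
  | |- bdd (fun m n => @?f m n * @?g m n) => apply (bdd_mult f g)
  end.

Ltac split_Clim :=
  repeat match goal with
  | |- Clim (fun m => @?f m * @?g m) _ => apply (Clim_mult f g)
  end.

Lemma Cmod_pow_le_1 (p : C) (n : nat) : (Cmod p < 1)%R -> (Cmod (p ^ n) <= 1)%R.
Proof.
  intros Hp. rewrite Cmod_pow, <- (pow1 n). apply pow_incr.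
  split; [apply Cmod_ge_0|lra].
Qed.

Lemma bdd_qpoch (p x : C) (s g : nat -> nat -> nat) :
  (Cmod p < 1)%R -> bdd (fun m n => qpoch (x * p ^ s m n) p (g m n)).
Proof.
  intros Hp. destruct (qpoch_bound p Hp (Cmod x)) as [M [HM H]].
  exists M. split; [lra|]. intros m n. apply H. rewrite Cmod_mult.
  assert (H1 := Cmod_pow_le_1 p (s m n) Hp).
  assert (H0 := Cmod_ge_0 x). nra.
Qed.

(** Lower bounds for the tails of a nonvanishing product come from
    [(x p^s;p)_n = (x;p)_(s+n) / (x;p)_s]. *)
Lemma bdd_inv_qpoch (p x : C) (s g : nat -> nat -> nat) :
  (Cmod p < 1)%R -> (forall j, 1 - x * p ^ j <> 0) ->
  bdd (fun m n => / qpoch (x * p ^ s m n) p (g m n)).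
Proof.
  intros Hp Hx.
  destruct (qpoch_bound p Hp (Cmod x)) as [M [HM H]].
  destruct (qpoch_away p Hp x Hx) as [c [Hc H']].
  exists (M * / c)%R. assert (Hic : (0 < / c)%R) by now apply Rinv_0_lt_compat.
  split; [nra|]. intros m n.
  assert (Ht : forall i, qpoch x p i <> 0) by (intros; apply qpoch_neq_0; auto).
  assert (Hn : qpoch (x * p ^ s m n) p (g m n) <> 0).
  { intros E. apply (Ht (s m n + g m n)%nat). rewrite qpoch_add, E. ring. }
  replace (/ qpoch (x * p ^ s m n) p (g m n))
    with (qpoch x p (s m n) * / qpoch x p (s m n + g m n)).
  2:{ rewrite qpoch_add. field. auto. }
  rewrite Cmod_mult, Cmod_inv by apply Ht.
  apply Rmult_le_compat; try apply Cmod_ge_0.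
  - left. apply Rinv_0_lt_compat, Cmod_gt_0, Ht.
  - apply H, Rle_refl.
  - apply Rinv_le_contravar; [exact Hc|apply H'].
Qed.

Lemma bdd_qpoch0 (p x : C) (g : nat -> nat -> nat) :
  (Cmod p < 1)%R -> bdd (fun m n => qpoch x p (g m n)).
Proof.
  intros Hp. apply bdd_ext with (fun m n => qpoch (x * p ^ 0) p (g m n)).
  - intros. simpl (p ^ 0). now rewrite Cmult_1_r.
  - apply (bdd_qpoch p x (fun _ _ => 0%nat) g Hp).
Qed.

Lemma bdd_inv_qpoch0 (p x : C) (g : nat -> nat -> nat) :
  (Cmod p < 1)%R -> (forall j, 1 - x * p ^ j <> 0) ->
  bdd (fun m n => / qpoch x p (g m n)).
Proof.
  intros Hp Hx. apply bdd_ext with (fun m n => / qpoch (x * p ^ 0) p (g m n)).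
  - intros. simpl (p ^ 0). now rewrite Cmult_1_r.
  - apply (bdd_inv_qpoch p x (fun _ _ => 0%nat) g Hp Hx).
Qed.

Lemma bdd_geom_Clim_0 (c d : nat -> C) (M r : R) :
  (0 < r < 1)%R -> bdd (fun _ n => c n) ->
  (forall n, (Cmod (d n) <= M * r ^ n)%R) -> Clim (fun n => c n * d n) 0.
Proof.
  intros Hr [K [HK H]] Hd.
  apply Clim_squeeze with (fun n => (K * (M * r ^ n))%R).
  - intros n. replace (c n * d n - 0) with (c n * d n) by ring.
    rewrite Cmod_mult. apply Rmult_le_compat; try apply Cmod_ge_0;
      [apply (H 0%nat)|apply Hd].
  - replace (Finite 0) with (Finite (K * (M * 0))%R) by (f_equal; ring).
    apply is_lim_seq_mult'; [apply is_lim_seq_const|].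
    apply is_lim_seq_mult'; [apply is_lim_seq_const|].
    apply is_lim_seq_geom. rewrite Rabs_pos_eq; lra.
Qed.

(** Puts terminating series under the same geometric domination as the
    infinite ones. *)
Lemma finite_support_geom (I : Type) (u : I -> nat -> R) (N : nat) (r : R) :
  (0 < r)%R ->
  (forall n, exists K, forall i, (u i n <= K)%R) ->
  (forall i n, (N <= n)%nat -> (u i n <= 0)%R) ->
  exists M, (0 <= M)%R /\ forall i n, (u i n <= M * r ^ n)%R.
Proof.
  intros Hr HK H.
  assert (HN : exists M, (0 <= M)%R /\
             forall i n, (n < N)%nat -> (u i n <= M * r ^ n)%R).
  { clear H. induction N as [|N [M [HM IH]]].
    - exists 0%R. split; [lra|]. intros; lia.
    - assert (Hp : (0 < r ^ N)%R) by now apply pow_lt.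
      destruct (HK N) as [K HKN].
      exists (Rmax M (K / r ^ N)).
      split; [eapply Rle_trans; [exact HM|apply Rmax_l]|].
      intros i n Hn. destruct (Nat.eq_dec n N) as [->|Hne].
      + apply Rle_trans with (K / r ^ N * r ^ N)%R.
        * eapply Rle_trans; [apply HKN|]. right. field. lra.
        * apply Rmult_le_compat_r; [lra|apply Rmax_r].
      + eapply Rle_trans; [apply IH; lia|].
        apply Rmult_le_compat_r; [apply pow_le; lra|apply Rmax_l]. }
  destruct HN as [M [HM HN]]. exists M. split; [exact HM|].
  intros i n. destruct (Nat.lt_ge_cases n N) as [Hn|Hn]; [auto|].
  eapply Rle_trans; [now apply H|].
  apply Rmult_le_pos; [exact HM|apply pow_le; lra].
Qed.

Lemma hpoch_eq (q z : C) (n : nat) :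
  z <> 0 -> hpoch q z n = qpoch (/ z) q n * (- (q * z)) ^ n.
Proof.
  intros Hz. induction n as [|n IH]; [cbn; ring|].
  cbn [hpoch]. rewrite IH, qpoch_S, Cpow_S. field. exact Hz.
Qed.

(** Convergence through the argument or through termination. *)
Definition summable_param (q z A B : C) : Prop :=
  (Cmod (q * z) < 1)%R \/
  exists N, forall n, (N <= n)%nat -> qpoch A q n * qpoch B q n = 0.

(** Stable under [z -> q z]. The condition on [a = z^2 A B] starts at [a q^2],
    because [reg_ratio] has lost its factor [1 - a q]. *)
Record watson_regular (q z A B : C) : Prop := {
  wr_z : z <> 0;
  wr_k : forall j, 1 - z * A * B * q ^ j <> 0;
  wr_A : forall j, 1 - q * z * A * q ^ j <> 0;
  wr_B : forall j, 1 - q * z * B * q ^ j <> 0;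
  wr_AB : forall j, 1 - q * (A * B) * (q ^ 2) ^ j <> 0;
  wr_a : forall j, 1 - z ^ 2 * A * B * q ^ 2 * q ^ j <> 0
}.

(** Scaled so that [watson_norm] times the series is the product of the four
    numerator factors in [watson_sum]. *)
Definition watson_norm (q z A B : C) : C :=
  qpoch_inf (q * z * A) q * qpoch_inf (q * z * B) q
  * qpoch_inf q (q ^ 2) * qpoch_inf (q * (A * B)) (q ^ 2)
  * qpoch_inf (z ^ 2 * A * B * q ^ 2) (q ^ 2)
  * qpoch_inf (- (q * z)) q / qpoch_inf (q * (z * A * B)) q.

(** The limit of [watson_term q z A B n] as [z] tends to zero. *)
Definition gauss_term (q A B : C) (n : nat) : C :=
  hpoch q 0 n
  * (qpoch A q n * qpoch B q n / (qpoch q q n * qpoch (q * (A * B)) (q ^ 2) n)).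

Section WatsonLimit.

Variable q : C.
Hypothesis Hq0 : q <> 0.
Hypothesis Hq : (Cmod q < 1)%R.

Let Hq2 : (Cmod (q ^ 2) < 1)%R := Cmod_sqr_lt_1 q Hq.

Lemma watson_regular_shift (z A B : C) :
  watson_regular q z A B -> watson_regular q (q * z) A B.
Proof.
  intros [H1 H2 H3 H4 H5 H6]. constructor; auto.
  - now apply Cmult_neq_0.
  - intros j. nz_from (H2 (S j)).
  - intros j. nz_from (H3 (S j)).
  - intros j. nz_from (H4 (S j)).
  - intros j. nz_from (H6 (S (S j))).
Qed.

Lemma summable_param_shift (z A B : C) :
  summable_param q z A B -> summable_param q (q * z) A B.
Proof.
  intros [H|H]; [left|now right].
  rewrite Cmod_mult. assert (H0 := Cmod_ge_0 (q * z)).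
  assert (H1 := Cmod_ge_0 q). nra.
Qed.

(** In the first case [(A, B, 1/z;q)_n] is bounded and [(- q z)^n] remains. *)
Lemma numerator_geom (z A B : C) :
  z <> 0 -> summable_param q z A B ->
  exists M r, (0 < r < 1)%R /\ (0 <= M)%R /\
    forall n, (Cmod (qpoch A q n * qpoch B q n * hpoch q z n) <= M * r ^ n)%R.
Proof.
  intros Hz [H|[N H]].
  - assert (Hb : bdd (fun _ n => qpoch A q n * qpoch B q n * qpoch (/ z) q n)).
    { split_bdd; now apply (bdd_qpoch0 q _ (fun _ n => n)). }
    destruct Hb as [M [HM Hb]].
    exists M, (Cmod (q * z)). split; [|split; [exact HM|]].
    + split; [|exact H]. apply Cmod_gt_0. now apply Cmult_neq_0.
    + intros n. rewrite (hpoch_eq q z n Hz).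
      replace (qpoch A q n * qpoch B q n * (qpoch (/ z) q n * (- (q * z)) ^ n))
        with (qpoch A q n * qpoch B q n * qpoch (/ z) q n * (- (q * z)) ^ n)
        by ring.
      rewrite Cmod_mult, Cmod_pow, Cmod_opp.
      apply Rmult_le_compat_r; [apply pow_le, Cmod_ge_0|apply (Hb 0%nat)].
  - destruct (finite_support_geom unit
      (fun _ n => Cmod (qpoch A q n * qpoch B q n * hpoch q z n)) N (1 / 2))
      as [M [HM HH]].
    + lra.
    + intros n. eexists. intros _. apply Rle_refl.
    + intros _ n Hn. rewrite H by exact Hn.
      replace (0 * hpoch q z n) with (RtoC 0) by ring. rewrite Cmod_0. lra.
    + exists M, (1 / 2)%R. split; [lra|]. split; [exact HM|]. exact (HH tt).
Qed.

(** The factors of the term at [z q^m] that tend to one as [m] grows. *)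
Definition watson_coef (z A B : C) (m n : nat) : C :=
  (1 - z * A * B * q ^ m * (q ^ n) ^ 2) / (1 - z * A * B * q ^ m)
  * qpoch (z * A * B * q ^ m) q n
  * reg_ratio q (z ^ 2 * A * B * (q ^ 2) ^ m) n
  / (qpoch (q * z * A * q ^ m) q n * qpoch (q * z * B * q ^ m) q n).

Definition gauss_coef (A B : C) (n : nat) : C :=
  / (qpoch q q n * qpoch (q * (A * B)) (q ^ 2) n).

Lemma watson_term_coef (z A B : C) (m n : nat) :
  watson_term q (z * q ^ m) A B n
  = watson_coef z A B m n * gauss_coef A B n
    * (qpoch A q n * qpoch B q n * hpoch q (z * q ^ m) n).
Proof.
  unfold watson_term, watson_coef, gauss_coef.
  replace (z * q ^ m * A * B) with (z * A * B * q ^ m) by ring.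
  replace ((z * q ^ m) ^ 2 * A * B) with (z ^ 2 * A * B * (q ^ 2) ^ m).
  2:{ rewrite <- Cpow_mult_r, Nat.mul_comm, Cpow_mult_r. ring. }
  replace (q * (z * q ^ m) * A) with (q * z * A * q ^ m) by ring.
  replace (q * (z * q ^ m) * B) with (q * z * B * q ^ m) by ring.
  unfold Cdiv. ring.
Qed.

Lemma reg_ratio_bdd (a : C) :
  (forall j, 1 - a * q ^ 2 * q ^ j <> 0) ->
  bdd (fun m n => reg_ratio q (a * (q ^ 2) ^ m) n).
Proof.
  intros Ha.
  destruct (bdd_mult _ _
    (bdd_qpoch (q ^ 2) (a * q ^ 3) (fun m _ => m) (fun _ n => n) Hq2)
    (bdd_inv_qpoch q (a * q ^ 2) (fun m _ => (2 * m)%nat) (fun _ n => n) Hq Ha))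
    as [M [HM H]].
  exists (Rmax M 1). split; [eapply Rle_trans; [exact HM|apply Rmax_l]|].
  intros m [|n].
  - simpl. rewrite Cmod_1. apply Rmax_r.
  - eapply Rle_trans; [|apply Rmax_l].
    cbn [reg_ratio]. unfold Cdiv.
    replace (a * (q ^ 2) ^ m * q ^ 3) with (a * q ^ 3 * (q ^ 2) ^ m) by ring.
    replace (a * (q ^ 2) ^ m * q ^ 2) with (a * q ^ 2 * q ^ (2 * m))
      by (rewrite Cpow_mult_r; ring).
    apply H.
Qed.

Lemma watson_coef_bdd (z A B : C) :
  watson_regular q z A B -> bdd (fun m n => watson_coef z A B m n).
Proof.
  intros [_ H2 H3 H4 _ H6].
  apply bdd_ext with (fun m n =>
    qpoch (z * A * B * q ^ (m + 2 * n)) q 1 * / qpoch (z * A * B * q ^ m) q 1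
    * qpoch (z * A * B * q ^ m) q n
    * reg_ratio q (z ^ 2 * A * B * (q ^ 2) ^ m) n
    * / qpoch (q * z * A * q ^ m) q n * / qpoch (q * z * B * q ^ m) q n).
  - intros m n. unfold watson_coef. cbn [qpoch Cpow].
    rewrite Cpow_add_r, (Nat.mul_comm 2 n), Cpow_mult_r, !Cmult_1_l, !Cmult_1_r.
    assert (Ha : qpoch (q * z * A * q ^ m) q n <> 0)
      by now apply qpoch_shift_neq_0.
    assert (Hb : qpoch (q * z * B * q ^ m) q n <> 0)
      by now apply qpoch_shift_neq_0.
    rewrite !Cmult_assoc. field. auto.
  - split_bdd.
    + apply (bdd_qpoch q (z * A * B) (fun m n => (m + 2 * n)%nat)
               (fun _ _ => 1%nat) Hq).
    + apply (bdd_inv_qpoch q (z * A * B) (fun m n => m) (fun _ _ => 1%nat) Hq H2).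
    + apply (bdd_qpoch q (z * A * B) (fun m n => m) (fun _ n => n) Hq).
    + now apply reg_ratio_bdd.
    + apply (bdd_inv_qpoch q (q * z * A) (fun m n => m) (fun _ n => n) Hq H3).
    + apply (bdd_inv_qpoch q (q * z * B) (fun m n => m) (fun _ n => n) Hq H4).
Qed.

Lemma gauss_coef_bdd (A B : C) :
  (forall j, 1 - q * (A * B) * (q ^ 2) ^ j <> 0) ->
  bdd (fun _ n => gauss_coef A B n).
Proof.
  intros H5.
  apply bdd_ext with (fun m n => / qpoch q q n
    * / qpoch (q * (A * B)) (q ^ 2) n).
  - intros _ n. unfold gauss_coef.
    assert (H1 := qpoch_qq_neq_0 q n Hq).
    assert (H : qpoch (q * (A * B)) (q ^ 2) n <> 0) by now apply qpoch_neq_0.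
    field. auto.
  - split_bdd.
    + apply (bdd_inv_qpoch0 q q (fun _ n => n) Hq).
      intros. now apply one_minus_qpow_neq_0.
    + exact (bdd_inv_qpoch0 (q ^ 2) _ (fun _ n => n) Hq2 H5).
Qed.

(** A bound uniform in the shift: for large [m] every factor [q (q^j - z q^m)]
    has modulus at most [(1 + |q|)/2]. *)
Lemma hpoch_small (z : C) :
  (Cmod (q * z) <= (1 - Cmod q) / 2)%R ->
  forall n, (Cmod (hpoch q z n) <= ((1 + Cmod q) / 2) ^ n)%R.
Proof.
  intros Hz n. assert (H0 := Cmod_ge_0 q).
  induction n as [|n IH]; [simpl; rewrite Cmod_1; lra|].
  cbn [hpoch pow]. rewrite Cmod_mult, Rmult_comm.
  apply Rmult_le_compat; try apply Cmod_ge_0; [|exact IH].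
  replace (q * (q ^ n - z)) with (q * q ^ n - q * z) by ring.
  eapply Rle_trans; [apply Cmod_triangle_minus|].
  rewrite (Cmod_mult q (q ^ n)). assert (H := Cmod_pow_le_1 q n Hq).
  assert (H' := Cmod_ge_0 (q ^ n)). nra.
Qed.

Lemma shift_Clim_0 (x : C) : Clim (fun m => x * q ^ m) 0.
Proof.
  apply (Clim_limit_eq (x * 0)); [ring|]. apply Clim_scal. now apply Clim_geom.
Qed.

Lemma qpoch_shift_Clim (x p : C) (n : nat) :
  Clim (fun m => qpoch (x * q ^ m) p n) 1.
Proof.
  induction n as [|n IH]; [exact (Clim_const 1)|].
  cbn [qpoch]. apply (Clim_limit_eq (1 * (1 - 0 * p ^ n))); [ring|].
  apply Clim_mult; [exact IH|].
  apply Clim_minus; [apply Clim_const|].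
  apply Clim_mult; [apply shift_Clim_0|apply Clim_const].
Qed.

Lemma inv_qpoch_shift_Clim (x : C) (n : nat) :
  Clim (fun m => / qpoch (x * q ^ m) q n) 1.
Proof.
  apply (Clim_limit_eq (/ 1)); [field|].
  apply Clim_inv; [apply C1_neq_0|apply qpoch_shift_Clim].
Qed.

Lemma hpoch_shift_Clim (z : C) (n : nat) :
  Clim (fun m => hpoch q (z * q ^ m) n) (hpoch q 0 n).
Proof.
  induction n as [|n IH]; [exact (Clim_const 1)|].
  cbn [hpoch]. apply Clim_mult; [exact IH|].
  apply Clim_scal, Clim_minus; [apply Clim_const|apply shift_Clim_0].
Qed.

Lemma watson_coef_Clim (z A B : C) (n : nat) :
  watson_regular q z A B -> Clim (fun m => watson_coef z A B m n) 1.
Proof.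
  intros [_ H2 H3 H4 _ H6].
  assert (Hr : Clim (fun m => reg_ratio q (z ^ 2 * A * B * (q ^ 2) ^ m) n) 1).
  { destruct n as [|n]; [exact (Clim_const 1)|].
    apply Clim_ext with (fun m =>
      qpoch (z ^ 2 * A * B * q ^ 3 * q ^ (2 * m)) (q ^ 2) n
      * / qpoch (z ^ 2 * A * B * q ^ 2 * q ^ (2 * m)) q n).
    { intros m. cbn [reg_ratio]. unfold Cdiv. rewrite Cpow_mult_r.
      f_equal; [|f_equal]; f_equal; ring. }
    apply (Clim_limit_eq (1 * 1)); [ring|].
    apply (Clim_subseq (fun m =>
      qpoch (z ^ 2 * A * B * q ^ 3 * q ^ m) (q ^ 2) n
      * / qpoch (z ^ 2 * A * B * q ^ 2 * q ^ m) q n) (fun m => (2 * m)%nat));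
      [intros; lia|].
    apply Clim_mult; [apply qpoch_shift_Clim|apply inv_qpoch_shift_Clim]. }
  apply Clim_ext with (fun m =>
    (1 - z * A * B * q ^ m * (q ^ n) ^ 2) * / qpoch (z * A * B * q ^ m) q 1
    * qpoch (z * A * B * q ^ m) q n
    * reg_ratio q (z ^ 2 * A * B * (q ^ 2) ^ m) n
    * / qpoch (q * z * A * q ^ m) q n * / qpoch (q * z * B * q ^ m) q n).
  - intros m. unfold watson_coef. cbn [qpoch].
    change (q ^ 0) with (RtoC 1). rewrite Cmult_1_l, Cmult_1_r.
    assert (Ha : qpoch (q * z * A * q ^ m) q n <> 0)
      by now apply qpoch_shift_neq_0.
    assert (Hb : qpoch (q * z * B * q ^ m) q n <> 0)
      by now apply qpoch_shift_neq_0.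
    field. auto.
  - apply (Clim_limit_eq ((1 - 0 * (q ^ n) ^ 2) * 1 * 1 * 1 * 1 * 1)); [ring|].
    split_Clim.
    + apply Clim_minus; [apply Clim_const|].
      apply Clim_mult; [apply shift_Clim_0|apply Clim_const].
    + apply inv_qpoch_shift_Clim.
    + apply qpoch_shift_Clim.
    + exact Hr.
    + apply inv_qpoch_shift_Clim.
    + apply inv_qpoch_shift_Clim.
Qed.

Lemma watson_Clim (z A B : C) :
  watson_regular q z A B -> summable_param q z A B ->
  Clim (csum (watson_term q z A B)) (Cseries (watson_term q z A B)).
Proof.
  intros Hr Hs.
  destruct (numerator_geom z A B (wr_z _ _ _ _ Hr) Hs) as [M [r [Hr1 [HM H]]]].
  destruct (bdd_mult _ _ (watson_coef_bdd z A B Hr)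
              (gauss_coef_bdd A B (wr_AB _ _ _ _ Hr))) as [K [HK Hb]].
  destruct (geom_bound_Clim (watson_term q z A B) (K * M) r Hr1) as [s Hs'].
  - intros n. replace z with (z * q ^ 0) at 1 by (simpl; ring).
    rewrite watson_term_coef, Cmod_mult, Rmult_assoc.
    replace (z * q ^ 0) with z by (simpl; ring).
    apply Rmult_le_compat; try apply Cmod_ge_0; [apply (Hb 0%nat)|apply H].
  - now rewrite (Cseries_Clim _ _ Hs').
Qed.

Lemma watson_cert_Clim (z A B : C) :
  watson_regular q z A B -> summable_param q z A B ->
  Clim (watson_cert q z A B) 0.
Proof.
  intros [H1 H2 H3 H4 H5 H6] Hs.
  destruct (numerator_geom z A B H1 Hs) as [M [r [Hr1 [HM H]]]].
  assert (H3' : forall j, 1 - q * (q * z) * A * q ^ j <> 0).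
  { intros j. nz_from (H3 (S j)). }
  assert (H4' : forall j, 1 - q * (q * z) * B * q ^ j <> 0).
  { intros j. nz_from (H4 (S j)). }
  assert (H6' : forall j, 1 - z ^ 2 * A * B * q ^ 3 * q ^ j <> 0).
  { intros j. nz_from (H6 (S j)). }
  set (w := q ^ 3 * (z ^ 2 * A * B) * z).
  apply Clim_ext with (fun n =>
    (q * z / (1 - q * (z * A * B)) * gauss_coef A B n
     * qpoch (w * q ^ n) q 1 * qpoch (q * (z * A * B)) q n
     * qpoch (z ^ 2 * A * B * q ^ 3) (q ^ 2) n
     * / qpoch (z ^ 2 * A * B * q ^ 3) q n
     * / qpoch (q * (q * z) * A) q n
     * / qpoch (q * (q * z) * B) q n
     * qpoch (A * q ^ n) q 1 * qpoch (B * q ^ n) q 1)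
    * (qpoch A q n * qpoch B q n * hpoch q z n)).
  - intros n. unfold watson_cert, gauss_coef. fold w.
    rewrite (qpoch_S A), (qpoch_S B). cbn [qpoch].
    change (q ^ 0) with (RtoC 1). rewrite !Cmult_1_r, !Cmult_1_l.
    assert (E1 := qpoch_qq_neq_0 q n Hq).
    assert (E2 : qpoch (q * (A * B)) (q ^ 2) n <> 0) by now apply qpoch_neq_0.
    assert (E3 : qpoch (q * (q * z) * A) q n <> 0) by now apply qpoch_neq_0.
    assert (E4 : qpoch (q * (q * z) * B) q n <> 0) by now apply qpoch_neq_0.
    assert (E5 : qpoch (z ^ 2 * A * B * q ^ 3) q n <> 0) by now apply qpoch_neq_0.
    assert (E6 : 1 - q * (z * A * B) <> 0).
    { nz_from (H2 1%nat). }
    clearbody w. field. auto 10.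
  - apply bdd_geom_Clim_0 with M r; [exact Hr1| |exact H].
    split_bdd.
    + apply bdd_const.
    + now apply gauss_coef_bdd.
    + apply (bdd_qpoch q w (fun _ n => n) (fun _ _ => 1%nat) Hq).
    + exact (bdd_qpoch0 q _ (fun _ n => n) Hq).
    + exact (bdd_qpoch0 (q ^ 2) _ (fun _ n => n) Hq2).
    + exact (bdd_inv_qpoch0 q _ (fun _ n => n) Hq H6').
    + exact (bdd_inv_qpoch0 q _ (fun _ n => n) Hq H3').
    + exact (bdd_inv_qpoch0 q _ (fun _ n => n) Hq H4').
    + apply (bdd_qpoch q A (fun _ n => n) (fun _ _ => 1%nat) Hq).
    + apply (bdd_qpoch q B (fun _ n => n) (fun _ _ => 1%nat) Hq).
Qed.

Lemma watson_norm_shift (z A B : C) :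
  (forall j, 1 - z * A * B * q ^ j <> 0) ->
  watson_norm q z A B
  = (1 - q * z * A) * (1 - q * z * B) * (1 - z ^ 2 * A * B * q ^ 2) * (1 + q * z)
    / (1 - q * (z * A * B)) * watson_norm q (q * z) A B.
Proof.
  intros H2. unfold watson_norm.
  assert (Hk : 1 - q * (z * A * B) <> 0).
  { nz_from (H2 1%nat). }
  assert (Hk' : qpoch_inf (q * (q * z * A * B)) q <> 0).
  { apply qpoch_inf_neq_0; [exact Hq|]. intros j.
    nz_from (H2 (S (S j))). }
  rewrite (qpoch_inf_S q Hq (q * z * A)), (qpoch_inf_S q Hq (q * z * B)),
    (qpoch_inf_S (q ^ 2) Hq2 (z ^ 2 * A * B * q ^ 2)),
    (qpoch_inf_S q Hq (- (q * z))), (qpoch_inf_S q Hq (q * (z * A * B))).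
  replace (q * z * A * q) with (q * (q * z) * A) by ring.
  replace (q * z * B * q) with (q * (q * z) * B) by ring.
  replace (z ^ 2 * A * B * q ^ 2 * q ^ 2) with ((q * z) ^ 2 * A * B * q ^ 2) by ring.
  replace (- (q * z) * q) with (- (q * (q * z))) by ring.
  replace (q * (z * A * B) * q) with (q * (q * z * A * B)) by ring.
  field. auto.
Qed.

(** The certificate tends to zero, so that the telescoped relation holds for
    the infinite sums. *)
Lemma watson_step (z A B : C) :
  watson_regular q z A B -> summable_param q z A B ->
  watson_norm q z A B * Cseries (watson_term q z A B)
  = (1 - q ^ 2 * z ^ 2 * A) * (1 - q ^ 2 * z ^ 2 * B)
    * (watson_norm q (q * z) A B * Cseries (watson_term q (q * z) A B)).
Proof.
  intros Hr Hs. rewrite (watson_norm_shift z A B (wr_k _ _ _ _ Hr)).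
  assert (HC := watson_Clim z A B Hr Hs).
  assert (HC' := watson_Clim (q * z) A B (watson_regular_shift _ _ _ Hr)
                   (summable_param_shift _ _ _ Hs)).
  assert (H0 := watson_cert_Clim z A B Hr Hs).
  destruct Hr as [H1 H2 H3 H4 H5 H6].
  set (L := (1 - q * z * A) * (1 - q * z * B) * (1 - z ^ 2 * A * B * q ^ 2)
            * (1 + q * z) / (1 - q * (z * A * B))).
  set (R := (1 - q ^ 2 * z ^ 2 * A) * (1 - q ^ 2 * z ^ 2 * B)).
  assert (E : L * Cseries (watson_term q z A B)
              = R * Cseries (watson_term q (q * z) A B)).
  { refine (telescoping_relation _ _ (watson_cert q z A B) _ _ _ _ _ H0 HC HC').
    intros n. apply (watson_telescope q Hq z A B H2 H3 H4 H5).
    - nz_from (H6 0%nat).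
    - intros j _. nz_from (H6 (S j)). }
  transitivity (watson_norm q (q * z) A B * (L * Cseries (watson_term q z A B)));
    [ring|].
  rewrite E. ring.
Qed.

Lemma watson_regular_pow (z A B : C) (m : nat) :
  watson_regular q z A B -> watson_regular q (z * q ^ m) A B.
Proof.
  intros H. induction m as [|m IH].
  - simpl. now rewrite Cmult_1_r.
  - replace (z * q ^ S m) with (q * (z * q ^ m)) by (rewrite Cpow_S; ring).
    now apply watson_regular_shift.
Qed.

Lemma summable_param_pow (z A B : C) (m : nat) :
  summable_param q z A B -> summable_param q (z * q ^ m) A B.
Proof.
  intros H. induction m as [|m IH].
  - simpl. now rewrite Cmult_1_r.
  - replace (z * q ^ S m) with (q * (z * q ^ m)) by (rewrite Cpow_S; ring).
    now apply summable_param_shift.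
Qed.

Lemma watson_iterate (z A B : C) (m : nat) :
  watson_regular q z A B -> summable_param q z A B ->
  watson_norm q z A B * Cseries (watson_term q z A B)
  = qpoch (q ^ 2 * z ^ 2 * A) (q ^ 2) m * qpoch (q ^ 2 * z ^ 2 * B) (q ^ 2) m
    * (watson_norm q (z * q ^ m) A B * Cseries (watson_term q (z * q ^ m) A B)).
Proof.
  intros Hr Hs. induction m as [|m IH].
  - replace (z * q ^ 0) with z by (simpl; ring). cbn [qpoch]. ring.
  - rewrite IH, (watson_step (z * q ^ m)), !qpoch_S.
    + replace (z * q ^ S m) with (q * (z * q ^ m)) by (rewrite Cpow_S; ring).
      replace (q ^ 2 * (z * q ^ m) ^ 2) with (q ^ 2 * z ^ 2 * (q ^ 2) ^ m).
      * ring.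
      * rewrite <- Cpow_mult_r, Nat.mul_comm, Cpow_mult_r. ring.
    + now apply watson_regular_pow.
    + now apply summable_param_pow.
Qed.

Lemma watson_norm_Clim (z A B : C) :
  watson_regular q z A B ->
  Clim (fun m => watson_norm q (z * q ^ m) A B)
    (qpoch_inf q (q ^ 2) * qpoch_inf (q * (A * B)) (q ^ 2)).
Proof.
  intros [H1 H2 H3 H4 H5 H6].
  apply Clim_ext with (fun m =>
    qpoch_inf (q * z * A * q ^ m) q * qpoch_inf (q * z * B * q ^ m) q
    * qpoch_inf q (q ^ 2) * qpoch_inf (q * (A * B)) (q ^ 2)
    * qpoch_inf (z ^ 2 * A * B * q ^ 2 * (q ^ 2) ^ m) (q ^ 2)
    * qpoch_inf (- (q * z) * q ^ m) q * / qpoch_inf (q * (z * A * B) * q ^ m) q).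
  - intros m. unfold watson_norm, Cdiv.
    replace (q * (z * q ^ m) * A) with (q * z * A * q ^ m) by ring.
    replace (q * (z * q ^ m) * B) with (q * z * B * q ^ m) by ring.
    replace ((z * q ^ m) ^ 2 * A * B * q ^ 2)
      with (z ^ 2 * A * B * q ^ 2 * (q ^ 2) ^ m).
    2:{ rewrite <- Cpow_mult_r, Nat.mul_comm, Cpow_mult_r. ring. }
    replace (- (q * (z * q ^ m))) with (- (q * z) * q ^ m) by ring.
    replace (q * (z * q ^ m * A * B)) with (q * (z * A * B) * q ^ m) by ring.
    reflexivity.
  - replace (qpoch_inf q (q ^ 2) * qpoch_inf (q * (A * B)) (q ^ 2))
      with (1 * 1 * qpoch_inf q (q ^ 2) * qpoch_inf (q * (A * B)) (q ^ 2)
            * 1 * 1 * / 1) by field.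
    split_Clim; try apply Clim_const;
      try (apply qpoch_inf_shift_Clim; assumption).
    apply Clim_inv; [apply C1_neq_0|now apply qpoch_inf_shift_Clim].
Qed.

Lemma gauss_Clim (A B : C) :
  (forall j, 1 - q * (A * B) * (q ^ 2) ^ j <> 0) ->
  Clim (csum (gauss_term q A B)) (Cseries (gauss_term q A B)).
Proof.
  intros HAB.
  assert (Hb : bdd (fun _ n => qpoch A q n * qpoch B q n * gauss_coef A B n)).
  { split_bdd.
    - exact (bdd_qpoch0 q A (fun _ n => n) Hq).
    - exact (bdd_qpoch0 q B (fun _ n => n) Hq).
    - now apply gauss_coef_bdd. }
  destruct Hb as [M [HM Hb]].
  destruct (geom_bound_Clim (gauss_term q A B) M ((1 + Cmod q) / 2)) as [s Hs].
  - assert (H0 := Cmod_ge_0 q). lra.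
  - intros n. replace (gauss_term q A B n)
      with (qpoch A q n * qpoch B q n * gauss_coef A B n * hpoch q 0 n)
      by (unfold gauss_term, gauss_coef, Cdiv; ring).
    rewrite Cmod_mult. apply Rmult_le_compat; try apply Cmod_ge_0.
    + apply (Hb 0%nat).
    + apply hpoch_small. rewrite Cmult_0_r, Cmod_0. lra.
  - now rewrite (Cseries_Clim _ _ Hs).
Qed.

(** Tannery's theorem along [z, z q, z q^2, ...]: the Watson series tends to
    the series of Andrews' q-analogue of Gauss's second theorem. *)
Lemma watson_series_Clim (z A B : C) :
  watson_regular q z A B -> summable_param q z A B ->
  Clim (fun m => Cseries (watson_term q (z * q ^ m) A B))
    (Cseries (gauss_term q A B)).
Proof.
  intros Hr Hs. assert (H0 := Cmod_ge_0 q).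
  destruct (shift_Clim_0 (q * z) ((1 - Cmod q) / 2)%R) as [m0 Hm0]; [lra|].
  apply Clim_unshift with m0.
  assert (Hb : bdd (fun m n => watson_coef z A B m n * gauss_coef A B n
                 * (qpoch A q n * qpoch B q n))).
  { split_bdd.
    - now apply watson_coef_bdd.
    - apply gauss_coef_bdd. exact (wr_AB _ _ _ _ Hr).
    - exact (bdd_qpoch0 q A (fun _ n => n) Hq).
    - exact (bdd_qpoch0 q B (fun _ n => n) Hq). }
  destruct Hb as [M [HM Hb]].
  apply tannery with (fun m => watson_term q (z * q ^ (m + m0)) A B)
    (gauss_term q A B) M ((1 + Cmod q) / 2)%R.
  - exact HM.
  - lra.
  - intros m n. rewrite watson_term_coef.
    replace (watson_coef z A B (m + m0) n * gauss_coef A B n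
      * (qpoch A q n * qpoch B q n * hpoch q (z * q ^ (m + m0)) n))
      with (watson_coef z A B (m + m0) n * gauss_coef A B n
      * (qpoch A q n * qpoch B q n) * hpoch q (z * q ^ (m + m0)) n) by ring.
    rewrite Cmod_mult. apply Rmult_le_compat; try apply Cmod_ge_0; [apply Hb|].
    apply hpoch_small. left.
    replace (q * (z * q ^ (m + m0))) with (q * z * q ^ (m + m0) - 0) by ring.
    apply Hm0. lia.
  - intros n.
    apply Clim_ext with (fun m => watson_coef z A B (m + m0) n
      * (gauss_coef A B n * (qpoch A q n * qpoch B q n))
      * hpoch q (z * q ^ (m + m0)) n).
    { intros m. rewrite watson_term_coef. ring. }
    replace (gauss_term q A B n) with
      (1 * (gauss_coef A B n * (qpoch A q n * qpoch B q n)) * hpoch q 0 n)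
      by (unfold gauss_term, gauss_coef, Cdiv; ring).
    apply Clim_mult; [apply Clim_mult; [|apply Clim_const]|].
    + apply (Clim_subseq (fun m => watson_coef z A B m n) (fun m => (m + m0)%nat));
        [intros; lia|now apply watson_coef_Clim].
    + apply (Clim_subseq (fun m => hpoch q (z * q ^ m) n) (fun m => (m + m0)%nat));
        [intros; lia|apply hpoch_shift_Clim].
  - intros m. apply watson_Clim;
      [now apply watson_regular_pow|now apply summable_param_pow].
  - apply gauss_Clim. exact (wr_AB _ _ _ _ Hr).
Qed.

(** Iterating the contiguous relation moves the argument to zero and produces
    the infinite products. *)
Lemma watson_gauss (z A B : C) :
  watson_regular q z A B -> summable_param q z A B ->
  watson_norm q z A B * Cseries (watson_term q z A B)
  = qpoch_inf (q ^ 2 * z ^ 2 * A) (q ^ 2) * qpoch_inf (q ^ 2 * z ^ 2 * B) (q ^ 2)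
    * (qpoch_inf q (q ^ 2) * qpoch_inf (q * (A * B)) (q ^ 2)
       * Cseries (gauss_term q A B)).
Proof.
  intros Hr Hs.
  apply (Clim_unique (fun _ => watson_norm q z A B * Cseries (watson_term q z A B))).
  - apply Clim_const.
  - eapply Clim_ext; [intros m; symmetry; now apply (watson_iterate z A B m)|].
    split_Clim; try (now apply qpoch_inf_Clim).
    + now apply watson_norm_Clim.
    + now apply watson_series_Clim.
Qed.

End WatsonLimit.

(** * Andrews' q-analogue of Gauss's second theorem *)

Section Gauss.

Variable q : C.
Hypothesis Hq0 : q <> 0.
Hypothesis Hq : (Cmod q < 1)%R.

Let Hq2 : (Cmod (q ^ 2) < 1)%R := Cmod_sqr_lt_1 q Hq.

Lemma gauss_telescope (A B : C) (n : nat) :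
  (forall j, 1 - q * (A * B) * (q ^ 2) ^ j <> 0) ->
  csum (fun i => (1 - q * (A * B)) * gauss_term q A B i
                 - (1 - A * q) * gauss_term q (A * q ^ 2) B i) (S n)
  = A * q ^ S n * qpoch (A * q) q n * qpoch B q (S n)
    / (qpoch q q n * qpoch (q * (A * q ^ 2 * B)) (q ^ 2) n) * hpoch q 0 n.
Proof.
  intros HAB.
  assert (H0 : 1 - q * (A * B) <> 0).
  { nz_from (HAB 0%nat). }
  assert (H3 : forall j, 1 - q * (A * q ^ 2 * B) * (q ^ 2) ^ j <> 0).
  { intros j. nz_from (HAB (S j)). }
  induction n as [|n IH].
  - unfold gauss_term. cbn [csum qpoch hpoch Cpow]. field.
  - rewrite csum_S, IH. clear IH. unfold gauss_term.
    assert (E : (1 - A * q) * qpoch (A * q ^ 2) q (S n)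
      = qpoch (A * q) q n * (1 - A * q * q ^ n) * (1 - A * q ^ 2 * q ^ n)).
    { replace (A * q ^ 2) with (A * q * q) at 1 by ring.
      rewrite <- qpoch_S_l, !qpoch_S, Cpow_S. ring. }
    replace ((1 - A * q) * (hpoch q 0 (S n) * (qpoch (A * q ^ 2) q (S n)
      * qpoch B q (S n) / (qpoch q q (S n)
        * qpoch (q * (A * q ^ 2 * B)) (q ^ 2) (S n)))))
      with (hpoch q 0 (S n) * ((1 - A * q) * qpoch (A * q ^ 2) q (S n)
      * qpoch B q (S n) / (qpoch q q (S n)
        * qpoch (q * (A * q ^ 2 * B)) (q ^ 2) (S n)))) by (unfold Cdiv; ring).
    rewrite E. clear E.
    rewrite (qpoch_S_l A), (qpoch_S_l (q * (A * B))).
    replace (q * (A * B) * q ^ 2) with (q * (A * q ^ 2 * B)) by ring.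
    assert (H1 := qpoch_qq_neq_0 q n Hq).
    assert (H2 := one_minus_qpow_neq_0 q n Hq).
    assert (H4 : qpoch (q * (A * q ^ 2 * B)) (q ^ 2) n <> 0)
      by now apply qpoch_neq_0.
    specialize (H3 n). rewrite !qpoch_S. cbn [hpoch].
    rewrite (qpow_double q n) in *.
    rewrite !(Cpow_S q (S n)), !(Cpow_S q n). clear HAB.
    set (X := q ^ n) in *.
    set (d := qpoch (q * (A * q ^ 2 * B)) (q ^ 2) n) in *.
    set (qn := qpoch q q n) in *. set (h := hpoch q 0 n).
    set (Bn := qpoch B q n). set (An := qpoch (A * q) q n).
    clearbody X d qn h Bn An.
    field. repeat split; auto.
Qed.

(** The value as a function of [A] satisfies the functional equation of
    [(A q;q^2)_oo / (q A B;q^2)_oo]. *)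
Lemma gauss_step (A B : C) :
  (forall j, 1 - q * (A * B) * (q ^ 2) ^ j <> 0) ->
  (1 - q * (A * B)) * Cseries (gauss_term q A B)
  = (1 - A * q) * Cseries (gauss_term q (A * q ^ 2) B).
Proof.
  intros HAB.
  assert (H3 : forall j, 1 - q * (A * q ^ 2 * B) * (q ^ 2) ^ j <> 0).
  { intros j. nz_from (HAB (S j)). }
  assert (HC := gauss_Clim q Hq A B HAB).
  assert (HC' := gauss_Clim q Hq (A * q ^ 2) B H3).
  refine (telescoping_relation _ _ _ _ _ _ _
            (fun n => gauss_telescope A B n HAB) _ HC HC').
  apply Clim_ext with (fun n =>
    (A * q * (qpoch (A * q) q n * qpoch B q (S n)
     * gauss_coef q (A * q ^ 2) B n)) * (q ^ n * hpoch q 0 n)).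
  - intros n. unfold gauss_coef, Cdiv. rewrite (Cpow_S q n). ring.
  - apply bdd_geom_Clim_0 with 1%R ((1 + Cmod q) / 2)%R.
    + assert (H0 := Cmod_ge_0 q). lra.
    + split_bdd; try apply bdd_const.
      * exact (bdd_qpoch0 q _ (fun _ n => n) Hq).
      * exact (bdd_qpoch0 q _ (fun _ n => S n) Hq).
      * now apply gauss_coef_bdd.
    + intros n. rewrite Cmod_mult.
      apply Rmult_le_compat; try apply Cmod_ge_0.
      * now apply Cmod_pow_le_1.
      * apply hpoch_small; [exact Hq|]. rewrite Cmult_0_r, Cmod_0. lra.
Qed.

(** Euler's identity between partitions into odd and into distinct parts:
    [(q;q)_oo = (q;q^2)_oo (q^2;q^2)_oo] and [(q;q)_oo (-q;q)_oo = (q^2;q^2)_oo]. *)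
Lemma euler_odd_distinct : qpoch_inf q (q ^ 2) * qpoch_inf (- q) q = 1.
Proof.
  assert (Hn : qpoch_inf (q ^ 2) (q ^ 2) <> 0).
  { apply qpoch_inf_neq_0; [exact Hq2|]. intros j.
    now apply one_minus_qpow_neq_0. }
  apply (Cmult_cancel_l (qpoch_inf (q ^ 2) (q ^ 2))); [|exact Hn].
  transitivity (qpoch_inf q q * qpoch_inf (- q) q).
  - rewrite (qpoch_inf_double q q Hq).
    replace (q * q) with (q ^ 2) by ring. ring.
  - rewrite (qpoch_inf_pm q q Hq). ring.
Qed.

Definition gauss_value (A B : C) : C :=
  qpoch_inf (q * (A * B)) (q ^ 2) * Cseries (gauss_term q A B).

Lemma gauss_value_sym (A B : C) :
  (forall j, 1 - q * (A * B) * (q ^ 2) ^ j <> 0) ->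
  gauss_value A B = gauss_value B A.
Proof.
  intros HAB. unfold gauss_value. rewrite (Cmult_comm B A). f_equal.
  apply Cseries_Clim.
  apply Clim_ext with (csum (gauss_term q B A)).
  - intros n. apply csum_ext. intros i _.
    unfold gauss_term. rewrite (Cmult_comm A B). unfold Cdiv. ring.
  - apply gauss_Clim; [exact Hq|]. intros j. rewrite (Cmult_comm B A). apply HAB.
Qed.

Lemma gauss_value_shift (A B : C) :
  (forall j, 1 - q * (A * B) * (q ^ 2) ^ j <> 0) ->
  gauss_value A B = (1 - A * q) * gauss_value (A * q ^ 2) B.
Proof.
  intros HAB. unfold gauss_value.
  rewrite (qpoch_inf_S (q ^ 2) Hq2 (q * (A * B))).
  replace (q * (A * B) * q ^ 2) with (q * (A * q ^ 2 * B)) by ring.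
  replace ((1 - q * (A * B)) * qpoch_inf (q * (A * q ^ 2 * B)) (q ^ 2)
           * Cseries (gauss_term q A B))
    with (qpoch_inf (q * (A * q ^ 2 * B)) (q ^ 2)
          * ((1 - q * (A * B)) * Cseries (gauss_term q A B))) by ring.
  rewrite gauss_step by exact HAB. ring.
Qed.

Lemma Cmod_mult_lt_1 (x y : C) :
  (Cmod x < 1)%R -> (Cmod y <= 1)%R -> (Cmod (x * y) < 1)%R.
Proof.
  intros Hx Hy. rewrite Cmod_mult.
  assert (H0 := Cmod_ge_0 x). assert (H1 := Cmod_ge_0 y). nra.
Qed.

(** At [z = 1] the Watson series reduces to its first term. Its value is thus
    known, and [watson_gauss] transfers it to the limit series. *)
Lemma gauss_value_small (A B : C) :
  (Cmod A < 1)%R -> (Cmod B < 1)%R ->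
  qpoch_inf q (q ^ 2) * gauss_value A B
  = qpoch_inf (A * q) (q ^ 2) * qpoch_inf (B * q) (q ^ 2).
Proof.
  intros HA HB.
  assert (Hsm : forall x y, (Cmod x < 1)%R -> (Cmod y <= 1)%R -> 1 - x * y <> 0)
    by (intros; apply one_minus_neq_0, Cmod_mult_lt_1; assumption).
  assert (Hle : forall j, (Cmod (q ^ j) <= 1)%R)
    by (intros; now apply Cmod_pow_le_1).
  assert (HAB : (Cmod (A * B) < 1)%R) by (apply Cmod_mult_lt_1; lra).
  assert (Hqle : (Cmod q <= 1)%R) by lra.
  assert (Hr : watson_regular q 1 A B).
  { constructor.
    - apply C1_neq_0.
    - intros j. replace (1 * A * B * q ^ j) with (A * B * q ^ j) by ring. auto.
    - intros j. replace (q * 1 * A * q ^ j) with (A * q ^ S j)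
        by (rewrite Cpow_S; ring). auto.
    - intros j. replace (q * 1 * B * q ^ j) with (B * q ^ S j)
        by (rewrite Cpow_S; ring). auto.
    - intros j. rewrite <- Cpow_mult_r.
      replace (q * (A * B) * q ^ (2 * j)) with (A * B * q ^ S (2 * j))
        by (rewrite (Cpow_S q (2 * j)); ring). auto.
    - intros j. replace (1 ^ 2 * A * B * q ^ 2 * q ^ j)
        with (A * B * q ^ S (S j)) by (rewrite !Cpow_S; ring). auto. }
  assert (HS : Cseries (watson_term q 1 A B) = 1).
  { apply Cseries_Clim.
    apply Clim_ext_from with (fun _ => 1) 1%nat; [|apply Clim_const].
    intros n Hn. rewrite (csum_stable _ 1 n Hn).
    - unfold watson_term. cbn [csum qpoch hpoch reg_ratio Cpow].
      assert (H := wr_k _ _ _ _ Hr 0). cbn [Cpow] in H. field.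
      rewrite Cmult_1_l, Cmult_1_r in H. exact H.
    - intros i Hi. unfold watson_term.
      replace (hpoch q 1 i) with (RtoC 0); [ring|].
      destruct i as [|i]; [lia|]. clear Hi.
      induction i as [|i IH]; [cbn; ring|]. cbn [hpoch] in *.
      rewrite <- IH. ring. }
  assert (E := watson_gauss q Hq0 Hq 1 A B Hr
                 ltac:(left; now rewrite Cmult_1_r)).
  rewrite HS in E. unfold watson_norm in E.
  replace (q * 1 * A) with (A * q) in E by ring.
  replace (q * 1 * B) with (B * q) in E by ring.
  replace (1 ^ 2 * A * B * q ^ 2) with (q * (A * B) * q) in E by ring.
  replace (q * (1 * A * B)) with (q * (A * B)) in E by ring.
  replace (q ^ 2 * 1 ^ 2 * A) with (A * q * q) in E by ring.
  replace (q ^ 2 * 1 ^ 2 * B) with (B * q * q) in E by ring.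
  replace (- (q * 1)) with (- q) in E by ring.
  rewrite (qpoch_inf_double (A * q) q Hq), (qpoch_inf_double (B * q) q Hq),
    (qpoch_inf_double (q * (A * B)) q Hq) in E.
  assert (N1 : qpoch_inf (A * q * q) (q ^ 2) <> 0).
  { apply qpoch_inf_neq_0; [exact Hq2|]. intros j. rewrite <- Cpow_mult_r.
    replace (A * q * q * q ^ (2 * j)) with (A * q ^ S (S (2 * j)))
      by (rewrite !(Cpow_S q); ring). auto. }
  assert (N2 : qpoch_inf (B * q * q) (q ^ 2) <> 0).
  { apply qpoch_inf_neq_0; [exact Hq2|]. intros j. rewrite <- Cpow_mult_r.
    replace (B * q * q * q ^ (2 * j)) with (B * q ^ S (S (2 * j)))
      by (rewrite !(Cpow_S q); ring). auto. }
  assert (N3 : qpoch_inf (q * (A * B)) (q ^ 2) <> 0).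
  { apply qpoch_inf_neq_0; [exact Hq2|]. exact (wr_AB _ _ _ _ Hr). }
  assert (N4 : qpoch_inf (q * (A * B) * q) (q ^ 2) <> 0).
  { apply qpoch_inf_neq_0; [exact Hq2|]. intros j. rewrite <- Cpow_mult_r.
    replace (q * (A * B) * q * q ^ (2 * j)) with (A * B * q ^ S (S (2 * j)))
      by (rewrite !(Cpow_S q); ring). auto. }
  unfold gauss_value.
  apply (Cmult_cancel_l (qpoch_inf (A * q * q) (q ^ 2)
                         * qpoch_inf (B * q * q) (q ^ 2)));
    [|now apply Cmult_neq_0].
  rewrite <- (Cmult_assoc (qpoch_inf q (q ^ 2))) in E. rewrite <- E.
  assert (Eu := euler_odd_distinct).
  transitivity (qpoch_inf (A * q * q) (q ^ 2) * qpoch_inf (B * q * q) (q ^ 2)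
    * (qpoch_inf (A * q) (q ^ 2) * qpoch_inf (B * q) (q ^ 2))
    * (qpoch_inf q (q ^ 2) * qpoch_inf (- q) q)).
  - field. auto.
  - rewrite Eu. ring.
Qed.

(** The functional equation in each parameter moves both into the unit disc. *)
Lemma gauss_second (A B : C) :
  (forall j, 1 - q * (A * B) * (q ^ 2) ^ j <> 0) ->
  qpoch_inf q (q ^ 2) * gauss_value A B
  = qpoch_inf (A * q) (q ^ 2) * qpoch_inf (B * q) (q ^ 2).
Proof.
  intros HAB.
  destruct (shift_small (q ^ 2) Hq2 A (1 / 2)) as [nA HnA]; [lra|].
  destruct (shift_small (q ^ 2) Hq2 B (1 / 2)) as [nB HnB]; [lra|].
  assert (H : forall i A B, (forall j, 1 - q * (A * B) * (q ^ 2) ^ j <> 0) ->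
    (Cmod (A * (q ^ 2) ^ i) < 1)%R -> (Cmod (B * (q ^ 2) ^ i) < 1)%R ->
    qpoch_inf q (q ^ 2) * gauss_value A B
    = qpoch_inf (A * q) (q ^ 2) * qpoch_inf (B * q) (q ^ 2)).
  { clear A B HAB nA HnA nB HnB. induction i as [|i IH]; intros A B HAB HA HB.
    - change ((q ^ 2) ^ 0) with (RtoC 1) in *. rewrite Cmult_1_r in HA, HB.
      now apply gauss_value_small.
    - assert (H1 : forall j, 1 - q * (B * (A * q ^ 2)) * (q ^ 2) ^ j <> 0).
      { intros j. nz_from (HAB (S j)). }
      assert (H2 : forall j, 1 - q * (B * q ^ 2 * (A * q ^ 2)) * (q ^ 2) ^ j <> 0).
      { intros j. nz_from (HAB (S (S j))). }
      assert (H0 : forall j, 1 - q * (A * q ^ 2 * B) * (q ^ 2) ^ j <> 0).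
      { intros j. rewrite (Cmult_comm (A * q ^ 2)). apply H1. }
      rewrite gauss_value_shift, gauss_value_sym, gauss_value_shift by assumption.
      rewrite (qpoch_inf_S (q ^ 2) Hq2 (A * q)), (qpoch_inf_S (q ^ 2) Hq2 (B * q)).
      replace (A * q * q ^ 2) with (A * q ^ 2 * q) by ring.
      replace (B * q * q ^ 2) with (B * q ^ 2 * q) by ring.
      specialize (IH (B * q ^ 2) (A * q ^ 2) H2).
      replace (B * q ^ 2 * (q ^ 2) ^ i) with (B * (q ^ 2) ^ S i) in IH
        by (rewrite (Cpow_S (q ^ 2)); ring).
      replace (A * q ^ 2 * (q ^ 2) ^ i) with (A * (q ^ 2) ^ S i) in IH
        by (rewrite (Cpow_S (q ^ 2)); ring).
      specialize (IH HB HA).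
      transitivity ((1 - A * q) * (1 - B * q)
        * (qpoch_inf q (q ^ 2) * gauss_value (B * q ^ 2) (A * q ^ 2))); [ring|].
      rewrite IH. ring. }
  apply (H (nA + nB)%nat A B HAB).
  - rewrite Cpow_add_r, Cmult_assoc. apply Cmod_mult_lt_1; [lra|].
    now apply Cmod_pow_le_1.
  - rewrite Nat.add_comm, Cpow_add_r, Cmult_assoc. apply Cmod_mult_lt_1; [lra|].
    now apply Cmod_pow_le_1.
Qed.

(** [gauss_second] evaluates the limit series that [watson_gauss] leaves. *)
Lemma watson_sum (z A B : C) :
  watson_regular q z A B -> summable_param q z A B ->
  watson_norm q z A B * Cseries (watson_term q z A B)
  = qpoch_inf (q ^ 2 * z ^ 2 * A) (q ^ 2) * qpoch_inf (q ^ 2 * z ^ 2 * B) (q ^ 2)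
    * (qpoch_inf (A * q) (q ^ 2) * qpoch_inf (B * q) (q ^ 2)).
Proof.
  intros Hr Hs. rewrite (watson_gauss q Hq0 Hq z A B Hr Hs).
  rewrite <- gauss_second by exact (wr_AB _ _ _ _ Hr).
  unfold gauss_value. ring.
Qed.

End Gauss.

(** * An addition formula for theta functions *)

Definition theta (p x : C) : C := qpoch_inf x p * qpoch_inf (p / x) p.

Section Theta.

Variable q : C.
Hypothesis Hq0 : q <> 0.
Hypothesis Hq : (Cmod q < 1)%R.

Let Hq2 : (Cmod (q ^ 2) < 1)%R := Cmod_sqr_lt_1 q Hq.
Let Hq20 : q ^ 2 <> 0 := Cpow_nz q 2 Hq0.

Lemma theta_shift (p x : C) :
  p <> 0 -> (Cmod p < 1)%R -> x <> 0 -> theta p x = - x * theta p (x * p).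
Proof.
  intros Hp0 Hp Hx. unfold theta.
  replace (p / (x * p)) with (/ x) by (field; auto).
  rewrite (qpoch_inf_S p Hp x), (qpoch_inf_S p Hp (/ x)).
  replace (/ x * p) with (p / x) by (unfold Cdiv; ring).
  field. exact Hx.
Qed.

Lemma theta_inv (p x : C) :
  p <> 0 -> x <> 0 -> theta p (p / x) = theta p x.
Proof.
  intros Hp Hx. unfold theta. replace (p / (p / x)) with x by (field; auto). ring.
Qed.

(** The addition formula says that this vanishes when [q z^2 A B = 1]. *)
Definition theta_defect (z A B : C) : C :=
  theta (q ^ 2) (A * q) * theta (q ^ 2) (B * q)
  + q * z * (theta (q ^ 2) A * theta (q ^ 2) B)
  - qpoch_inf q (q ^ 2) ^ 2 * (theta q (q * z * A) * theta q (- (q * z))).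

(** All three products are theta functions of the same quasi-period. *)
Lemma theta_defect_shift (z A B : C) :
  z <> 0 -> A <> 0 ->
  theta_defect (z * q) (A / q ^ 2) B = - (A / q) * theta_defect z A B.
Proof.
  intros Hz HA. unfold theta_defect.
  assert (HAq : A / q ^ 2 <> 0).
  { intros E. apply HA. replace A with (A / q ^ 2 * q ^ 2) by (field; auto).
    rewrite E. ring. }
  rewrite (theta_shift (q ^ 2) (A / q ^ 2 * q) Hq20 Hq2) by now apply Cmult_neq_0.
  rewrite (theta_shift (q ^ 2) (A / q ^ 2) Hq20 Hq2 HAq).
  replace (q * (z * q) * (A / q ^ 2)) with (z * A) by (field; auto).
  rewrite (theta_shift q (z * A) Hq0 Hq) by now apply Cmult_neq_0.
  rewrite (theta_shift q (- (q * z)) Hq0 Hq).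
  2:{ intros E. apply (Cmult_neq_0 q z Hq0 Hz).
      replace (q * z) with (- - (q * z)) by ring. rewrite E. ring. }
  replace (z * A * q) with (q * z * A) by ring.
  replace (A / q ^ 2 * q * q ^ 2) with (A * q) by (field; auto).
  replace (A / q ^ 2 * q ^ 2) with A by (field; auto).
  replace (- (q * z) * q) with (- (q * (z * q))) by ring.
  field. auto.
Qed.

Lemma theta_defect_iter (z A B : C) (s : nat) :
  z <> 0 -> A <> 0 ->
  (theta_defect (z * q ^ s) (A / (q ^ 2) ^ s) B = 0 <-> theta_defect z A B = 0).
Proof.
  intros Hz HA. induction s as [|s IH].
  - change (q ^ 0) with (RtoC 1). change ((q ^ 2) ^ 0) with (RtoC 1).
    replace (A / 1) with A by field. now rewrite Cmult_1_r.
  - rewrite <- IH. clear IH.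
    assert (H1 : q ^ s <> 0) by now apply Cpow_nz.
    assert (H2 : (q ^ 2) ^ s <> 0) by now apply Cpow_nz.
    replace (z * q ^ S s) with (z * q ^ s * q) by (rewrite Cpow_S; ring).
    replace (A / (q ^ 2) ^ S s) with (A / (q ^ 2) ^ s / q ^ 2)
      by (rewrite (Cpow_S (q ^ 2)); field; auto).
    assert (HA' : A / (q ^ 2) ^ s <> 0).
    { intros E. apply HA. replace A with (A / (q ^ 2) ^ s * (q ^ 2) ^ s)
        by (field; auto). rewrite E. ring. }
    rewrite theta_defect_shift by auto using Cmult_neq_0.
    split; intros E.
    + apply (Cmult_cancel_l (- (A / (q ^ 2) ^ s / q))).
      * rewrite E. ring.
      * intros E'. apply HA'.
        replace (A / (q ^ 2) ^ s) with (- - (A / (q ^ 2) ^ s / q) * q)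
          by (field; auto).
        rewrite E'. ring.
    + rewrite E. ring.
Qed.

(** At [z = -1] the last product has a zero factor and the other two cancel. *)
Lemma theta_defect_m1 (A B : C) :
  A <> 0 -> q * (A * B) = 1 -> theta_defect (- (1)) A B = 0.
Proof.
  intros HA E.
  assert (EB : B = / (q * A)).
  { apply (Cmult_cancel_l (q * A)); [|now apply Cmult_neq_0].
    rewrite <- Cmult_assoc, E. field. auto. }
  unfold theta_defect. subst B.
  replace (theta q (- (q * - (1)))) with (RtoC 0).
  2:{ replace (- (q * - (1))) with q by ring. unfold theta.
      replace (q / q) with (RtoC 1) by (field; exact Hq0).
      rewrite (qpoch_inf_S q Hq 1). ring. }
  replace (/ (q * A) * q) with (q ^ 2 / (A * q ^ 2)) by (field; auto).
  rewrite theta_inv by auto using Cmult_neq_0.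
  replace (/ (q * A)) with (q ^ 2 / (A * q * q ^ 2)) by (field; auto).
  rewrite theta_inv by auto using Cmult_neq_0.
  rewrite (theta_shift (q ^ 2) A Hq20 Hq2 HA).
  rewrite (theta_shift (q ^ 2) (A * q) Hq20 Hq2) by now apply Cmult_neq_0.
  ring.
Qed.

(** For [a = 1/q] the factors of the normalization pair into thetas, since the
    denominator [(1/z;q)_oo] divides [(q A B;q^2)_oo = (1/z^2;q^2)_oo]. *)
Lemma watson_norm_theta (z A B : C) :
  z <> 0 -> A <> 0 -> q * (z ^ 2 * A * B) = 1 ->
  (forall j, 1 - z * A * B * q ^ j <> 0) ->
  watson_norm q z A B
  = qpoch_inf q (q ^ 2) ^ 2 * (theta q (q * z * A) * theta q (- (q * z))).
Proof.
  intros Hz HA E HK.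
  assert (HzA : z * A <> 0) by now apply Cmult_neq_0.
  assert (EB : B = / (q * z ^ 2 * A)).
  { apply (Cmult_cancel_l (q * z ^ 2 * A)).
    - replace (q * z ^ 2 * A * B) with (q * (z ^ 2 * A * B)) by ring.
      rewrite E. field. auto.
    - repeat apply Cmult_neq_0; auto using C1_neq_0. }
  assert (Hk : qpoch_inf (/ z) q <> 0).
  { apply qpoch_inf_neq_0; [exact Hq|]. intros j.
    replace (/ z * q ^ j) with (z * A * B * q ^ S j)
      by (rewrite EB, (Cpow_S q j); field; auto). apply HK. }
  clear E HK. subst B.
  unfold watson_norm, theta.
  replace (q * z * / (q * z ^ 2 * A)) with (q / (q * z * A)) by (field; auto).
  replace (q * (A * / (q * z ^ 2 * A))) with ((/ z) ^ 2) by (field; auto).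
  replace (z ^ 2 * A * / (q * z ^ 2 * A) * q ^ 2) with q by (field; auto).
  replace (q * (z * A * / (q * z ^ 2 * A))) with (/ z) by (field; auto).
  replace (q / - (q * z)) with (- / z) by (field; auto).
  rewrite <- (qpoch_inf_pm (/ z) q Hq). field. exact Hk.
Qed.

(** For [a = 1/q] one has [k q = 1/z], and what follows the first term is, up
    to a constant, the Watson series with [A q] and [B q]. *)
Lemma watson_term_tail (z A B : C) (n : nat) :
  watson_regular q z A B -> q * (z ^ 2 * A * B) = 1 ->
  watson_term q z A B (S n)
  = q * (1 - z) * (1 - A) * (1 - B) * (1 - z * A * B * q ^ 2)
    / ((1 - q) * (1 - q * z * A) * (1 - q * z * B) * (1 - q * (A * B)))
    * watson_term q z (A * q) (B * q) n.
Proof.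
  intros [H1 H2 H3 H4 H5 H6] E. unfold watson_term.
  assert (Er : reg_ratio q (z ^ 2 * A * B) (S n)
               = qpoch (q ^ 2) (q ^ 2) n / qpoch q q n).
  { cbn [reg_ratio].
    replace (z ^ 2 * A * B * q ^ 3) with (q * (z ^ 2 * A * B) * q ^ 2) by ring.
    replace (z ^ 2 * A * B * q ^ 2) with (q * (z ^ 2 * A * B) * q) by ring.
    now rewrite E, !Cmult_1_l. }
  assert (D1 : 1 - q <> 0).
  { rewrite <- (Cmult_1_r q). apply (one_minus_qpow_neq_0 q 0 Hq). }
  assert (D2 : 1 - q ^ 2 <> 0).
  { replace (q ^ 2) with (q * q ^ 1) by ring. now apply one_minus_qpow_neq_0. }
  assert (Er' : reg_ratio q (z ^ 2 * (A * q) * (B * q)) n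
     = qpoch (q ^ 2) (q ^ 2) n * (1 - q) / (qpoch q q n * (1 - q * q ^ n))).
  { replace (z ^ 2 * (A * q) * (B * q)) with (q * (z ^ 2 * A * B) * q) by ring.
    rewrite E, Cmult_1_l. destruct n as [|n].
    - cbn [reg_ratio qpoch Cpow]. field. rewrite ?Cmult_1_r. auto using C1_neq_0.
    - cbn [reg_ratio].
      assert (E1 : qpoch (q ^ 2) (q ^ 2) (S n)
                   = (1 - q ^ 2) * qpoch (q * q ^ 3) (q ^ 2) n).
      { rewrite qpoch_S_l. do 2 f_equal. ring. }
      assert (E2 : qpoch q q (S n) * (1 - q * q ^ S n)
                   = (1 - q) * (1 - q ^ 2) * qpoch (q * q ^ 2) q n).
      { rewrite <- qpoch_S, !qpoch_S_l.
        replace (q * q) with (q ^ 2) by ring.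
        replace (q ^ 2 * q) with (q * q ^ 2) by ring. ring. }
      rewrite E1, E2. field. split; [|auto].
      intros E0. rewrite E0, Cmult_0_r, <- qpoch_S in E2.
      revert E2. now apply qpoch_qq_neq_0. }
  rewrite Er, Er'. clear Er Er'.
  assert (K1 : 1 - z * A * B <> 0).
  { nz_from (H2 0%nat). }
  assert (K2 : 1 - z * A * B * q <> 0).
  { nz_from (H2 1%nat). }
  assert (K3 : 1 - z * A * B * q ^ 2 <> 0) by apply (H2 2%nat).
  assert (KA : 1 - q * z * A <> 0).
  { nz_from (H3 0%nat). }
  assert (KB : 1 - q * z * B <> 0).
  { nz_from (H4 0%nat). }
  assert (KAB : 1 - q * (A * B) <> 0).
  { nz_from (H5 0%nat). }
  assert (Ek : qpoch (z * A * B) q (S n) * (q * (q ^ n - z))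
     = (1 - z * A * B) * (q * (1 - z)) * qpoch (z * A * B * q ^ 2) q n).
  { rewrite qpoch_S_l.
    assert (Ek : (1 - z * A * B * q) * qpoch (z * A * B * q ^ 2) q n
      = qpoch (z * A * B * q) q n * (1 - z * A * B * q * q ^ n)).
    { rewrite <- qpoch_S, qpoch_S_l. do 2 f_equal. ring. }
    assert (Hzk : z * A * B * q = / z).
    { apply (Cmult_cancel_l z); [|exact H1].
      replace (z * (z * A * B * q)) with (q * (z ^ 2 * A * B)) by ring.
      rewrite E. field. exact H1. }
    assert (Hx : q * (q ^ n - z) = - (q * z) * (1 - z * A * B * q * q ^ n)).
    { rewrite Hzk. field. exact H1. }
    assert (Hy : q * (1 - z) = - (q * z) * (1 - z * A * B * q)).
    { rewrite Hzk. field. exact H1. }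
    rewrite Hx, Hy.
    transitivity (- (q * z) * (1 - z * A * B)
      * (qpoch (z * A * B * q) q n * (1 - z * A * B * q * q ^ n))); [ring|].
    rewrite <- Ek. ring. }
  rewrite (qpoch_S_l (q * z * A)), (qpoch_S_l (q * z * B)),
    (qpoch_S_l (q * (A * B))), (qpoch_S_l A), (qpoch_S_l B), (qpoch_S q).
  cbn [hpoch].
  replace (z * (A * q) * (B * q)) with (z * A * B * q ^ 2) by ring.
  replace (q * z * (A * q)) with (q * z * A * q) by ring.
  replace (q * z * (B * q)) with (q * z * B * q) by ring.
  replace (q * (A * q * (B * q))) with (q * (A * B) * q ^ 2) by ring.
  assert (N1 := qpoch_qq_neq_0 q n Hq).
  assert (N2 := one_minus_qpow_neq_0 q n Hq).
  assert (N3 : qpoch (q * z * A * q) q n <> 0).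
  { apply qpoch_neq_0. intros j _.
    nz_from (H3 (S j)). }
  assert (N4 : qpoch (q * z * B * q) q n <> 0).
  { apply qpoch_neq_0. intros j _.
    nz_from (H4 (S j)). }
  assert (N5 : qpoch (q * (A * B) * q ^ 2) (q ^ 2) n <> 0).
  { apply qpoch_neq_0. intros j _.
    nz_from (H5 (S j)). }
  rewrite (Cpow_S q n).
  transitivity ((1 - z * A * B * (q * q ^ n) ^ 2) / (1 - z * A * B)
    * (qpoch (z * A * B) q (S n) * (q * (q ^ n - z)))
    * (qpoch (q ^ 2) (q ^ 2) n / qpoch q q n)
    / ((1 - q * z * A) * qpoch (q * z * A * q) q n
       * ((1 - q * z * B) * qpoch (q * z * B * q) q n))
    * hpoch q z n
    * ((1 - A) * qpoch (A * q) q n * ((1 - B) * qpoch (B * q) q n)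
       / (qpoch q q n * (1 - q * q ^ n)
          * ((1 - q * (A * B)) * qpoch (q * (A * B) * q ^ 2) (q ^ 2) n)))).
  { unfold Cdiv. ring. }
  rewrite Ek. clear Ek H2 H3 H4 H5 H6.
  set (w := z * A * B) in *. clearbody w. qatoms.
  field. repeat split; auto.
Qed.

(** Both the series and its tail are Watson series with known values; their
    difference is the first term, [1]. *)
Lemma theta_addition_small (z A B : C) :
  watson_regular q z A B -> A <> 0 -> (Cmod (q * z) < 1)%R ->
  q * (z ^ 2 * A * B) = 1 -> theta_defect z A B = 0.
Proof.
  intros Hr HA Hz E. assert (Hr' := Hr).
  destruct Hr' as [H1 H2 H3 H4 H5 H6].
  assert (HB : B <> 0) by (intros ->; apply C1_neq_0; rewrite <- E; ring).
  assert (Hr1 : watson_regular q z (A * q) (B * q)).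
  { constructor; auto.
    - intros j. nz_from (H2 (S (S j))).
    - intros j. nz_from (H3 (S j)).
    - intros j. nz_from (H4 (S j)).
    - intros j. nz_from (H5 (S j)).
    - intros j. nz_from (H6 (S (S j))). }
  assert (S0 := watson_sum q Hq0 Hq z A B Hr (or_introl Hz)).
  assert (S1 := watson_sum q Hq0 Hq z (A * q) (B * q) Hr1 (or_introl Hz)).
  set (T := Cseries (watson_term q z (A * q) (B * q))) in *.
  set (t1 := q * (1 - z) * (1 - A) * (1 - B) * (1 - z * A * B * q ^ 2)
    / ((1 - q) * (1 - q * z * A) * (1 - q * z * B) * (1 - q * (A * B)))).
  assert (K1 : 1 - z * A * B <> 0).
  { nz_from (H2 0%nat). }
  assert (ES : Cseries (watson_term q z A B) = 1 + t1 * T).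
  { apply Cseries_Clim. apply Clim_unshift with 1%nat.
    apply Clim_ext with
      (fun n => 1 + t1 * csum (watson_term q z (A * q) (B * q)) n).
    - intros n. rewrite Nat.add_1_r, csum_S_l, <- csum_scal. f_equal.
      + unfold watson_term. cbn [qpoch hpoch reg_ratio Cpow].
        field. exact K1.
      + apply csum_ext. intros i _. symmetry. now apply watson_term_tail.
    - apply Clim_plus; [apply Clim_const|]. apply Clim_scal.
      apply watson_Clim; auto. now left. }
  assert (EN : watson_norm q z A B * t1
    = - (q * z) * (1 - A) * (1 - B) * watson_norm q z (A * q) (B * q)).
  { unfold watson_norm, t1.
    assert (Hzk : z * A * B * q = / z).
    { apply (Cmult_cancel_l z); [|exact H1].
      replace (z * (z * A * B * q)) with (q * (z ^ 2 * A * B)) by ring.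
      rewrite E. field. exact H1. }
    assert (K2 : 1 - z * A * B * q <> 0).
    { nz_from (H2 1%nat). }
    assert (K3 : 1 - z * A * B * q ^ 2 <> 0) by apply (H2 2%nat).
    assert (KA : 1 - q * z * A <> 0).
    { nz_from (H3 0%nat). }
    assert (KB : 1 - q * z * B <> 0).
    { nz_from (H4 0%nat). }
    assert (KAB : 1 - q * (A * B) <> 0).
    { nz_from (H5 0%nat). }
    assert (D1 : 1 - q <> 0).
    { rewrite <- (Cmult_1_r q). apply (one_minus_qpow_neq_0 q 0 Hq). }
    assert (Kinf : qpoch_inf (q * (z * (A * q) * (B * q))) q <> 0).
    { apply qpoch_inf_neq_0; [exact Hq|]. intros j.
      nz_from (H2 (S (S (S j)))). }
    rewrite (qpoch_inf_S q Hq (q * z * A)), (qpoch_inf_S q Hq (q * z * B)),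
      (qpoch_inf_S (q ^ 2) Hq2 (q * (A * B))),
      (qpoch_inf_S (q ^ 2) Hq2 (z ^ 2 * A * B * q ^ 2)),
      (qpoch_inf_S q Hq (q * (z * A * B))),
      (qpoch_inf_S q Hq (q * (z * A * B) * q)).
    replace (q * (z * A * B) * q * q) with (q * (z * (A * q) * (B * q))) by ring.
    replace (q * z * A * q) with (q * z * (A * q)) by ring.
    replace (q * z * B * q) with (q * z * (B * q)) by ring.
    replace (q * (A * B) * q ^ 2) with (q * (A * q * (B * q))) by ring.
    replace (z ^ 2 * A * B * q ^ 2 * q ^ 2)
      with (z ^ 2 * (A * q) * (B * q) * q ^ 2) by ring.
    replace (1 - z ^ 2 * A * B * q ^ 2) with (1 - q)
      by (replace (z ^ 2 * A * B * q ^ 2) with (q * (z ^ 2 * A * B) * q) by ring;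
          rewrite E; ring).
    replace (1 - z) with (- z * (1 - z * A * B * q))
      by (rewrite Hzk; field; exact H1).
    replace (q * (z * A * B)) with (z * A * B * q) by ring.
    replace (z * A * B * q * q) with (z * A * B * q ^ 2) by ring.
    clear Hzk. field. repeat split; auto. }
  rewrite ES in S0. unfold theta_defect.
  rewrite <- (watson_norm_theta z A B H1 HA E H2).
  replace (watson_norm q z A B) with
    (watson_norm q z A B * (1 + t1 * T) - watson_norm q z A B * t1 * T) by ring.
  rewrite S0, EN.
  replace (- (q * z) * (1 - A) * (1 - B) * watson_norm q z (A * q) (B * q) * T)
    with (- (q * z) * (1 - A) * (1 - B)
          * (watson_norm q z (A * q) (B * q) * T)) by ring.
  rewrite S1. unfold theta.
  rewrite (qpoch_inf_S (q ^ 2) Hq2 A), (qpoch_inf_S (q ^ 2) Hq2 B).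
  assert (EA : q ^ 2 * z ^ 2 * A = q / B).
  { apply (Cmult_cancel_l B); [|exact HB].
    replace (B * (q ^ 2 * z ^ 2 * A)) with (q * (q * (z ^ 2 * A * B))) by ring.
    rewrite E. field. exact HB. }
  assert (EB : q ^ 2 * z ^ 2 * B = q / A).
  { apply (Cmult_cancel_l A); [|exact HA].
    replace (A * (q ^ 2 * z ^ 2 * B)) with (q * (q * (z ^ 2 * A * B))) by ring.
    rewrite E. field. exact HA. }
  replace (q ^ 2 * z ^ 2 * (A * q)) with (q ^ 2 * z ^ 2 * A * q) by ring.
  replace (q ^ 2 * z ^ 2 * (B * q)) with (q ^ 2 * z ^ 2 * B * q) by ring.
  rewrite EA, EB.
  replace (q ^ 2 / (A * q)) with (q / A) by (field; auto).
  replace (q ^ 2 / (B * q)) with (q / B) by (field; auto).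
  replace (q / B * q) with (q ^ 2 / B) by (field; auto).
  replace (q / A * q) with (q ^ 2 / A) by (field; auto).
  replace (A * q * q) with (A * q ^ 2) by ring.
  replace (B * q * q) with (B * q ^ 2) by ring.
  ring.
Qed.

End Theta.

Section Truncated.

Variable q : C.
Hypothesis Hq0 : q <> 0.
Hypothesis Hq : (Cmod q < 1)%R.

Let Hq2 : (Cmod (q ^ 2) < 1)%R := Cmod_sqr_lt_1 q Hq.
Let Hq20 : q ^ 2 <> 0 := Cpow_nz q 2 Hq0.

Lemma qpow_cancel (x : C) (i j : nat) :
  x * q ^ i = q ^ j -> x * q ^ (i - j) = q ^ (j - i).
Proof.
  intros E. destruct (Nat.le_ge_cases i j) as [H|H].
  - replace (i - j)%nat with 0%nat by lia.
    apply (Cmult_cancel_l (q ^ i)); [|now apply Cpow_nz].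
    rewrite <- Cpow_add_r. replace (i + (j - i))%nat with j by lia.
    rewrite <- E. simpl. ring.
  - replace (j - i)%nat with 0%nat by lia.
    apply (Cmult_cancel_l (q ^ j)); [|now apply Cpow_nz].
    transitivity (x * (q ^ j * q ^ (i - j))); [ring|].
    rewrite <- Cpow_add_r. replace (j + (i - j))%nat with i by lia.
    rewrite E. simpl. ring.
Qed.

(** The quasi-periodicity moves [z] towards zero, where the Watson sum
    applies; its exceptional points [z = - q^j] are moved to [z = -1]. *)
Lemma theta_addition (z A B : C) :
  z <> 0 -> A <> 0 -> q * (z ^ 2 * A * B) = 1 ->
  (forall i j, z * q ^ i <> q ^ j) ->
  (forall i j, z * A * q ^ i <> q ^ j) ->
  theta_defect q z A B = 0.
Proof.
  intros Hz HA E Hzq HzA.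
  destruct (shift_small q Hq (q * z) (1 / 2)) as [s Hs]; [lra|].
  apply (theta_defect_iter q Hq0 Hq z A B s Hz HA).
  assert (Hs0 : q ^ s <> 0) by now apply Cpow_nz.
  set (z' := z * q ^ s). set (A' := A / (q ^ 2) ^ s).
  assert (Hz' : z' <> 0) by now apply Cmult_neq_0.
  assert (EA : A' * (q ^ s) ^ 2 = A).
  { unfold A'. rewrite qpow_double. field. exact Hs0. }
  assert (HA' : A' <> 0) by (intros E0; apply HA; rewrite <- EA, E0; ring).
  assert (E' : q * (z' ^ 2 * A' * B) = 1).
  { rewrite <- E, <- EA. unfold z'. ring. }
  assert (EzA : z' * A' * q ^ s = z * A) by (rewrite <- EA; unfold z'; ring).
  assert (HB : B <> 0) by (intros ->; apply C1_neq_0; rewrite <- E; ring).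
  clearbody A'.
  destruct (classic (exists j, z' = - q ^ j)) as [[j Hj]|Hj].
  - assert (Hm1 : - (1) <> RtoC 0).
    { intros E0. apply C1_neq_0. replace (RtoC 1) with (- - (1)) by ring.
      rewrite E0. ring. }
    assert (Hj2 : (q ^ 2) ^ j <> 0) by now apply Cpow_nz.
    replace z' with (- (1) * q ^ j) by (rewrite Hj; ring).
    replace A' with (A' * (q ^ 2) ^ j / (q ^ 2) ^ j) by (field; exact Hj2).
    apply (theta_defect_iter q Hq0 Hq); [exact Hm1|now apply Cmult_neq_0|].
    apply (theta_defect_m1 q Hq0 Hq); [now apply Cmult_neq_0|].
    rewrite <- E', Hj, qpow_double. ring.
  - apply (theta_addition_small q Hq0 Hq); auto.
    2:{ replace (q * z') with (q * z * q ^ s) by (unfold z'; ring). lra. }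
    constructor; auto.
    + intros j E0. apply (Hzq (s + 1)%nat j).
      transitivity (q * z' * 1); [rewrite Cpow_add_r, Cpow_1_r; unfold z'; ring|].
      replace (RtoC 1) with (z' * A' * B * q ^ j + (1 - z' * A' * B * q ^ j)) by ring.
      rewrite E0. transitivity (q * (z' ^ 2 * A' * B) * q ^ j); [ring|].
      rewrite E'. ring.
    + intros j E0. apply (HzA (S j) s).
      transitivity (q ^ s * (q * z' * A' * q ^ j + (1 - q * z' * A' * q ^ j))).
      * rewrite E0, <- EzA, Cpow_S. ring.
      * ring.
    + intros j E0. apply (HzA 0%nat (s + j)%nat).
      transitivity (z' * A' * q ^ s
        * (q * z' * B * q ^ j + (1 - q * z' * B * q ^ j))).
      * rewrite <- EzA. simpl. ring.
      * rewrite E0, Cpow_add_r.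
        transitivity (q * (z' ^ 2 * A' * B) * (q ^ s * q ^ j)); [ring|].
        rewrite E'. ring.
    + intros j E0.
      assert (E1 : (z' - q ^ j) * (z' + q ^ j) = 0).
      { transitivity (z' ^ 2 * (1 - q * (A' * B) * (q ^ 2) ^ j)
                      + (q * (z' ^ 2 * A' * B) - 1) * (q ^ j) ^ 2).
        - rewrite qpow_double. ring.
        - rewrite E0, E'. ring. }
      destruct (Ceq_dec (z' - q ^ j) 0) as [D|D].
      * apply (Hzq s j). fold z'. replace z' with (z' - q ^ j + q ^ j) by ring.
        rewrite D. ring.
      * apply Hj. exists j. replace z' with (z' + q ^ j - q ^ j) by ring.
        replace (z' + q ^ j) with (RtoC 0); [ring|].
        apply (Cmult_cancel_l (z' - q ^ j)); [|exact D]. rewrite E1. ring.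
    + intros j. replace (z' ^ 2 * A' * B * q ^ 2 * q ^ j)
        with (q * (z' ^ 2 * A' * B) * (q * q ^ j)) by ring.
      rewrite E', Cmult_1_l. now apply one_minus_qpow_neq_0.
Qed.

(** * The truncated Watson sum, [a q^(2M+1) = 1] *)

Lemma qpow_neq_1 (n : nat) : (0 < n)%nat -> 1 - q ^ n <> 0.
Proof.
  intros Hn. destruct n as [|n]; [lia|]. rewrite Cpow_S.
  now apply one_minus_qpow_neq_0.
Qed.

Lemma qpow_inverse_neq_1 (x : C) (n j : nat) :
  x * q ^ n = 1 -> (j < n)%nat -> 1 - x * q ^ j <> 0.
Proof.
  intros E Hj E0. apply (qpow_neq_1 (n - j)); [lia|].
  rewrite <- E. replace n with (j + (n - j))%nat at 1 by lia.
  rewrite Cpow_add_r.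
  transitivity (- (1 - x * q ^ j) * q ^ (n - j)); [ring|].
  rewrite E0. ring.
Qed.

(** Each contiguous step shortens the sum by one term, until only the first
    term is left. *)
Lemma watson_truncated_norm (M : nat) : forall z A B,
  (forall j, 1 - z * A * B * q ^ j <> 0) ->
  (forall j, 1 - q * z * A * q ^ j <> 0) ->
  (forall j, 1 - q * z * B * q ^ j <> 0) ->
  (forall j, 1 - q * (A * B) * (q ^ 2) ^ j <> 0) ->
  z ^ 2 * A * B * q ^ (2 * M + 1) = 1 ->
  watson_norm q z A B * csum (watson_term q z A B) (S M)
  = qpoch (q ^ 2 * z ^ 2 * A) (q ^ 2) M * qpoch (q ^ 2 * z ^ 2 * B) (q ^ 2) M
    * watson_norm q (z * q ^ M) A B.
Proof.
  induction M as [|M IH]; intros z A B HK HA HB HAB E.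
  - assert (K1 : 1 - z * A * B <> 0).
    { nz_from (HK 0%nat). }
    replace (z * q ^ 0) with z by (simpl; ring).
    unfold watson_term. cbn [csum qpoch hpoch reg_ratio Cpow].
    field. exact K1.
  - set (a := z ^ 2 * A * B) in *.
    assert (Ha2 : 1 - a * q ^ 2 <> 0).
    { apply (qpow_inverse_neq_1 a _ 2 E). lia. }
    assert (Ha3 : forall j, (j < M)%nat -> 1 - a * q ^ 3 * q ^ j <> 0).
    { intros j Hj. rewrite <- Cmult_assoc, <- Cpow_add_r.
      apply (qpow_inverse_neq_1 a _ _ E). lia. }
    assert (Elast : a * q ^ 3 * (q ^ M) ^ 2 = 1).
    { rewrite <- E, <- Cmult_assoc, <- Cpow_mult_r, <- Cpow_add_r.
      do 2 f_equal. lia. }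
    assert (HT := watson_telescope q Hq z A B HK HA HB HAB Ha2 M Ha3).
    assert (HL := watson_telescope_last q Hq z A B HK HA HB HAB Ha2 M Ha3 Elast).
    specialize (IH (q * z) A B).
    assert (IH' : watson_norm q (q * z) A B * csum (watson_term q (q * z) A B) (S M)
      = qpoch (q ^ 2 * (q * z) ^ 2 * A) (q ^ 2) M
        * qpoch (q ^ 2 * (q * z) ^ 2 * B) (q ^ 2) M
        * watson_norm q (q * z * q ^ M) A B).
    { apply IH.
      - intros j. nz_from (HK (S j)).
      - intros j. nz_from (HA (S j)).
      - intros j. nz_from (HB (S j)).
      - exact HAB.
      - rewrite <- E. unfold a.
        replace (2 * S M + 1)%nat with (2 + (2 * M + 1))%nat by lia.
        rewrite (Cpow_add_r q 2). ring. }
    clear IH.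
    rewrite (watson_norm_shift q Hq z A B HK).
    set (L := (1 - q * z * A) * (1 - q * z * B) * (1 - z ^ 2 * A * B * q ^ 2)
              * (1 + q * z) / (1 - q * (z * A * B))).
    set (R := (1 - q ^ 2 * z ^ 2 * A) * (1 - q ^ 2 * z ^ 2 * B)).
    fold a in HT, HL.
    change ((1 - q * z * A) * (1 - q * z * B) * (1 - a * q ^ 2)
            * (1 + q * z) / (1 - q * (z * A * B))) with L in HT, HL.
    change ((1 - q ^ 2 * z ^ 2 * A) * (1 - q ^ 2 * z ^ 2 * B)) with R in HT.
    assert (ER : L * csum (watson_term q z A B) (S (S M))
                 = R * csum (watson_term q (q * z) A B) (S M)).
    { rewrite (csum_S _ (S M)), Cmult_plus_distr_l.
      replace (L * watson_term q z A B (S M)) with (- watson_cert q z A B M).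
      2:{ transitivity (L * watson_term q z A B (S M)
            - (watson_cert q z A B M + L * watson_term q z A B (S M))); [ring|].
          rewrite HL. ring. }
      rewrite <- HT.
      rewrite csum_minus_scal. ring. }
    transitivity (watson_norm q (q * z) A B
      * (L * csum (watson_term q z A B) (S (S M)))); [ring|].
    rewrite ER.
    transitivity (R * (watson_norm q (q * z) A B
      * csum (watson_term q (q * z) A B) (S M))); [ring|].
    rewrite IH', !qpoch_S_l. unfold R.
    replace (q * z * q ^ M) with (z * q ^ S M) by (rewrite Cpow_S; ring).
    replace (q ^ 2 * (q * z) ^ 2 * A) with (q ^ 2 * z ^ 2 * A * q ^ 2) by ring.
    replace (q ^ 2 * (q * z) ^ 2 * B) with (q ^ 2 * z ^ 2 * B * q ^ 2) by ring.
    ring.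
Qed.

(** Since [q (z q^M)^2 A B = 1], the normalization at [z q^M] is a product of
    thetas, which the addition formula splits in two. The first part is the
    value that the infinite series would have; the second is contributed by
    the reflected index. *)
Lemma watson_truncated (z A B : C) (M : nat) :
  z <> 0 -> A <> 0 -> B <> 0 ->
  (forall j, 1 - z * A * B * q ^ j <> 0) ->
  (forall j, 1 - q * z * q ^ j <> 0) ->
  (forall j, 1 - q * z * A * q ^ j <> 0) ->
  (forall j, 1 - q * z * B * q ^ j <> 0) ->
  (forall j, 1 - q * (A * B) * (q ^ 2) ^ j <> 0) ->
  z ^ 2 * A * B * q ^ (2 * M + 1) = 1 ->
  watson_norm q z A B * csum (watson_term q z A B) (S M)
  = qpoch_inf (q ^ 2 * z ^ 2 * A) (q ^ 2) * qpoch_inf (q ^ 2 * z ^ 2 * B) (q ^ 2)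
    * (qpoch_inf (A * q) (q ^ 2) * qpoch_inf (B * q) (q ^ 2))
    + z * q ^ (M + 1)
      * (qpoch (q ^ 2 * z ^ 2 * A) (q ^ 2) M * qpoch (q ^ 2 * z ^ 2 * B) (q ^ 2) M)
      * (qpoch_inf A (q ^ 2) * qpoch_inf B (q ^ 2)
         * (qpoch_inf (q ^ 2 / A) (q ^ 2) * qpoch_inf (q ^ 2 / B) (q ^ 2))).
Proof.
  intros Hz HA0 HB0 HK Hzj HA HB HAB E.
  rewrite watson_truncated_norm by assumption.
  assert (HM : q ^ M <> 0) by now apply Cpow_nz.
  assert (E2 : q ^ (2 * M + 1) = q * (q ^ M) ^ 2).
  { rewrite Nat.add_1_r, Cpow_S, Nat.mul_comm, Cpow_mult_r. reflexivity. }
  assert (E0 : q * ((z * q ^ M) ^ 2 * A * B) = 1) by (rewrite <- E, E2; ring).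
  assert (HT : theta_defect q (z * q ^ M) A B = 0).
  { apply theta_addition; auto using Cmult_neq_0.
    - intros i j Eij. rewrite <- Cmult_assoc, <- Cpow_add_r in Eij.
      apply qpow_cancel in Eij.
      destruct (Nat.le_gt_cases (M + i) j) as [H|H].
      + replace (M + i - j)%nat with 0%nat in Eij by lia.
        rewrite Cmult_1_r in Eij.
        apply (HK (2 * M + 1 + (j - (M + i)))%nat).
        rewrite Cpow_add_r, <- Eij, <- E. ring.
      + replace (j - (M + i))%nat with 0%nat in Eij by lia.
        apply (Hzj (M + i - j - 1)%nat).
        replace (q * z * q ^ (M + i - j - 1)) with (z * q ^ S (M + i - j - 1))
          by (rewrite Cpow_S; ring).
        replace (S (M + i - j - 1)) with (M + i - j)%nat by lia.
        rewrite Eij. simpl. ring.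
    - intros i j Eij.
      replace (z * q ^ M * A * q ^ i) with (z * A * q ^ (M + i)) in Eij
        by (rewrite Cpow_add_r; ring).
      apply qpow_cancel in Eij.
      destruct (Nat.le_gt_cases (M + i) j) as [H|H].
      + replace (M + i - j)%nat with 0%nat in Eij by lia.
        rewrite Cmult_1_r in Eij.
        apply (HB (2 * M + (j - (M + i)))%nat).
        rewrite Cpow_add_r, <- Eij, <- E, (Cpow_add_r q (2 * M)), Cpow_1_r. ring.
      + replace (j - (M + i))%nat with 0%nat in Eij by lia.
        apply (HA (M + i - j - 1)%nat).
        replace (q * z * A * q ^ (M + i - j - 1))
          with (z * A * q ^ S (M + i - j - 1)) by (rewrite Cpow_S; ring).
        replace (S (M + i - j - 1)) with (M + i - j)%nat by lia.
        rewrite Eij. simpl. ring. }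
  unfold theta_defect in HT.
  rewrite <- (watson_norm_theta q Hq0 Hq (z * q ^ M) A B) in HT; auto.
  2:{ now apply Cmult_neq_0. }
  2:{ intros j. nz_from (HK (M + j)%nat). }
  replace (watson_norm q (z * q ^ M) A B) with
    (theta (q ^ 2) (A * q) * theta (q ^ 2) (B * q)
     + q * (z * q ^ M) * (theta (q ^ 2) A * theta (q ^ 2) B)).
  2:{ transitivity (theta (q ^ 2) (A * q) * theta (q ^ 2) (B * q)
     + q * (z * q ^ M) * (theta (q ^ 2) A * theta (q ^ 2) B) - 0); [ring|].
      rewrite <- HT. ring. }
  rewrite (qpoch_inf_split (q ^ 2) Hq2 (q ^ 2 * z ^ 2 * A) M),
    (qpoch_inf_split (q ^ 2) Hq2 (q ^ 2 * z ^ 2 * B) M), !qpow_double.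
  unfold theta.
  replace (q ^ 2 * z ^ 2 * A * (q ^ M) ^ 2) with (q ^ 2 / (B * q)).
  2:{ apply (Cmult_cancel_l B); [|exact HB0].
      transitivity (q * (q * ((z * q ^ M) ^ 2 * A * B))); [|ring].
      rewrite E0. field. auto. }
  replace (q ^ 2 * z ^ 2 * B * (q ^ M) ^ 2) with (q ^ 2 / (A * q)).
  2:{ apply (Cmult_cancel_l A); [|exact HA0].
      transitivity (q * (q * ((z * q ^ M) ^ 2 * A * B))); [|ring].
      rewrite E0. field. auto. }
  rewrite Cpow_add_r, Cpow_1_r. ring.
Qed.

End Truncated.

(** * Summation over the Bailey pair *)

Section Bridge.

Variable q : C.
Hypothesis Hq0 : q <> 0.
Hypothesis Hq : (Cmod q < 1)%R.

Let Hq2 : (Cmod (q ^ 2) < 1)%R := Cmod_sqr_lt_1 q Hq.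
Let Hq20 : q ^ 2 <> 0 := Cpow_nz q 2 Hq0.

Variables z A B : C.
Hypothesis Hz : z <> 0.
Hypothesis HA0 : A <> 0.
Hypothesis HB0 : B <> 0.

Let k := z * A * B.
Let a := z ^ 2 * A * B.

Hypothesis H1a : 1 - a <> 0.
Hypothesis HK : forall j, 1 - k * q ^ j <> 0.
Hypothesis Hzj : forall j, 1 - q * z * q ^ j <> 0.
Hypothesis HA : forall j, 1 - q * z * A * q ^ j <> 0.
Hypothesis HB : forall j, 1 - q * z * B * q ^ j <> 0.
Hypothesis HAB : forall j, 1 - q * (A * B) * (q ^ 2) ^ j <> 0.
Hypothesis HM : forall j, 1 - a ^ 2 * q ^ 2 / k * q ^ j <> 0.

(** The left-hand series is [sum beta_n delta_n], where [beta] belongs to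
    [quad_alpha]; [z = a/k], and [A], [B] stand for [k^2/(a b)] and [b]. *)
Definition delta (n : nat) : C :=
  (1 - k * (q ^ n) ^ 2) / (1 - k) * (qpoch A q n * qpoch B q n)
  * qpoch (a * q) (q ^ 2) n
  / (qpoch (q * z * A) q n * qpoch (q * z * B) q n
     * qpoch (q * (A * B)) (q ^ 2) n) * (- (q * z)) ^ n.

Definition lhs_term (n : nat) : C :=
  qpoch (k ^ 2 / (q * a ^ 2)) q n / qpoch q q n * delta n.

(** The normalized value, by [watson_sum], of the inner series with index [m]. *)
Definition rho_tail (m : nat) : C :=
  qpoch_inf (q ^ 2 * z ^ 2 * (A * q ^ m)) (q ^ 2)
  * qpoch_inf (q ^ 2 * z ^ 2 * (B * q ^ m)) (q ^ 2)
  * (qpoch_inf (A * q ^ m * q) (q ^ 2) * qpoch_inf (B * q ^ m * q) (q ^ 2)).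

(** The common general term of the two series on the right-hand side: even
    indices give the first, odd ones the second. *)
Definition rho (m : nat) : C :=
  quad_alpha q a k m * (qpoch A q m * qpoch B q m) * (- (q * z)) ^ m
  * rho_tail m.

Lemma k_neq_0 : k <> 0.
Proof. unfold k. repeat apply Cmult_neq_0; assumption. Qed.

Lemma a_neq_0 : a <> 0.
Proof.
  unfold a. repeat apply Cmult_neq_0; auto using C1_neq_0.
Qed.

Lemma H1k : 1 - k <> 0.
Proof. nz_from (HK 0%nat). Qed.

Lemma reg_ratio_ratio (x : C) (n : nat) :
  (forall i, (i < n)%nat -> 1 - x * q * q ^ i <> 0) ->
  reg_ratio q x n = qpoch (x * q) (q ^ 2) n / qpoch (x * q) q n.
Proof.
  intros H. destruct n as [|n]; [cbn [reg_ratio qpoch]; field|].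
  assert (H0 : 1 - x * q <> 0).
  { nz_from (H 0%nat ltac:(lia)). }
  cbn [reg_ratio]. rewrite !qpoch_S_l.
  replace (x * q * q ^ 2) with (x * q ^ 3) by ring.
  replace (x * q * q) with (x * q ^ 2) by ring.
  assert (Hn : qpoch (x * q ^ 2) q n <> 0).
  { apply qpoch_neq_0. intros j Hj.
    nz_from (H (S j) ltac:(lia)). }
  field. auto.
Qed.

(** The first term of the inner series with index [r]. *)
Definition row_factor (r : nat) : C :=
  qpoch k q (2 * r) / qpoch (a * q) q (2 * r) * delta r.

Lemma shifted_AB (j r : nat) :
  1 - q * (A * q ^ r * (B * q ^ r)) * (q ^ 2) ^ j <> 0.
Proof.
  replace (q * (A * q ^ r * (B * q ^ r)) * (q ^ 2) ^ j)
    with (q * (A * B) * (q ^ 2) ^ (r + j)); [apply HAB|].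
  rewrite Cpow_add_r, (qpow_double q r). ring.
Qed.

(** The kernel turns the weights [delta] into a Watson series with [A] and [B]
    multiplied by [q^r]. *)
Lemma kernel_delta (r j : nat) :
  (forall i, (i < 2 * r + j)%nat -> 1 - a * q * q ^ i <> 0) ->
  wp_kernel q a k (r + j) r * delta (r + j)
  = row_factor r * watson_term q z (A * q ^ r) (B * q ^ r) j.
Proof.
  intros Ha. unfold wp_kernel, row_factor, delta, watson_term.
  replace (r + j - r)%nat with j by lia.
  replace (r + j + r)%nat with (2 * r + j)%nat by lia.
  replace (z ^ 2 * (A * q ^ r) * (B * q ^ r)) with (a * (q ^ r) ^ 2)
    by (unfold a; ring).
  replace (z * (A * q ^ r) * (B * q ^ r)) with (k * (q ^ r) ^ 2)
    by (unfold k; ring).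
  replace (q * z * (A * q ^ r)) with (q * z * A * q ^ r) by ring.
  replace (q * z * (B * q ^ r)) with (q * z * B * q ^ r) by ring.
  replace (q * (A * q ^ r * (B * q ^ r))) with (q * (A * B) * (q ^ 2) ^ r)
    by (rewrite (qpow_double q r); ring).
  rewrite (qpow_sqr q r).
  rewrite reg_ratio_ratio.
  2:{ intros i Hi. nz_from (Ha (2 * r + i)%nat ltac:(lia)). }
  rewrite hpoch_eq by exact Hz.
  rewrite !qpoch_add, !Cpow_add_r.
  replace (k / a) with (/ z) by (unfold k, a; field; auto).
  replace (a * q ^ (2 * r) * q) with (a * q * q ^ (2 * r)) by ring.
  replace ((q ^ 2) ^ r) with (q ^ (2 * r)) by apply Cpow_mult_r.
  assert (N1 := qpoch_qq_neq_0 q j Hq).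
  assert (N2 : qpoch (a * q) q (2 * r) <> 0).
  { apply qpoch_neq_0. intros. apply Ha. lia. }
  assert (N3 : qpoch (a * q * q ^ (2 * r)) q j <> 0).
  { apply qpoch_neq_0. intros. rewrite <- Cmult_assoc, <- Cpow_add_r.
    apply Ha. lia. }
  assert (N4 : forall n, qpoch (q * z * A) q n <> 0)
    by (intros; apply qpoch_neq_0; auto).
  assert (N5 : forall n, qpoch (q * z * B) q n <> 0)
    by (intros; apply qpoch_neq_0; auto).
  assert (N6 : forall n, qpoch (q * (A * B)) (q ^ 2) n <> 0)
    by (intros; apply qpoch_neq_0; auto).
  assert (M4 : qpoch (q * z * A * q ^ r) q j <> 0).
  { intros E. apply (N4 (r + j)%nat). rewrite qpoch_add, E. ring. }
  assert (M5 : qpoch (q * z * B * q ^ r) q j <> 0).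
  { intros E. apply (N5 (r + j)%nat). rewrite qpoch_add, E. ring. }
  assert (M6 : qpoch (q * (A * B) * q ^ (2 * r)) (q ^ 2) j <> 0).
  { intros E. apply (N6 (r + j)%nat). rewrite qpoch_add, Cpow_mult_r in *.
    rewrite E. ring. }
  specialize (N4 r). specialize (N5 r). specialize (N6 r).
  assert (K1 := H1k).
  assert (K2 := HK (2 * r)).
  replace (q ^ r * q ^ j) with (q ^ (r + j)) by apply Cpow_add_r.
  replace ((q ^ (r + j)) ^ 2) with (q ^ (2 * r) * (q ^ j) ^ 2)
    by (rewrite Cpow_add_r, (Nat.mul_comm 2 r), Cpow_mult_r; ring).
  clear HA HB HAB HM HK Hzj Ha H1a.
  clearbody a k. qatoms. field. repeat split; auto.
Qed.

(** The normalization of the inner series depends on [r]; its quotient by the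
    one for [r = 0] cancels the denominators of [row_factor]. *)
Lemma norm_row_factor (r : nat) :
  (forall i, (i < 2 * r)%nat -> 1 - a * q * q ^ i <> 0) ->
  watson_norm q z A B * row_factor r
  = watson_norm q z (A * q ^ r) (B * q ^ r)
    * ((qpoch A q r * qpoch B q r) * (- (q * z)) ^ r).
Proof.
  intros Ha. unfold watson_norm, row_factor, delta.
  fold k a.
  replace (z ^ 2 * (A * q ^ r) * (B * q ^ r)) with (a * (q ^ r) ^ 2)
    by (unfold a; ring).
  replace (z * (A * q ^ r) * (B * q ^ r)) with (k * (q ^ r) ^ 2)
    by (unfold k; ring).
  rewrite (qpoch_inf_split q Hq (q * z * A) r), (qpoch_inf_split q Hq (q * z * B) r),
    (qpoch_inf_split (q ^ 2) Hq2 (q * (A * B)) r),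
    (qpoch_inf_split (q ^ 2) Hq2 (a * q ^ 2) r),
    (qpoch_inf_split q Hq (q * k) (2 * r)).
  replace (q * z * (A * q ^ r)) with (q * z * A * q ^ r) by ring.
  replace (q * z * (B * q ^ r)) with (q * z * B * q ^ r) by ring.
  replace (q * (A * q ^ r * (B * q ^ r))) with (q * (A * B) * (q ^ 2) ^ r)
    by (rewrite (qpow_double q r); ring).
  replace (a * (q ^ r) ^ 2 * q ^ 2) with (a * q ^ 2 * (q ^ 2) ^ r)
    by (rewrite (qpow_double q r); ring).
  replace (q * (k * (q ^ r) ^ 2)) with (q * k * q ^ (2 * r))
    by (rewrite (Nat.mul_comm 2 r), Cpow_mult_r; ring).
  assert (Ek : qpoch k q (2 * r) * (1 - k * (q ^ r) ^ 2)
               = (1 - k) * qpoch (q * k) q (2 * r)).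
  { rewrite (qpow_sqr q r).
    rewrite <- qpoch_S, qpoch_S_l. do 2 f_equal. ring. }
  assert (Ea : qpoch (a * q) q (2 * r)
               = qpoch (a * q) (q ^ 2) r * qpoch (a * q ^ 2) (q ^ 2) r).
  { rewrite qpoch_double. do 2 f_equal. ring. }
  assert (N2 : qpoch (a * q) q (2 * r) <> 0) by now apply qpoch_neq_0.
  rewrite Ea in *.
  assert (N1 : qpoch (a * q) (q ^ 2) r <> 0)
    by (intros E; apply N2; rewrite E; ring).
  assert (N3 : qpoch (a * q ^ 2) (q ^ 2) r <> 0)
    by (intros E; apply N2; rewrite E; ring).
  assert (N4 : qpoch (q * z * A) q r <> 0) by (apply qpoch_neq_0; auto).
  assert (N5 : qpoch (q * z * B) q r <> 0) by (apply qpoch_neq_0; auto).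
  assert (N6 : qpoch (q * (A * B)) (q ^ 2) r <> 0) by (apply qpoch_neq_0; auto).
  assert (Hqk : forall j, 1 - q * k * q ^ j <> 0).
  { intros j. nz_from (HK (S j)). }
  assert (N7 : qpoch (q * k) q (2 * r) <> 0) by (apply qpoch_neq_0; auto).
  assert (N8 : qpoch_inf (q * k * q ^ (2 * r)) q <> 0).
  { apply qpoch_inf_neq_0; [exact Hq|]. intros j.
    rewrite <- Cmult_assoc, <- Cpow_add_r. apply Hqk. }
  assert (K1 := H1k).
  transitivity (qpoch_inf (q * z * A * q ^ r) q * qpoch_inf (q * z * B * q ^ r) q
    * qpoch_inf q (q ^ 2) * qpoch_inf (q * (A * B) * (q ^ 2) ^ r) (q ^ 2)
    * qpoch_inf (a * q ^ 2 * (q ^ 2) ^ r) (q ^ 2) * qpoch_inf (- (q * z)) q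
    / (qpoch (q * k) q (2 * r) * qpoch_inf (q * k * q ^ (2 * r)) q)
    * (qpoch k q (2 * r) * (1 - k * (q ^ r) ^ 2)) / (1 - k)
    * (qpoch A q r * qpoch B q r * (- (q * z)) ^ r)).
  - field. repeat split; auto.
  - rewrite Ek. field. repeat split; auto.
Qed.

(** Insert the Bailey pair and sum over [n] first. *)
Lemma lhs_triangle (L : nat) :
  (forall i, (i < 2 * L - 2)%nat -> 1 - a * q * q ^ i <> 0) ->
  csum lhs_term L
  = csum (fun r => quad_alpha q a k r * row_factor r
       * csum (watson_term q z (A * q ^ r) (B * q ^ r)) (L - r)) L.
Proof.
  intros Ha.
  transitivity (csum (fun n => csum (fun r =>
      wp_kernel q a k n r * quad_alpha q a k r * delta n) (S n)) L).
  - apply csum_ext. intros n Hn. unfold lhs_term.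
    rewrite <- (quad_bailey_pair q Hq a k n Hq0 a_neq_0 k_neq_0 H1a).
    + rewrite Cmult_comm, <- csum_scal. apply csum_ext. intros; ring.
    + intros i Hi. apply Ha. lia.
    + exact HK.
    + exact HM.
  - rewrite csum_triangle. apply csum_ext. intros r Hr.
    rewrite <- csum_scal. apply csum_ext. intros j Hj.
    transitivity (quad_alpha q a k r * (wp_kernel q a k (r + j) r * delta (r + j)));
      [ring|].
    rewrite kernel_delta; [ring|]. intros i Hi. apply Ha. lia.
Qed.

(** ** Generic [a] *)

Section Generic.

Hypothesis Haq : forall j, 1 - a * q * q ^ j <> 0.

Lemma watson_regular_row (r : nat) :
  watson_regular q z (A * q ^ r) (B * q ^ r).
Proof.
  constructor; auto.
  - intros j. assert (E := HK (r + r + j)%nat). unfold k in E. nz_from E.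
  - intros j. nz_from (HA (r + j)%nat).
  - intros j. nz_from (HB (r + j)%nat).
  - intros j. apply shifted_AB.
  - intros j. assert (E := Haq (S (r + r + j))). unfold a in E. nz_from E.
Qed.

Lemma summable_param_row (r : nat) :
  summable_param q z A B -> qpoch A q r * qpoch B q r <> 0 ->
  summable_param q z (A * q ^ r) (B * q ^ r).
Proof.
  intros [H|[N H]] Hr; [now left|].
  right. exists N. intros n Hn.
  apply (Cmult_cancel_l (qpoch A q r * qpoch B q r)); [|exact Hr].
  specialize (H (r + n)%nat ltac:(lia)). rewrite !qpoch_add in H.
  rewrite Cmult_0_r, <- H. ring.
Qed.

Definition alpha_coef (r : nat) : C :=
  (1 - a * (q ^ r) ^ 2) / (1 - a)
  * (qpoch a q r * qpoch (k / (a * q)) q r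
     / (qpoch q q r * qpoch (a ^ 2 * q ^ 2 / k) q r))
  * (qpoch (q * a ^ 2 / k) q (2 * r) / qpoch k q (2 * r)).

Definition delta_coef (n : nat) : C :=
  (1 - k * (q ^ n) ^ 2) / (1 - k) * (qpoch A q n * qpoch B q n)
  * qpoch (a * q) (q ^ 2) n
  / (qpoch (q * z * A) q n * qpoch (q * z * B) q n
     * qpoch (q * (A * B)) (q ^ 2) n).

Lemma alpha_coef_bdd : bdd (fun r _ => alpha_coef r).
Proof.
  apply bdd_ext with (fun r _ =>
    / (1 - a) * qpoch (a * q ^ (2 * r)) q 1 * qpoch a q r
    * qpoch (k / (a * q)) q r * / qpoch q q r * / qpoch (a ^ 2 * q ^ 2 / k) q r
    * qpoch (q * a ^ 2 / k) q (2 * r) * / qpoch k q (2 * r)).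
  - intros r _. unfold alpha_coef. cbn [qpoch]. change (q ^ 0) with (RtoC 1).
    rewrite (qpow_sqr q r).
    assert (N1 := qpoch_qq_neq_0 q r Hq).
    assert (N2 : qpoch (a ^ 2 * q ^ 2 / k) q r <> 0) by (apply qpoch_neq_0; auto).
    assert (N3 : qpoch k q (2 * r) <> 0) by (apply qpoch_neq_0; auto).
    clear HA HB HAB HM HK Hzj. clearbody a k. qatoms.
    field. repeat split; auto.
  - split_bdd; try apply bdd_const.
    + apply (bdd_qpoch q a (fun r _ => (2 * r)%nat) (fun _ _ => 1%nat) Hq).
    + apply (bdd_qpoch0 q _ (fun r _ => r) Hq).
    + apply (bdd_qpoch0 q _ (fun r _ => r) Hq).
    + apply (bdd_inv_qpoch0 q _ (fun r _ => r) Hq).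
      intros. now apply one_minus_qpow_neq_0.
    + now apply (bdd_inv_qpoch0 q _ (fun r _ => r) Hq).
    + apply (bdd_qpoch0 q _ (fun r _ => (2 * r)%nat) Hq).
    + now apply (bdd_inv_qpoch0 q _ (fun r _ => (2 * r)%nat) Hq).
Qed.

Lemma delta_coef_bdd (g : nat -> nat -> nat) :
  bdd (fun m n => delta_coef (g m n)).
Proof.
  apply bdd_ext with (fun m n =>
    / (1 - k) * qpoch (k * q ^ (2 * g m n)) q 1 * qpoch A q (g m n)
    * qpoch B q (g m n) * qpoch (a * q) (q ^ 2) (g m n)
    * / qpoch (q * z * A) q (g m n) * / qpoch (q * z * B) q (g m n)
    * / qpoch (q * (A * B)) (q ^ 2) (g m n)).
  - intros m n. set (i := g m n). unfold delta_coef. cbn [qpoch].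
    change (q ^ 0) with (RtoC 1).
    rewrite (qpow_sqr q i).
    assert (N1 : qpoch (q * z * A) q i <> 0) by (apply qpoch_neq_0; auto).
    assert (N2 : qpoch (q * z * B) q i <> 0) by (apply qpoch_neq_0; auto).
    assert (N3 : qpoch (q * (A * B)) (q ^ 2) i <> 0) by (apply qpoch_neq_0; auto).
    assert (K1 := H1k).
    clear HA HB HAB HM HK Hzj. clearbody a k. qatoms.
    field. repeat split; auto.
  - split_bdd; try apply bdd_const.
    + apply (bdd_qpoch q k (fun m n => (2 * g m n)%nat) (fun _ _ => 1%nat) Hq).
    + now apply bdd_qpoch0.
    + now apply bdd_qpoch0.
    + now apply bdd_qpoch0.
    + now apply bdd_inv_qpoch0.
    + now apply bdd_inv_qpoch0.
    + now apply bdd_inv_qpoch0.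
Qed.

Lemma kernel_bdd : bdd (fun r j => wp_kernel q a k (r + j) r).
Proof.
  apply bdd_ext with (fun r j => qpoch (k / a) q j * qpoch k q (2 * r + j)
     * / qpoch q q j * / qpoch (a * q) q (2 * r + j)).
  - intros r j. unfold wp_kernel.
    replace (r + j - r)%nat with j by lia.
    replace (r + j + r)%nat with (2 * r + j)%nat by lia.
    assert (N1 := qpoch_qq_neq_0 q j Hq).
    assert (N2 : qpoch (a * q) q (2 * r + j) <> 0) by (apply qpoch_neq_0; auto).
    qatoms. field. auto.
  - split_bdd.
    + now apply (bdd_qpoch0 q _ (fun _ j => j)).
    + now apply (bdd_qpoch0 q _ (fun r j => (2 * r + j)%nat)).
    + apply (bdd_inv_qpoch0 q _ (fun _ j => j) Hq).
      intros. now apply one_minus_qpow_neq_0.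
    + now apply (bdd_inv_qpoch0 q _ (fun r j => (2 * r + j)%nat)).
Qed.

Definition row (L r : nat) : C :=
  quad_alpha q a k r * row_factor r
  * csum (watson_term q z (A * q ^ r) (B * q ^ r)) (L - r).

Lemma row_eq (L r : nat) :
  row L r = csum (fun j => quad_alpha q a k r
                           * (wp_kernel q a k (r + j) r * delta (r + j))) (L - r).
Proof.
  unfold row. rewrite <- csum_scal. apply csum_ext. intros j _.
  rewrite kernel_delta by auto. ring.
Qed.

Lemma csum_support_bounded (u : nat -> C) (N : nat) :
  (forall i, (N <= i)%nat -> u i = 0) ->
  exists K, forall n, (Cmod (csum u n) <= K)%R.
Proof.
  intros H.
  assert (HN : exists K, forall n, (n <= N)%nat -> (Cmod (csum u n) <= K)%R).
  { clear H. induction N as [|N [K IH]].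
    - exists 0%R. intros n Hn. replace n with 0%nat by lia. simpl.
      rewrite Cmod_0. lra.
    - exists (Rmax K (Cmod (csum u (S N)))). intros n Hn.
      destruct (Nat.eq_dec n (S N)) as [->|Hne]; [apply Rmax_r|].
      eapply Rle_trans; [apply IH; lia|apply Rmax_l]. }
  destruct HN as [K HN]. exists K. intros n.
  destruct (Nat.le_ge_cases n N) as [Hn|Hn]; [auto|].
  rewrite (csum_stable u N n Hn H). auto.
Qed.

(** The powers [(k/a)^r] and [(- q z)^(r+j)] combine to [(- q)^r (- q z)^j],
    which decays in both indices when [|q z| < 1]. *)
Lemma row_bound :
  summable_param q z A B ->
  exists M r, (0 <= M)%R /\ (0 < r < 1)%R /\
    forall L i, (Cmod (row L i) <= M * r ^ i)%R.
Proof.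
  intros [H|[N H]].
  - destruct (bdd_mult _ _ alpha_coef_bdd (bdd_mult _ _ kernel_bdd
      (delta_coef_bdd (fun r j => (r + j)%nat)))) as [K [HK0 Hb]].
    assert (Hqz : (0 < Cmod (q * z))%R)
      by (apply Cmod_gt_0; now apply Cmult_neq_0).
    assert (Hq1 : (0 < Cmod q)%R) by now apply Cmod_gt_0.
    exists (K / (1 - Cmod (q * z)))%R, (Cmod q). split; [|split; [lra|]].
    + apply Rmult_le_pos; [exact HK0|]. left. apply Rinv_0_lt_compat. lra.
    + intros L i. rewrite row_eq.
      set (u := fun j => quad_alpha q a k i
                         * (wp_kernel q a k (i + j) i * delta (i + j))).
      replace (csum u (L - i)) with (csum u (L - i) - csum u 0)
        by (simpl; ring).
      eapply Rle_trans.
      * apply (csum_Cmod_geom u (K * Cmod q ^ i) (Cmod (q * z)) 0 (L - i)).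
        -- apply Rmult_le_pos; [exact HK0|apply pow_le; lra].
        -- lra.
        -- intros j. unfold u.
           replace (quad_alpha q a k i
                    * (wp_kernel q a k (i + j) i * delta (i + j)))
             with (alpha_coef i * (wp_kernel q a k (i + j) i * delta_coef (i + j))
                   * ((- q) ^ i * (- (q * z)) ^ j)).
           ++ rewrite !(Cmod_mult _ (_ * _)), !(Cmod_mult (_ ^ _)), !Cmod_pow,
                !Cmod_opp.
              rewrite <- Rmult_assoc.
              apply Rmult_le_compat_r; [apply pow_le, Cmod_ge_0|].
              apply Rmult_le_compat_r; [apply pow_le, Cmod_ge_0|].
              rewrite <- Cmod_mult. apply Hb.
           ++ change (quad_alpha q a k i) with (alpha_coef i * (k / a) ^ i).
              change (delta (i + j))
                with (delta_coef (i + j) * (- (q * z)) ^ (i + j)).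
              rewrite Cpow_add_r.
              replace (- q) with (k / a * - (q * z))
                by (unfold k, a; field; auto).
              rewrite Cpow_mult_l. ring.
        -- lia.
      * right. simpl. field. lra.
  - destruct (finite_support_geom nat (fun L i => Cmod (row L i)) N (1 / 2))
      as [M [HM0 HH]].
    + lra.
    + intros i.
      destruct (csum_support_bounded (fun j => quad_alpha q a k i
                         * (wp_kernel q a k (i + j) i * delta (i + j))) N)
        as [K HK'].
      * intros j Hj. unfold delta. rewrite H by lia. unfold Cdiv. ring.
      * exists K. intros L. rewrite row_eq. apply HK'.
    + intros L i Hi. rewrite row_eq, csum_zero.
      * rewrite Cmod_0. lra.
      * intros j _. unfold delta. rewrite H by lia. unfold Cdiv. ring.
    + exists M, (1 / 2)%R. split; [exact HM0|]. split; [lra|]. exact HH.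
Qed.

Lemma row_factor_zero (r : nat) :
  qpoch A q r * qpoch B q r = 0 -> row_factor r = 0.
Proof. intros E. unfold row_factor, delta. rewrite E. unfold Cdiv. ring. Qed.

Lemma row_Clim (r : nat) :
  summable_param q z A B ->
  Clim (fun L => row L r)
    (quad_alpha q a k r * row_factor r
     * Cseries (watson_term q z (A * q ^ r) (B * q ^ r))).
Proof.
  intros Hs. unfold row.
  destruct (Ceq_dec (qpoch A q r * qpoch B q r) 0) as [E|E].
  - rewrite (row_factor_zero r E), Cmult_0_r, Cmult_0_l.
    apply Clim_ext with (fun _ => 0); [intros; ring|apply Clim_const].
  - apply Clim_scal. apply Clim_unshift with r.
    eapply Clim_ext; [|apply watson_Clim; auto using watson_regular_row,
                         summable_param_row].
    intros n. f_equal. lia.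
Qed.

Lemma rho_row (r : nat) :
  summable_param q z A B ->
  watson_norm q z A B
  * (quad_alpha q a k r * row_factor r
     * Cseries (watson_term q z (A * q ^ r) (B * q ^ r))) = rho r.
Proof.
  intros Hs. unfold rho.
  destruct (Ceq_dec (qpoch A q r * qpoch B q r) 0) as [E|E].
  - rewrite (row_factor_zero r E), E. ring.
  - assert (H := watson_sum q Hq0 Hq z (A * q ^ r) (B * q ^ r)
                   (watson_regular_row r) (summable_param_row r Hs E)).
    assert (H' := norm_row_factor r ltac:(auto)).
    fold (rho_tail r) in H. rewrite <- H.
    transitivity (quad_alpha q a k r * (watson_norm q z A B * row_factor r)
      * Cseries (watson_term q z (A * q ^ r) (B * q ^ r))); [ring|].
    rewrite H'. ring.
Qed.

Lemma rho_Clim_generic (t : C) :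
  summable_param q z A B -> Clim (csum lhs_term) t ->
  Clim (csum rho) (watson_norm q z A B * t).
Proof.
  intros Hs Ht.
  destruct (row_bound Hs) as [M [r [HM0 [Hr Hb]]]].
  set (g := fun r => quad_alpha q a k r * row_factor r
     * Cseries (watson_term q z (A * q ^ r) (B * q ^ r))).
  assert (Hg : Clim (csum g) t).
  { apply tannery_trunc with row M r; auto.
    - intros i. now apply row_Clim.
    - eapply Clim_ext; [|exact Ht]. intros L.
      apply (lhs_triangle L). auto. }
  apply Clim_ext with (fun n => watson_norm q z A B * csum g n).
  - intros n. rewrite <- csum_scal. apply csum_ext. intros i _. exact (rho_row i Hs).
  - now apply Clim_scal.
Qed.

(** If neither condition holds, the terms of the left-hand series do not tend
    to zero: no numerator factor vanishes, and the products without zero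
    factors are bounded below. *)
Lemma summable_from_convergence (t : C) :
  Clim (csum lhs_term) t -> summable_param q z A B.
Proof.
  intros Ht.
  destruct (Rlt_le_dec (Cmod (q * z)) 1) as [H|H]; [now left|]. right.
  destruct (classic (exists j, 1 - A * q ^ j = 0 \/ 1 - B * q ^ j = 0))
    as [[j Hj]|Hj].
  { exists (S j). intros n Hn. destruct Hj as [Hj|Hj].
    - rewrite (qpoch_eq_0 A q n j) by (auto; lia). ring.
    - rewrite (qpoch_eq_0 B q n j) by (auto; lia). ring. }
  exfalso.
  assert (HAj : forall j, 1 - A * q ^ j <> 0) by (intros j E; apply Hj; eauto).
  assert (HBj : forall j, 1 - B * q ^ j <> 0) by (intros j E; apply Hj; eauto).
  assert (Haj : forall j, 1 - a * q * (q ^ 2) ^ j <> 0).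
  { intros j. rewrite <- Cpow_mult_r. apply Haq. }
  assert (Ek : k ^ 2 / (q * a ^ 2) = / (q * z ^ 2)).
  { unfold k, a. field. auto. }
  assert (Hej : forall j, 1 - / (q * z ^ 2) * q ^ j <> 0).
  { intros j E.
    assert (E1 : q ^ S j = (q * z) ^ 2).
    { transitivity (q ^ 2 * z ^ 2 * (/ (q * z ^ 2) * q ^ j)).
      - rewrite Cpow_S. field. auto.
      - replace (/ (q * z ^ 2) * q ^ j)
          with (1 - (1 - / (q * z ^ 2) * q ^ j)) by ring.
        rewrite E. ring. }
    apply (f_equal Cmod) in E1. rewrite !Cmod_pow in E1.
    assert (H0 := Cmod_ge_0 q).
    assert (Hp : (Cmod q ^ S j < 1)%R) by (apply pow_lt_1_compat; [lra|lia]).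
    nra. }
  assert (Hkj : forall n, 1 - k * (q ^ n) ^ 2 <> 0).
  { intros n. rewrite <- Cpow_mult_r. apply HK. }
  assert (Hb : bdd (fun _ n => qpoch q q n * (1 - k)
     * qpoch (q * z * A) q n * qpoch (q * z * B) q n
     * qpoch (q * (A * B)) (q ^ 2) n * / qpoch (/ (q * z ^ 2)) q n
     * / qpoch (k * q ^ (n * 2)) q 1
     * / qpoch A q n * / qpoch B q n * / qpoch (a * q) (q ^ 2) n)).
  { split_bdd; try apply bdd_const.
    - now apply (bdd_qpoch0 q _ (fun _ n => n)).
    - now apply (bdd_qpoch0 q _ (fun _ n => n)).
    - now apply (bdd_qpoch0 q _ (fun _ n => n)).
    - now apply (bdd_qpoch0 (q ^ 2) _ (fun _ n => n)).
    - now apply (bdd_inv_qpoch0 q _ (fun _ n => n)).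
    - now apply (bdd_inv_qpoch q k (fun _ n => (n * 2)%nat) (fun _ _ => 1%nat)).
    - now apply (bdd_inv_qpoch0 q _ (fun _ n => n)).
    - now apply (bdd_inv_qpoch0 q _ (fun _ n => n)).
    - now apply (bdd_inv_qpoch0 (q ^ 2) _ (fun _ n => n)). }
  destruct Hb as [M [HM0 Hb]].
  assert (Hl : Clim lhs_term 0).
  { apply Clim_ext with (fun n => csum lhs_term (S n) - csum lhs_term n).
    - intros n. rewrite csum_S. ring.
    - replace (RtoC 0) with (t - t) by ring. apply Clim_minus; [|exact Ht].
      apply (Clim_subseq (csum lhs_term) S); [intros; lia|exact Ht]. }
  destruct (Hl (/ (M + 1))%R) as [N HN]; [apply Rinv_0_lt_compat; lra|].
  specialize (HN N (le_n _)). specialize (Hb 0%nat N).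
  cbn [qpoch] in Hb. change (q ^ 0) with (RtoC 1) in Hb.
  rewrite Cpow_mult_r, Cmult_1_l, Cmult_1_r in Hb.
  set (w := (qpoch q q N * (1 - k)
     * qpoch (q * z * A) q N * qpoch (q * z * B) q N
     * qpoch (q * (A * B)) (q ^ 2) N * / qpoch (/ (q * z ^ 2)) q N
     * / (1 - k * (q ^ N) ^ 2)
     * / qpoch A q N * / qpoch B q N * / qpoch (a * q) (q ^ 2) N)) in *.
  assert (Ew : (- (q * z)) ^ N = lhs_term N * w).
  { unfold w, lhs_term, delta. rewrite Ek.
    assert (N1 := qpoch_qq_neq_0 q N Hq).
    assert (N2 : qpoch A q N <> 0) by (apply qpoch_neq_0; auto).
    assert (N3 : qpoch B q N <> 0) by (apply qpoch_neq_0; auto).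
    assert (N4 : qpoch (a * q) (q ^ 2) N <> 0) by (apply qpoch_neq_0; auto).
    assert (N5 : qpoch (/ (q * z ^ 2)) q N <> 0) by (apply qpoch_neq_0; auto).
    assert (N6 : qpoch (q * z * A) q N <> 0) by (apply qpoch_neq_0; auto).
    assert (N7 : qpoch (q * z * B) q N <> 0) by (apply qpoch_neq_0; auto).
    assert (N8 : qpoch (q * (A * B)) (q ^ 2) N <> 0) by (apply qpoch_neq_0; auto).
    assert (K1 := H1k). specialize (Hkj N).
    clear - N1 N2 N3 N4 N5 N6 N7 N8 K1 Hkj.
    clearbody a k. qatoms. field. repeat split; auto. }
  apply (f_equal Cmod) in Ew. rewrite Cmod_mult, Cmod_pow, Cmod_opp in Ew.
  assert (H1 : (1 <= Cmod (q * z) ^ N)%R) by now apply pow_R1_Rle.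
  replace (lhs_term N - 0) with (lhs_term N) in HN by ring.
  assert (H2 := Cmod_ge_0 (lhs_term N)). assert (H3 := Cmod_ge_0 w).
  assert (H4 : (Cmod (lhs_term N) * Cmod w <= / (M + 1) * M)%R)
    by (apply Rmult_le_compat; lra).
  assert (H5 : (/ (M + 1) * M < 1)%R).
  { apply Rlt_le_trans with (/ (M + 1) * (M + 1))%R.
    - apply Rmult_lt_compat_l; [apply Rinv_0_lt_compat; lra|lra].
    - right. field. lra. }
  lra.
Qed.

End Generic.

(** ** The exceptional values [a = q^-(2M+1)] *)

Section Exceptional.

Variable M : nat.
Hypothesis HaM : a * q ^ (2 * M + 1) = 1.

(** Numerator and denominator of [quad_alpha (r+1) / quad_alpha r] as functions
    of [X = q^r]. *)
Definition alpha_num (X : C) : C :=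
  (1 - a * q ^ 2 * X ^ 2) * (1 - a * X) * (1 - k / (a * q) * X)
  * (1 - q * a ^ 2 / k * X ^ 2) * (1 - q ^ 2 * a ^ 2 / k * X ^ 2) * (k / a).

Definition alpha_den (X : C) : C :=
  (1 - a * X ^ 2) * (1 - q * X) * (1 - a ^ 2 * q ^ 2 / k * X)
  * (1 - k * X ^ 2) * (1 - q * k * X ^ 2).

Lemma quad_alpha_S (r : nat) :
  quad_alpha q a k (S r) * alpha_den (q ^ r)
  = quad_alpha q a k r * alpha_num (q ^ r).
Proof.
  unfold quad_alpha, alpha_num, alpha_den.
  replace (2 * S r)%nat with (S (S (2 * r))) by lia.
  rewrite !qpoch_S, !(Cpow_S q r), (Cpow_S q (2 * r)), (Cpow_S (k / a)).
  assert (N1 := qpoch_qq_neq_0 q r Hq).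
  assert (N2 := one_minus_qpow_neq_0 q r Hq).
  assert (N3 : qpoch (a ^ 2 * q ^ 2 / k) q r <> 0) by (apply qpoch_neq_0; auto).
  assert (N4 : 1 - a ^ 2 * q ^ 2 / k * q ^ r <> 0) by auto.
  assert (N5 : qpoch k q (2 * r) <> 0) by (apply qpoch_neq_0; auto).
  assert (N6 : 1 - k * q ^ (2 * r) <> 0) by auto.
  assert (N7 : 1 - k * q ^ S (2 * r) <> 0) by auto.
  rewrite (Cpow_S q (2 * r)) in N7.
  replace (q ^ (2 * r)) with ((q ^ r) ^ 2) in *
    by (rewrite (Nat.mul_comm 2 r), Cpow_mult_r; reflexivity).
  set (x3 := qpoch (a ^ 2 * q ^ 2 / k) q r) in *.
  set (x4 := qpoch (q * a ^ 2 / k) q (2 * r)).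
  set (x5 := qpoch (k / (a * q)) q r).
  set (x6 := qpoch k q (2 * r)) in *. set (x7 := qpoch q q r) in *.
  set (x8 := qpoch a q r). set (x9 := (k / a) ^ r). set (X := q ^ r) in *.
  clearbody x3 x4 x5 x6 x7 x8 x9 X.
  set (u := 1 - a ^ 2 * q ^ 2 / k * X) in *.
  replace (1 - a * (q * X) ^ 2) with (1 - a * q ^ 2 * X ^ 2) by ring.
  replace (1 - q * a ^ 2 / k * (q * X ^ 2)) with (1 - q ^ 2 * a ^ 2 / k * X ^ 2)
    by (unfold Cdiv; ring).
  set (v1 := 1 - q ^ 2 * a ^ 2 / k * X ^ 2).
  set (v2 := 1 - q * a ^ 2 / k * X ^ 2).
  set (v3 := 1 - k / (a * q) * X).
  clearbody u v1 v2 v3. assert (Ha := a_neq_0).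
  clear - Ha H1a N1 N2 N3 N4 N5 N6 N7.
  clearbody a k. field. repeat split; auto.
Qed.

Lemma alpha_ratio_inv (X X' : C) :
  X <> 0 -> X' <> 0 -> a * q * (X * X') = 1 ->
  alpha_num X * alpha_num X' = alpha_den X * alpha_den X'.
Proof.
  intros HX HX' E.
  assert (Ha : a = / (q * X * X')).
  { apply (Cmult_cancel_l (q * X * X')); [|auto using Cmult_neq_0].
    transitivity (a * q * (X * X')); [ring|]. rewrite E. field. auto. }
  assert (Hk := k_neq_0). unfold alpha_num, alpha_den.
  clear - Ha Hk HX HX' Hq0. clearbody a k. subst a.
  field. auto.
Qed.

Lemma alpha_ratio_center (X : C) :
  X <> 0 -> a * q * (X * X) = 1 -> alpha_num X = - alpha_den X.
Proof.
  intros HX E.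
  assert (Ha : a = / (q * X * X)).
  { apply (Cmult_cancel_l (q * X * X)); [|auto using Cmult_neq_0].
    transitivity (a * q * (X * X)); [ring|]. rewrite E. field. auto. }
  assert (Hk := k_neq_0). unfold alpha_num, alpha_den.
  clear - Ha Hk HX Hq0. clearbody a k. subst a.
  field. auto.
Qed.

Lemma alpha_den_neq_0 (n : nat) :
  1 - a * (q ^ n) ^ 2 <> 0 -> alpha_den (q ^ n) <> 0.
Proof.
  intros H. unfold alpha_den.
  assert (Hk2 : 1 - k * (q ^ n) ^ 2 <> 0).
  { rewrite <- Cpow_mult_r. apply HK. }
  assert (Hk3 : 1 - q * k * (q ^ n) ^ 2 <> 0).
  { rewrite <- Cpow_mult_r.
    nz_from (HK (S (n * 2)%nat)). }
  assert (Hn := one_minus_qpow_neq_0 q n Hq).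
  auto 10 using Cmult_neq_0.
Qed.

(** The ratio [alpha_(r+1) / alpha_r] is a rational function of [q^r] that is
    inverted by [q^r -> 1/(a q^(r+1))] and equals [-1] at the fixed point. *)
Lemma quad_alpha_antisym (d : nat) :
  (d <= M)%nat -> quad_alpha q a k (M + 1 + d) = - quad_alpha q a k (M - d).
Proof.
  assert (HaX : forall n n', (n + n' = 2 * M)%nat -> a * q * (q ^ n * q ^ n') = 1).
  { intros n n' Hn. rewrite <- Cpow_add_r, Hn, <- HaM, Nat.add_1_r, Cpow_S. ring. }
  induction d as [|d IH]; intros Hd.
  - assert (E := quad_alpha_S M).
    assert (Hc : a * q * (q ^ M * q ^ M) = 1) by (apply HaX; lia).
    rewrite (alpha_ratio_center (q ^ M)) in E by (auto using Cpow_nz).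
    rewrite Nat.sub_0_r. replace (M + 1 + 0)%nat with (S M) by lia.
    apply (Cmult_cancel_l (alpha_den (q ^ M))).
    + rewrite Cmult_comm, E. ring.
    + (* Here [a q^(2M+1) = 1], so that the factor is [1 - 1/q]. *)
      apply alpha_den_neq_0. rewrite <- Cpow_mult_r.
      apply (qpow_inverse_neq_1 q Hq a (2 * M + 1)); [exact HaM|lia].
  - set (n := (M + 1 + d)%nat). set (n' := (M - S d)%nat).
    specialize (IH ltac:(lia)). fold n in IH.
    replace (M - d)%nat with (S n') in IH by (unfold n'; lia).
    replace (M + 1 + S d)%nat with (S n) by (unfold n; lia).
    assert (E1 := quad_alpha_S n). assert (E2 := quad_alpha_S n').
    assert (E3 : alpha_num (q ^ n) * alpha_num (q ^ n')
                 = alpha_den (q ^ n) * alpha_den (q ^ n')).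
    { apply alpha_ratio_inv; auto using Cpow_nz. apply HaX.
      unfold n, n'. lia. }
    assert (D1 : alpha_den (q ^ n) <> 0).
    { apply alpha_den_neq_0. rewrite <- Cpow_mult_r.
      replace (n * 2)%nat with (2 * M + 1 + S (2 * d))%nat by (unfold n; lia).
      rewrite Cpow_add_r, Cmult_assoc, HaM, Cmult_1_l.
      apply (qpow_neq_1 q Hq). lia. }
    assert (D2 : alpha_den (q ^ n') <> 0).
    { apply alpha_den_neq_0. rewrite <- Cpow_mult_r.
      apply (qpow_inverse_neq_1 q Hq a (2 * M + 1)); [exact HaM|].
      unfold n'. lia. }
    apply (Cmult_cancel_l (alpha_den (q ^ n) * alpha_den (q ^ n')));
      [|now apply Cmult_neq_0].
    transitivity (quad_alpha q a k (S n) * alpha_den (q ^ n) * alpha_den (q ^ n'));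
      [ring|].
    rewrite E1, IH.
    transitivity (- (quad_alpha q a k (S n') * alpha_den (q ^ n'))
                  * alpha_num (q ^ n)); [ring|].
    rewrite E2.
    transitivity (- quad_alpha q a k n'
                  * (alpha_num (q ^ n) * alpha_num (q ^ n'))); [ring|].
    rewrite E3. ring.
Qed.

(** Reading the product backwards: [1 - x q^(2j)] is [- x q^(2j)] times a factor
    of [(u;q^2)_n]. *)
Lemma qpoch_reverse (x u : C) (n : nat) :
  x * u * (q ^ 2) ^ n = q ^ 2 ->
  qpoch x (q ^ 2) n * ((- u) ^ n * q ^ (n * (n - 1))) = qpoch u (q ^ 2) n.
Proof.
  revert x. induction n as [|n IH]; intros x E.
  - cbn [qpoch Nat.mul Cpow]. ring.
  - rewrite (Cpow_S (q ^ 2) n) in E.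
    assert (E1 : x * u * (q ^ 2) ^ n = 1).
    { apply (Cmult_cancel_l (q ^ 2)); [|exact Hq20].
      transitivity (x * u * (q ^ 2 * (q ^ 2) ^ n)); [ring|]. rewrite E. ring. }
    rewrite qpoch_S_l, (qpoch_S u), <- (IH (x * q ^ 2)).
    2:{ transitivity (x * u * (q ^ 2 * (q ^ 2) ^ n)); [ring|exact E]. }
    replace (S n * (S n - 1))%nat with (n * (n - 1) + 2 * n)%nat by nia.
    rewrite Cpow_add_r, (Cpow_mult_r q 2 n), (Cpow_S (- u)).
    transitivity (qpoch (x * q ^ 2) (q ^ 2) n * (- u) ^ n * q ^ (n * (n - 1))
      * (x * u * (q ^ 2) ^ n - u * (q ^ 2) ^ n)); [ring|].
    rewrite E1. ring.
Qed.

Lemma qpoch_odd_tail (x : C) (L : nat) :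
  qpoch x q (2 * L + 1) * qpoch_inf (x * q ^ (2 * L + 1) * q) (q ^ 2)
  = qpoch (x * q) (q ^ 2) L * qpoch_inf x (q ^ 2).
Proof.
  rewrite Nat.add_1_r, qpoch_S, qpoch_double.
  rewrite (qpoch_inf_split (q ^ 2) Hq2 x (S L)), qpoch_S.
  replace (x * q ^ S (2 * L) * q) with (x * (q ^ 2) ^ S L).
  - rewrite Cpow_mult_r. ring.
  - rewrite (Cpow_S (q ^ 2)), (Cpow_S q (2 * L)), Cpow_mult_r. ring.
Qed.

Lemma reverse_scalar (x y : C) (L : nat) :
  z ^ 2 * x * y * q ^ (2 * L + 1) = 1 ->
  - (- (q * z)) ^ (2 * L + 1)
    * ((- (y * q)) ^ L * q ^ (L * (L - 1)) * ((- (x * q)) ^ L * q ^ (L * (L - 1))))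
  = z * q ^ (L + 1).
Proof.
  intros E.
  transitivity (q * z * (z ^ 2 * x * y * q ^ (2 * L + 1)) ^ L * q ^ L).
  - rewrite Nat.add_1_r, Cpow_S, Cpow_mult_r.
    replace ((- (q * z)) ^ 2) with (q ^ 2 * z ^ 2) by ring.
    replace (- (y * q)) with (- (1) * (y * q)) by ring.
    replace (- (x * q)) with (- (1) * (x * q)) by ring.
    rewrite !Cpow_mult_l, <- !Cpow_mult_r.
    replace (S (2 * L) * L)%nat with (L * (L - 1) + L * (L - 1) + L + L + L)%nat
      by (destruct L; nia).
    rewrite !Cpow_add_r.
    replace (q ^ (2 * L)) with (q ^ L * q ^ L)
      by (rewrite <- Cpow_add_r; f_equal; lia).
    assert (H1 : (- (1)) ^ L * (- (1)) ^ L = 1).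
    { rewrite <- Cpow_mult_l. replace (- (1) * - (1)) with (RtoC 1) by ring.
      apply Cpow_1_l. }
    transitivity (q * z * (q ^ L * q ^ L * z ^ (2 * L) * (q ^ L * q ^ L)
      * (x ^ L * y ^ L) * (q ^ (L * (L - 1)) * q ^ (L * (L - 1)))
      * ((- (1)) ^ L * (- (1)) ^ L))); [ring|].
    rewrite H1. ring.
  - rewrite E, Cpow_1_l, Cpow_add_r, Cpow_1_r. ring.
Qed.

(** Reflection changes the sign of [quad_alpha] and reverses the finite
    products, so that the term with index [2M+1-r] is the second part of the
    truncated Watson sum with index [r]. *)
Lemma rho_reflect (r : nat) :
  (r <= M)%nat ->
  rho (2 * M + 1 - r)
  = quad_alpha q a k r * (qpoch A q r * qpoch B q r) * (- (q * z)) ^ r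
    * (z * q ^ (M - r + 1)
       * (qpoch (q ^ 2 * z ^ 2 * (A * q ^ r)) (q ^ 2) (M - r)
          * qpoch (q ^ 2 * z ^ 2 * (B * q ^ r)) (q ^ 2) (M - r))
       * (qpoch_inf (A * q ^ r) (q ^ 2) * qpoch_inf (B * q ^ r) (q ^ 2)
          * (qpoch_inf (q ^ 2 / (A * q ^ r)) (q ^ 2)
             * qpoch_inf (q ^ 2 / (B * q ^ r)) (q ^ 2)))).
Proof.
  intros Hr. set (L := (M - r)%nat).
  assert (Hqr : q ^ r <> 0) by now apply Cpow_nz.
  set (x := A * q ^ r). set (y := B * q ^ r).
  assert (Hx : x <> 0) by now apply Cmult_neq_0.
  assert (Hy : y <> 0) by now apply Cmult_neq_0.
  assert (E : z ^ 2 * x * y * q ^ (2 * L + 1) = 1).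
  { rewrite <- HaM. replace (2 * M + 1)%nat with (r + r + (2 * L + 1))%nat
      by (unfold L; lia).
    rewrite !(Cpow_add_r q _ (2 * L + 1)), (Cpow_add_r q r r).
    unfold x, y, a. ring. }
  assert (HS := reverse_scalar x y L E).
  assert (E2 : (q ^ 2) ^ L * q = q ^ (2 * L + 1)).
  { rewrite Nat.add_1_r, (Cpow_S q (2 * L)), Cpow_mult_r. ring. }
  assert (Rx := qpoch_reverse (q ^ 2 * z ^ 2 * y) (x * q) L).
  assert (Ry := qpoch_reverse (q ^ 2 * z ^ 2 * x) (y * q) L).
  specialize (Rx ltac:(transitivity (q ^ 2 * (z ^ 2 * x * y * ((q ^ 2) ^ L * q)));
                       [ring|rewrite E2, E; ring])).
  specialize (Ry ltac:(transitivity (q ^ 2 * (z ^ 2 * x * y * ((q ^ 2) ^ L * q)));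
                       [ring|rewrite E2, E; ring])).
  unfold rho, rho_tail.
  replace (2 * M + 1 - r)%nat with (M + 1 + L)%nat at 1 by (unfold L; lia).
  rewrite quad_alpha_antisym by (unfold L; lia).
  replace (M - L)%nat with r by (unfold L; lia).
  replace (2 * M + 1 - r)%nat with (r + (2 * L + 1))%nat by (unfold L; lia).
  rewrite (qpoch_add A q r), (qpoch_add B q r), (Cpow_add_r (- (q * z)) r),
    (Cpow_add_r q r).
  rewrite !(Cmult_assoc A), !(Cmult_assoc B). fold x y.
  replace (q ^ 2 * z ^ 2 * (x * q ^ (2 * L + 1))) with (q ^ 2 / y).
  2:{ apply (Cmult_cancel_l y); [|exact Hy].
      transitivity (q ^ 2 * (z ^ 2 * x * y * q ^ (2 * L + 1))); [|ring].
      rewrite E. field. exact Hy. }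
  replace (q ^ 2 * z ^ 2 * (y * q ^ (2 * L + 1))) with (q ^ 2 / x).
  2:{ apply (Cmult_cancel_l x); [|exact Hx].
      transitivity (q ^ 2 * (z ^ 2 * x * y * q ^ (2 * L + 1))); [|ring].
      rewrite E. field. exact Hx. }
  assert (Ox := qpoch_odd_tail x L). assert (Oy := qpoch_odd_tail y L).
  transitivity (- quad_alpha q a k r * (qpoch A q r * qpoch B q r)
    * ((- (q * z)) ^ r * (- (q * z)) ^ (2 * L + 1))
    * (qpoch_inf (q ^ 2 / y) (q ^ 2) * qpoch_inf (q ^ 2 / x) (q ^ 2))
    * ((qpoch x q (2 * L + 1) * qpoch_inf (x * q ^ (2 * L + 1) * q) (q ^ 2))
       * (qpoch y q (2 * L + 1) * qpoch_inf (y * q ^ (2 * L + 1) * q) (q ^ 2))));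
    [ring|].
  rewrite Ox, Oy, <- Rx, <- Ry, <- HS. ring.
Qed.

Lemma lhs_term_vanish (n : nat) : (S M <= n)%nat -> lhs_term n = 0.
Proof.
  intros Hn. unfold lhs_term, delta.
  rewrite (qpoch_eq_0 (a * q) (q ^ 2) n M); [unfold Cdiv; ring|lia|].
  rewrite <- Cpow_mult_r, <- HaM, Nat.add_1_r, Cpow_S. ring.
Qed.

Lemma rho_vanish (n : nat) : (2 * M + 2 <= n)%nat -> rho n = 0.
Proof.
  intros Hn. unfold rho, quad_alpha.
  rewrite (qpoch_eq_0 a q n (2 * M + 1)); [unfold Cdiv; ring|lia|].
  rewrite HaM. ring.
Qed.

(** Here both sides are finite; the terms [r] and [2M+1-r] on the right
    combine to one truncated Watson sum. *)
Lemma rho_Clim_exceptional (t : C) :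
  Clim (csum lhs_term) t -> Clim (csum rho) (watson_norm q z A B * t).
Proof.
  intros Ht.
  replace t with (csum lhs_term (S M)).
  2:{ apply (Clim_unique (csum lhs_term)); [|exact Ht].
      apply Clim_ext_from with (fun _ => csum lhs_term (S M)) (S M);
        [|apply Clim_const].
      intros n Hn. symmetry. apply csum_stable; [exact Hn|].
      apply lhs_term_vanish. }
  apply Clim_ext_from with (fun _ => csum rho (2 * M + 2)) (2 * M + 2)%nat.
  { intros n Hn. symmetry. apply csum_stable; [exact Hn|]. apply rho_vanish. }
  replace (watson_norm q z A B * csum lhs_term (S M)) with (csum rho (2 * M + 2));
    [apply Clim_const|].
  rewrite lhs_triangle.
  2:{ intros i Hi. rewrite <- Cmult_assoc, <- Cpow_S.
      apply (qpow_inverse_neq_1 q Hq a (2 * M + 1)); [exact HaM|lia]. }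
  rewrite csum_fold, <- csum_scal. apply csum_ext. intros r Hr.
  replace (S M - r)%nat with (S (M - r)) by lia.
  transitivity (quad_alpha q a k r * (watson_norm q z A B * row_factor r)
    * csum (watson_term q z (A * q ^ r) (B * q ^ r)) (S (M - r))); [|ring].
  rewrite norm_row_factor.
  2:{ intros i Hi. rewrite <- Cmult_assoc, <- Cpow_S.
      apply (qpow_inverse_neq_1 q Hq a (2 * M + 1)); [exact HaM|lia]. }
  transitivity (quad_alpha q a k r
    * (qpoch A q r * qpoch B q r * (- (q * z)) ^ r)
    * (watson_norm q z (A * q ^ r) (B * q ^ r)
       * csum (watson_term q z (A * q ^ r) (B * q ^ r)) (S (M - r)))); [|ring].
  rewrite (watson_truncated q Hq0 Hq z (A * q ^ r) (B * q ^ r) (M - r)).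
  - rewrite rho_reflect by lia. unfold rho, rho_tail. ring.
  - exact Hz.
  - apply Cmult_neq_0; [exact HA0|now apply Cpow_nz].
  - apply Cmult_neq_0; [exact HB0|now apply Cpow_nz].
  - intros j. assert (E := HK (r + r + j)%nat). unfold k in E. nz_from E.
  - exact Hzj.
  - intros j. nz_from (HA (r + j)%nat).
  - intros j. nz_from (HB (r + j)%nat).
  - intros j. apply shifted_AB.
  - rewrite <- HaM. replace (2 * M + 1)%nat with (r + r + (2 * (M - r) + 1))%nat
      by lia.
    rewrite !(Cpow_add_r q _ (2 * (M - r) + 1)), (Cpow_add_r q r r).
    unfold a. ring.
Qed.

End Exceptional.

(** The factors [1 - a q^(2j)] being nonzero, [a q^(j+1) = 1] is possible for
    even [j] only. *)
Lemma rho_Clim (t : C) :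
  (forall j, 1 - a * (q ^ 2) ^ j <> 0) ->
  Clim (csum lhs_term) t -> Clim (csum rho) (watson_norm q z A B * t).
Proof.
  intros Ha Ht.
  destruct (classic (exists M, a * q ^ (2 * M + 1) = 1)) as [[M HaM]|H].
  - now apply (rho_Clim_exceptional M).
  - assert (Haq : forall j, 1 - a * q * q ^ j <> 0).
    { intros j E.
      destruct (Nat.Even_or_Odd j) as [[i ->]|[i ->]].
      - apply H. exists i. rewrite Nat.add_1_r, Cpow_S.
        transitivity (1 - (1 - a * q * q ^ (2 * i))); [ring|]. rewrite E. ring.
      - apply (Ha (S i)). rewrite <- E, <- Cpow_mult_r.
        replace (2 * S i)%nat with (S (2 * i + 1)) by lia.
        rewrite Cpow_S. ring. }
    apply rho_Clim_generic; auto.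
    now apply (summable_from_convergence Haq t).
Qed.

End Bridge.

(** * Basic hypergeometric notation *)

(** A pair of parameters [x, -x] in base [p] is one parameter [x^2] in base
    [p^2]; this removes all square roots. *)
Lemma qpoch_pair (x y w p : C) (n : nat) :
  y = - x -> x ^ 2 = w -> qpoch x p n * qpoch y p n = qpoch w (p ^ 2) n.
Proof. intros -> <-. apply qpoch_pm. Qed.

Lemma qpoch_very_well_poised (x p : C) (n : nat) :
  qpoch (x * p) p n * (1 - x) = qpoch x p n * (1 - x * p ^ n).
Proof. rewrite <- qpoch_S, qpoch_S_l. ring. Qed.

Lemma Cdiv_neq_0 (x y : C) : x <> 0 -> y <> 0 -> x / y <> 0.
Proof.
  intros Hx Hy E. apply Hx. replace x with (x / y * y) by (field; exact Hy).
  rewrite E. ring.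
Qed.

Lemma Cinv_mult (x y : C) : / (x * y) = / x * / y.
Proof.
  assert (E0 : / RtoC 0 = 0)
    by (apply injective_projections; simpl; unfold Rdiv; ring).
  destruct (Ceq_dec x 0) as [->|Hx]; [rewrite Cmult_0_l, E0; ring|].
  destruct (Ceq_dec y 0) as [->|Hy]; [rewrite Cmult_0_r, E0; ring|].
  field. auto.
Qed.

Section Translation.

Variable rt : C -> C.
Hypothesis rt_sqr : forall x : C, rt x ^ 2 = x.

Lemma rt_neq_0 (x : C) : x <> 0 -> rt x <> 0.
Proof.
  intros Hx E. apply Hx. rewrite <- (rt_sqr x), E. ring.
Qed.

Variables q a b k : C.
Hypothesis Hq0 : q <> 0.
Hypothesis Hq : (Cmod q < 1)%R.
Hypothesis Ha0 : a <> 0.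
Hypothesis Hb0 : b <> 0.
Hypothesis Hk0 : k <> 0.

Let Hq2 : (Cmod (q ^ 2) < 1)%R := Cmod_sqr_lt_1 q Hq.

Definition phi_num : list C :=
  [q * rt k; - (q * rt k); k ^ 2 / (a * b); b;
   rt (q * a); - rt (q * a); k ^ 2 / (q * a ^ 2)].

Definition phi_den : list C :=
  [rt k; - rt k; q * a * b / k; q * k / b;
   k * rt (q / a); - (k * rt (q / a))].

Definition W_even_params : list C :=
  [k ^ 2 / (a * b); b; a * q; k / (a * q); k / a;
   a * rt (q / k); - (a * rt (q / k));
   a * q / rt k; - (a * q / rt k);
   a * rt (q ^ 3 / k); - (a * rt (q ^ 3 / k));
   a * q ^ 2 / rt k; - (a * q ^ 2 / rt k)].

Definition W_odd_params : list C :=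
  [k ^ 2 * q / (a * b); b * q; a * q; k * q / a; k / a;
   a * rt (q ^ 3 / k); - (a * rt (q ^ 3 / k));
   a * q ^ 2 / rt k; - (a * q ^ 2 / rt k);
   a * rt (q ^ 5 / k); - (a * rt (q ^ 5 / k));
   a * q ^ 3 / rt k; - (a * q ^ 3 / rt k)].

Hypothesis H1a : 1 - a <> 0.
Hypothesis Haj : forall j, 1 - a * (q ^ 2) ^ j <> 0.
Hypothesis HK : forall j, 1 - k * q ^ j <> 0.
Hypothesis HA : forall j, 1 - q * a * b / k * q ^ j <> 0.
Hypothesis HB : forall j, 1 - q * k / b * q ^ j <> 0.
Hypothesis HAB : forall j, 1 - k ^ 2 * q / a * (q ^ 2) ^ j <> 0.
Hypothesis HM : forall j, 1 - a ^ 2 * q ^ 2 / k * q ^ j <> 0.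

Lemma k_param : a / k * (k ^ 2 / (a * b)) * b = k.
Proof. field. auto. Qed.

Lemma a_param : (a / k) ^ 2 * (k ^ 2 / (a * b)) * b = a.
Proof. field. auto. Qed.

Lemma H1k' : 1 - k <> 0.
Proof. nz_from (HK 0%nat). Qed.

Lemma phi_term_lhs (n : nat) :
  phi_term phi_num phi_den q (- (q * a / k)) n
  = lhs_term q (a / k) (k ^ 2 / (a * b)) b n.
Proof.
  unfold phi_term, lhs_term, delta, qpochs, Cprod, phi_num, phi_den.
  cbn [map fold_right]. rewrite k_param, a_param.
  replace (q * (a / k) * (k ^ 2 / (a * b))) with (q * k / b) by (field; auto).
  replace (q * (a / k) * b) with (q * a * b / k) by (field; auto).
  replace (q * (k ^ 2 / (a * b) * b)) with (k ^ 2 * q / a) by (field; auto).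
  replace (- (q * (a / k))) with (- (q * a / k)) by (field; auto).
  assert (P1 := qpoch_pair (q * rt k) (- (q * rt k)) (k * q ^ 2) q n eq_refl
                  ltac:(rewrite Cpow_mult_l, rt_sqr; ring)).
  assert (P2 := qpoch_pair (rt k) (- rt k) k q n eq_refl (rt_sqr k)).
  assert (P3 := qpoch_pair (rt (q * a)) (- rt (q * a)) (a * q) q n eq_refl
                  ltac:(rewrite rt_sqr; ring)).
  assert (P4 := qpoch_pair (k * rt (q / a)) (- (k * rt (q / a))) (k ^ 2 * q / a)
                  q n eq_refl
                  ltac:(rewrite Cpow_mult_l, rt_sqr; unfold Cdiv; ring)).
  match goal with |- ?num / ?den * _ = _ =>
    replace num with (qpoch (k * q ^ 2) (q ^ 2) n * qpoch (a * q) (q ^ 2) n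
      * (qpoch (k ^ 2 / (a * b)) q n * qpoch b q n
         * qpoch (k ^ 2 / (q * a ^ 2)) q n))
      by (rewrite <- P1, <- P3; ring);
    replace den with (qpoch k (q ^ 2) n * qpoch (k ^ 2 * q / a) (q ^ 2) n
      * (qpoch q q n * qpoch (q * a * b / k) q n * qpoch (q * k / b) q n))
      by (rewrite <- P2, <- P4; ring)
  end.
  clear P1 P2 P3 P4.
  assert (V := qpoch_very_well_poised k (q ^ 2) n).
  rewrite qpow_double in V.
  replace (qpoch (k * q ^ 2) (q ^ 2) n)
    with (qpoch k (q ^ 2) n * (1 - k * (q ^ n) ^ 2) / (1 - k)).
  2:{ rewrite <- V. field. apply H1k'. }
  assert (N1 : qpoch k (q ^ 2) n <> 0).
  { apply qpoch_neq_0. intros j _. rewrite <- Cpow_mult_r. apply HK. }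
  assert (N2 : qpoch (k ^ 2 * q / a) (q ^ 2) n <> 0) by (apply qpoch_neq_0; auto).
  assert (N3 : qpoch (q * a * b / k) q n <> 0) by (apply qpoch_neq_0; auto).
  assert (N4 : qpoch (q * k / b) q n <> 0) by (apply qpoch_neq_0; auto).
  assert (N5 := qpoch_qq_neq_0 q n Hq). assert (K1 := H1k').
  clear HA HB HAB HM HK Haj V. qatoms. field. repeat split; auto.
Qed.

Lemma qpoch_quadruple (x : C) (s : nat) :
  qpoch x q (2 * (2 * s))
  = qpoch x ((q ^ 2) ^ 2) s * qpoch (x * q) ((q ^ 2) ^ 2) s
    * qpoch (x * q ^ 2) ((q ^ 2) ^ 2) s * qpoch (x * q ^ 3) ((q ^ 2) ^ 2) s.
Proof.
  rewrite qpoch_double, (qpoch_double x), (qpoch_double (x * q)).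
  replace (x * q * q ^ 2) with (x * q ^ 3) by ring. ring.
Qed.

(** The last eight parameters form one product [(m;q)_(4s)]; the denominators
    belonging to them do the same. *)
Lemma W_term_quadruple (a1 m x1 x2 x3 x4 c1 c2 c3 c4 c5 : C) (s : nat) :
  a1 <> 0 -> x1 <> 0 -> x2 <> 0 -> x3 <> 0 -> x4 <> 0 ->
  x1 ^ 2 = m -> x2 ^ 2 = m * q -> x3 ^ 2 = m * q ^ 2 -> x4 ^ 2 = m * q ^ 3 ->
  (forall j, 1 - a1 * (q ^ 2) ^ j <> 0) ->
  W_term rt a1 [c1; c2; c3; c4; c5; x1; - x1; x2; - x2; x3; - x3; x4; - x4]
    (q ^ 2) (q ^ 2) s
  = (1 - a1 * (q ^ (2 * s)) ^ 2) / (1 - a1)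
    * (qpoch m q (2 * (2 * s)) / qpoch (a1 ^ 2 * q / m) q (2 * (2 * s)))
    * (qpochs [a1; c1; c2; c3; c4; c5] (q ^ 2) s
       / qpochs [q ^ 2; a1 * q ^ 2 / c1; a1 * q ^ 2 / c2; a1 * q ^ 2 / c3;
                 a1 * q ^ 2 / c4; a1 * q ^ 2 / c5] (q ^ 2) s)
    * (q ^ 2) ^ s.
Proof.
  intros Ha1 H1 H2 H3 H4 E1 E2 E3 E4 Haj1.
  assert (Hm : m <> 0) by (rewrite <- E1; now apply Cpow_nz).
  set (Q := (q ^ 2) ^ 2).
  assert (P : forall x w : C, x ^ 2 = w ->
    qpoch x (q ^ 2) s * qpoch (- x) (q ^ 2) s = qpoch w Q s)
    by (intros x w <-; apply qpoch_pm).
  assert (R : forall x w w' : C, x <> 0 -> x ^ 2 = w -> a1 ^ 2 * q ^ 4 = w * w' ->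
    w <> 0 -> qpoch (a1 * q ^ 2 / x) (q ^ 2) s
              * qpoch (a1 * q ^ 2 / (- x)) (q ^ 2) s = qpoch w' Q s).
  { intros x w w' Hx E Ew Hw.
    assert (Hx' : - x <> 0).
    { intros E'. apply Hx. replace x with (- - x) by ring. rewrite E'. ring. }
    replace (a1 * q ^ 2 / - x) with (- (a1 * q ^ 2 / x)) by (field; auto).
    apply P. transitivity (a1 ^ 2 * q ^ 4 / x ^ 2); [field; auto|].
    rewrite Ew, E. field. exact Hw. }
  assert (Hq3 : q ^ 3 <> 0) by now apply Cpow_nz.
  set (K := a1 ^ 2 * q / m).
  assert (P0 := P (q ^ 2 * rt a1) (a1 * Q)
                  ltac:(rewrite Cpow_mult_l, rt_sqr; unfold Q; ring)).
  assert (P5 := P (rt a1) a1 (rt_sqr a1)).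
  assert (P1 := P x1 _ E1). assert (P2 := P x2 _ E2).
  assert (P3 := P x3 _ E3). assert (P4 := P x4 _ E4).
  assert (R1 := R x1 m (K * q ^ 3) H1 E1 ltac:(unfold K; field; auto) Hm).
  assert (R2 := R x2 (m * q) (K * q ^ 2) H2 E2 ltac:(unfold K; field; auto)
                  ltac:(now apply Cmult_neq_0)).
  assert (R3 := R x3 (m * q ^ 2) (K * q) H3 E3 ltac:(unfold K; field; auto)
                  ltac:(auto using Cmult_neq_0, Cpow_nz)).
  assert (R4 := R x4 (m * q ^ 3) K H4 E4 ltac:(unfold K; field; auto)
                  ltac:(auto using Cmult_neq_0, Cpow_nz)).
  clear P R E1 E2 E3 E4.
  unfold W_term, phi_term, vwp_num, vwp_den, qpochs, Cprod.
  cbn [map fold_right].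
  rewrite !qpoch_quadruple. fold Q.
  assert (N : qpoch a1 Q s <> 0).
  { apply qpoch_neq_0. intros j _. unfold Q. rewrite <- Cpow_mult_r. apply Haj1. }
  assert (N1 : 1 - a1 <> 0).
  { nz_from (Haj1 0%nat). }
  assert (V := qpoch_very_well_poised a1 Q s).
  replace (Q ^ s) with ((q ^ (2 * s)) ^ 2) in V
    by (unfold Q; rewrite <- !Cpow_mult_r; f_equal; lia).
  replace ((1 - a1 * (q ^ (2 * s)) ^ 2) / (1 - a1))
    with (qpoch (a1 * Q) Q s / qpoch a1 Q s).
  2:{ apply (Cmult_cancel_l (qpoch a1 Q s * (1 - a1)));
        [|now apply Cmult_neq_0].
      transitivity (qpoch (a1 * Q) Q s * (1 - a1)); [field; exact N|].
      rewrite V. field. exact N1. }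
  rewrite <- P0, <- P5, <- P1, <- P2, <- P3, <- P4, <- R1, <- R2, <- R3, <- R4.
  unfold Cdiv. rewrite !Cinv_mult. ring.
Qed.

Lemma qpoch_tail_even (x : C) (s : nat) :
  qpoch x q (2 * s) * qpoch_inf (x * q ^ (2 * s) * q) (q ^ 2)
  = qpoch x (q ^ 2) s * qpoch_inf (x * q) (q ^ 2).
Proof.
  rewrite qpoch_double, (qpoch_inf_split (q ^ 2) Hq2 (x * q) s), Cpow_mult_r.
  replace (x * (q ^ 2) ^ s * q) with (x * q * (q ^ 2) ^ s) by ring. ring.
Qed.

(** In base [q^2] the factors of even index of [(x;q)_(2s)] and of odd index
    separate; the numerical factor and the powers match because
    [k/a * (- q z) = - q]. *)
Lemma rho_even (s : nat) :
  (forall j, 1 - a ^ 2 * b * q ^ 2 / k ^ 2 * (q ^ 2) ^ j <> 0) ->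
  (forall j, 1 - q ^ 2 * a / b * (q ^ 2) ^ j <> 0) ->
  rho q (a / k) (k ^ 2 / (a * b)) b (2 * s)
  = qpochs_inf [k ^ 2 * q / (a * b); b * q; a ^ 2 * b * q ^ 2 / k ^ 2;
                q ^ 2 * a / b] (q ^ 2)
    * W_term rt a W_even_params (q ^ 2) (q ^ 2) s.
Proof.
  intros Hu Hv.
  set (u := a ^ 2 * b * q ^ 2 / k ^ 2) in *. set (v := q ^ 2 * a / b) in *.
  unfold rho, rho_tail. rewrite k_param, a_param.
  set (A := k ^ 2 / (a * b)).
  replace (q ^ 2 * (a / k) ^ 2 * (A * q ^ (2 * s))) with (v * (q ^ 2) ^ s)
    by (rewrite Cpow_mult_r; unfold A, v; qatoms; field; auto).
  replace (q ^ 2 * (a / k) ^ 2 * (b * q ^ (2 * s))) with (u * (q ^ 2) ^ s)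
    by (rewrite Cpow_mult_r; unfold u; qatoms; field; auto).
  assert (TA := qpoch_tail_even A s). assert (TB := qpoch_tail_even b s).
  assert (Hq3 : q ^ 3 <> 0) by now apply Cpow_nz.
  assert (Hc0 : rt k <> 0) by now apply rt_neq_0.
  unfold W_even_params. fold A.
  rewrite (W_term_quadruple a (q * a ^ 2 / k)); auto.
  2-5: auto using Cmult_neq_0, Cdiv_neq_0, rt_neq_0, Cpow_nz.
  2,4: rewrite Cpow_mult_l, rt_sqr; field; auto.
  2,3: rewrite <- (rt_sqr k) at 2; field; auto.
  unfold qpochs, qpochs_inf, Cprod. cbn [map fold_right].
  replace (a ^ 2 * q / (q * a ^ 2 / k)) with k by (field; auto).
  replace (a * q ^ 2 / A) with u by (unfold u, A; field; auto).
  replace (a * q ^ 2 / b) with v by (unfold v; field; auto).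
  replace (a * q ^ 2 / (a * q)) with q by (field; auto).
  replace (a * q ^ 2 / (k / (a * q))) with (a ^ 2 * q ^ 2 / k * q)
    by (field; auto).
  replace (a * q ^ 2 / (k / a)) with (a ^ 2 * q ^ 2 / k) by (field; auto).
  unfold quad_alpha.
  assert (D3 := qpoch_double a q s). assert (D4 := qpoch_double (k / (a * q)) q s).
  assert (D5 := qpoch_double q q s).
  assert (D6 := qpoch_double (a ^ 2 * q ^ 2 / k) q s).
  replace (k / (a * q) * q) with (k / a) in D4 by (field; auto).
  replace (q * q) with (q ^ 2) in D5 by ring.
  assert (N1 : qpoch k q (2 * (2 * s)) <> 0) by (apply qpoch_neq_0; auto).
  assert (N2 := qpoch_qq_neq_0 q (2 * s) Hq).
  assert (N3 : qpoch (a ^ 2 * q ^ 2 / k) q (2 * s) <> 0)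
    by (apply qpoch_neq_0; auto).
  assert (N5 : qpoch u (q ^ 2) s <> 0) by (apply qpoch_neq_0; auto).
  assert (N6 : qpoch v (q ^ 2) s <> 0) by (apply qpoch_neq_0; auto).
  rewrite (qpoch_inf_split (q ^ 2) Hq2 u s), (qpoch_inf_split (q ^ 2) Hq2 v s).
  set (i1 := qpoch_inf (v * (q ^ 2) ^ s) (q ^ 2)).
  set (i2 := qpoch_inf (u * (q ^ 2) ^ s) (q ^ 2)).
  replace (k ^ 2 * q / (a * b)) with (A * q) by (unfold A; field; auto).
  assert (Ex : (q ^ 2) ^ s = (k / a) ^ (2 * s) * (- (q * (a / k))) ^ (2 * s)).
  { rewrite <- Cpow_mult_l, Cpow_mult_r. f_equal. field. auto. }
  rewrite Ex. clear Ex.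
  transitivity ((1 - a * (q ^ (2 * s)) ^ 2) / (1 - a)
    * (qpoch a q (2 * s) * qpoch (k / (a * q)) q (2 * s)
       / (qpoch q q (2 * s) * qpoch (a ^ 2 * q ^ 2 / k) q (2 * s)))
    * (qpoch (q * a ^ 2 / k) q (2 * (2 * s)) / qpoch k q (2 * (2 * s)))
    * ((k / a) ^ (2 * s) * (- (q * (a / k))) ^ (2 * s))
    * (i1 * i2)
    * ((qpoch A q (2 * s) * qpoch_inf (A * q ^ (2 * s) * q) (q ^ 2))
       * (qpoch b q (2 * s) * qpoch_inf (b * q ^ (2 * s) * q) (q ^ 2))));
    [unfold Cdiv; ring|].
  rewrite TA, TB. clear TA TB.
  rewrite D3, D4 in *. rewrite D5 in *. rewrite D6 in *.
  assert (N7 : qpoch q (q ^ 2) s <> 0) by (intros E; apply N2; rewrite E; ring).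
  assert (N8 : qpoch (q ^ 2) (q ^ 2) s <> 0)
    by (intros E; apply N2; rewrite E; ring).
  assert (N9 : qpoch (a ^ 2 * q ^ 2 / k) (q ^ 2) s <> 0)
    by (intros E; apply N3; rewrite E; ring).
  assert (N10 : qpoch (a ^ 2 * q ^ 2 / k * q) (q ^ 2) s <> 0)
    by (intros E; apply N3; rewrite E; ring).
  clear HA HB HAB HM HK Haj Hu Hv D3 D4 D5 D6 N2 N3.
  clearbody A u v.
  set (i3 := qpoch_inf (A * q) (q ^ 2)). set (i4 := qpoch_inf (b * q) (q ^ 2)).
  clearbody i1 i2 i3 i4.
  generalize ((k / a) ^ (2 * s)) ((- (q * (a / k))) ^ (2 * s)). intros g1 g2.
  qatoms. field. repeat split; auto.
Qed.

(** The first factors, split off to reach even lengths, form the coefficient of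
    the second series. *)
Lemma rho_odd (s : nat) :
  1 - q <> 0 -> 1 - k * q <> 0 -> 1 - a ^ 2 * q ^ 2 / k <> 0 ->
  (forall j, 1 - a ^ 2 * b * q ^ 3 / k ^ 2 * (q ^ 2) ^ j <> 0) ->
  (forall j, 1 - q ^ 3 * a / b * (q ^ 2) ^ j <> 0) ->
  rho q (a / k) (k ^ 2 / (a * b)) b (2 * s + 1)
  = - (q * ((1 - a * q ^ 2) * (1 - q * a ^ 2 / k) * (1 - q ^ 2 * a ^ 2 / k)
             * (1 - k / (a * q))
           / ((1 - q) * (1 - k) * (1 - k * q) * (1 - a ^ 2 * q ^ 2 / k)))
       * qpochs_inf [k ^ 2 / (a * b); b; a ^ 2 * b * q ^ 3 / k ^ 2;
                     q ^ 3 * a / b] (q ^ 2))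
    * W_term rt (a * q ^ 2) W_odd_params (q ^ 2) (q ^ 2) s.
Proof.
  intros H1q H1kq H1m Hu Hv.
  set (u := a ^ 2 * b * q ^ 3 / k ^ 2) in *. set (v := q ^ 3 * a / b) in *.
  unfold rho, rho_tail. rewrite k_param, a_param.
  set (A := k ^ 2 / (a * b)).
  replace (q ^ 2 * (a / k) ^ 2 * (A * q ^ (2 * s + 1))) with (v * (q ^ 2) ^ s)
    by (rewrite Nat.add_1_r, (Cpow_S q (2 * s)), Cpow_mult_r; unfold A, v;
        qatoms; field; auto).
  replace (q ^ 2 * (a / k) ^ 2 * (b * q ^ (2 * s + 1))) with (u * (q ^ 2) ^ s)
    by (rewrite Nat.add_1_r, (Cpow_S q (2 * s)), Cpow_mult_r; unfold u;
        qatoms; field; auto).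
  assert (TA := qpoch_odd_tail q Hq A s). assert (TB := qpoch_odd_tail q Hq b s).
  assert (Hq3 : q ^ 3 <> 0) by now apply Cpow_nz.
  assert (Hq5 : q ^ 5 <> 0) by now apply Cpow_nz.
  assert (Hc0 : rt k <> 0) by now apply rt_neq_0.
  unfold W_odd_params.
  rewrite (W_term_quadruple (a * q ^ 2) (q * a ^ 2 / k * q ^ 2)); auto.
  2-6: auto using Cmult_neq_0, Cdiv_neq_0, rt_neq_0, Cpow_nz.
  2,4: rewrite Cpow_mult_l, rt_sqr; field; auto.
  2,3: rewrite <- (rt_sqr k) at 2; field; auto.
  2:{ intros j. rewrite <- Cmult_assoc, <- Cpow_S. apply Haj. }
  unfold qpochs, qpochs_inf, Cprod. cbn [map fold_right]. fold A.
  replace ((a * q ^ 2) ^ 2 * q / (q * a ^ 2 / k * q ^ 2)) with (k * q ^ 2)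
    by (field; auto).
  replace (k ^ 2 * q / (a * b)) with (A * q) by (unfold A; field; auto).
  replace (a * q ^ 2 * q ^ 2 / (A * q)) with u by (unfold u, A; field; auto).
  replace (a * q ^ 2 * q ^ 2 / (b * q)) with v by (unfold v; field; auto).
  replace (a * q ^ 2 * q ^ 2 / (a * q)) with (q * q ^ 2) by (field; auto).
  replace (a * q ^ 2 * q ^ 2 / (k * q / a)) with (a ^ 2 * q ^ 2 / k * q)
    by (field; auto).
  replace (a * q ^ 2 * q ^ 2 / (k / a)) with (a ^ 2 * q ^ 2 / k * q * q)
    by (field; auto).
  replace (1 - a * q ^ 2 * (q ^ (2 * s)) ^ 2) with (1 - a * (q ^ S (2 * s)) ^ 2)
    by (rewrite (Cpow_S q (2 * s)); ring).
  unfold quad_alpha.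
  assert (D3 := qpoch_double (a * q) q s).
  assert (D4 := qpoch_double (k / (a * q) * q) q s).
  assert (D5 := qpoch_double (q * q) q s).
  assert (D6 := qpoch_double (a ^ 2 * q ^ 2 / k * q) q s).
  replace (2 * (2 * s + 1))%nat with (S (S (2 * (2 * s)))) by lia.
  rewrite !Nat.add_1_r in *.
  rewrite (qpoch_S_l a q), (qpoch_S_l (k / (a * q)) q), (qpoch_S_l q q),
    (qpoch_S_l (a ^ 2 * q ^ 2 / k) q), (qpoch_S_l k q), (qpoch_S_l (k * q) q),
    (qpoch_S_l (q * a ^ 2 / k) q), (qpoch_S_l (q * a ^ 2 / k * q) q).
  replace (k * q * q) with (k * q ^ 2) by ring.
  replace (q * a ^ 2 / k * q * q) with (q * a ^ 2 / k * q ^ 2)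
    by (unfold Cdiv; ring).
  replace (a * q * q) with (a * q ^ 2) in D3 by ring.
  replace (k / (a * q) * q * q) with (k * q / a) in D4 by (field; auto).
  replace (q * q * q) with (q * q ^ 2) in D5 by ring.
  assert (N1 : qpoch (k * q ^ 2) q (2 * (2 * s)) <> 0).
  { apply qpoch_neq_0. intros j _.
    nz_from (HK (S (S j))). }
  assert (N2 : qpoch (q * q) q (2 * s) <> 0).
  { apply qpoch_neq_0. intros j _. rewrite <- Cmult_assoc, <- Cpow_S.
    now apply one_minus_qpow_neq_0. }
  assert (N3 : qpoch (a ^ 2 * q ^ 2 / k * q) q (2 * s) <> 0).
  { apply qpoch_neq_0. intros j _. rewrite <- Cmult_assoc, <- Cpow_S. apply HM. }
  assert (H2a : 1 - a * q ^ 2 <> 0).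
  { rewrite <- (Cpow_1_r (q ^ 2)). apply Haj. }
  assert (N5 : qpoch u (q ^ 2) s <> 0) by (apply qpoch_neq_0; auto).
  assert (N6 : qpoch v (q ^ 2) s <> 0) by (apply qpoch_neq_0; auto).
  rewrite (qpoch_inf_split (q ^ 2) Hq2 u s), (qpoch_inf_split (q ^ 2) Hq2 v s).
  set (i1 := qpoch_inf (v * (q ^ 2) ^ s) (q ^ 2)).
  set (i2 := qpoch_inf (u * (q ^ 2) ^ s) (q ^ 2)).
  assert (Ex : (k / a) ^ S (2 * s) * (- (q * (a / k))) ^ S (2 * s)
               = - q * (q ^ 2) ^ s).
  { rewrite <- Cpow_mult_l. replace (k / a * - (q * (a / k))) with (- q)
      by (field; auto).
    rewrite Cpow_S, Cpow_mult_r. do 2 f_equal. ring. }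
  set (w := 1 - a * (q ^ S (2 * s)) ^ 2) in *.
  set (c1 := 1 - q * a ^ 2 / k) in *. set (c2 := 1 - q * a ^ 2 / k * q).
  set (c3 := 1 - k / (a * q)). set (c4 := 1 - a ^ 2 * q ^ 2 / k) in *.
  replace (1 - q ^ 2 * a ^ 2 / k) with c2 by (unfold c2, Cdiv; ring).
  transitivity (w / (1 - a)
    * ((1 - a) * qpoch (a * q) q (2 * s)
        * (c3 * qpoch (k / (a * q) * q) q (2 * s))
       / ((1 - q) * qpoch (q * q) q (2 * s)
          * (c4 * qpoch (a ^ 2 * q ^ 2 / k * q) q (2 * s))))
    * (c1 * (c2 * qpoch (q * a ^ 2 / k * q ^ 2) q (2 * (2 * s)))
       / ((1 - k) * ((1 - k * q) * qpoch (k * q ^ 2) q (2 * (2 * s)))))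
    * ((k / a) ^ S (2 * s) * (- (q * (a / k))) ^ S (2 * s))
    * (i1 * i2)
    * ((qpoch A q (S (2 * s)) * qpoch_inf (A * q ^ S (2 * s) * q) (q ^ 2))
       * (qpoch b q (S (2 * s)) * qpoch_inf (b * q ^ S (2 * s) * q) (q ^ 2))));
    [unfold Cdiv; ring|].
  rewrite TA, TB, Ex. clear TA TB Ex.
  rewrite D3, D4 in *. rewrite D5 in *. rewrite D6 in *.
  replace (k / (a * q) * q) with (k / a) by (field; auto).
  replace (q * q) with (q ^ 2) in * by ring.
  assert (N7 : qpoch (q ^ 2) (q ^ 2) s <> 0)
    by (intros E; apply N2; rewrite E; ring).
  assert (N8 : qpoch (q * q ^ 2) (q ^ 2) s <> 0)
    by (intros E; apply N2; rewrite E; ring).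
  assert (N9 : qpoch (a ^ 2 * q ^ 2 / k * q) (q ^ 2) s <> 0)
    by (intros E; apply N3; rewrite E; ring).
  assert (N10 : qpoch (a ^ 2 * q ^ 2 / k * q * q) (q ^ 2) s <> 0)
    by (intros E; apply N3; rewrite E; ring).
  assert (K1 := H1k').
  clear HA HB HAB HM HK Haj Hu Hv D3 D4 D5 D6 N2 N3.
  set (i3 := qpoch_inf A (q ^ 2)). set (i4 := qpoch_inf b (q ^ 2)).
  clearbody i1 i2 i3 i4 w c1 c2 c3 c4. clearbody A u v.
  qatoms. field. repeat split; auto.
Qed.

End Translation.

Lemma no_zero_pair (x w p : C) (j : nat) :
  x ^ 2 = w -> 1 - x * p ^ j <> 0 -> 1 - - x * p ^ j <> 0 ->
  1 - w * (p ^ 2) ^ j <> 0.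
Proof.
  intros <- H1 H2. rewrite (qpow_double p j).
  replace (1 - x ^ 2 * (p ^ j) ^ 2) with ((1 - x * p ^ j) * (1 - - x * p ^ j))
    by ring.
  now apply Cmult_neq_0.
Qed.

Ltac in_list :=
  cbn [In map app vwp_den];
  repeat first [left; match goal with |- ?x = ?x => reflexivity end | right].

Theorem corollary2 (rt : C -> C) (rt_sqr : forall z : C, rt z ^ 2 = z)
    (q a b k : C) :
  let num7 :=
    [q * rt k; - (q * rt k); k ^ 2 / (a * b); b;
     rt (q * a); - rt (q * a); k ^ 2 / (q * a ^ 2)] in
  let den7 :=
    [rt k; - rt k; q * a * b / k; q * k / b;
     k * rt (q / a); - (k * rt (q / a))] in
  let par1 :=
    [k ^ 2 / (a * b); b; a * q; k / (a * q); k / a;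
     a * rt (q / k); - (a * rt (q / k));
     a * q / rt k; - (a * q / rt k);
     a * rt (q ^ 3 / k); - (a * rt (q ^ 3 / k));
     a * q ^ 2 / rt k; - (a * q ^ 2 / rt k)] in
  let par2 :=
    [k ^ 2 * q / (a * b); b * q; a * q; k * q / a; k / a;
     a * rt (q ^ 3 / k); - (a * rt (q ^ 3 / k));
     a * q ^ 2 / rt k; - (a * q ^ 2 / rt k);
     a * rt (q ^ 5 / k); - (a * rt (q ^ 5 / k));
     a * q ^ 3 / rt k; - (a * q ^ 3 / rt k)] in
  q <> 0 -> a <> 0 -> b <> 0 -> k <> 0 ->
  (Cmod q < 1)%R ->
  no_zero_factor [k * q; q * a / k] q ->
  no_zero_factor (q :: den7) q ->
  no_zero_factor (q ^ 2 :: vwp_den rt a par1 (q ^ 2)) (q ^ 2) ->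
  no_zero_factor (q ^ 2 :: vwp_den rt (a * q ^ 2) par2 (q ^ 2)) (q ^ 2) ->
  1 - q <> 0 -> 1 - k <> 0 -> 1 - k * q <> 0 -> 1 - a ^ 2 * q ^ 2 / k <> 0 ->
  abs_convergent (phi_term num7 den7 q (- (q * a / k))) ->
  abs_convergent (W_term rt a par1 (q ^ 2) (q ^ 2)) ->
  abs_convergent (W_term rt (a * q ^ 2) par2 (q ^ 2) (q ^ 2)) ->
  qpochs_inf [q * a * b / k; k * q / b] q
    * qpochs_inf [q; k ^ 2 * q / a; q ^ 2 * a; q ^ 2 * a ^ 2 / k ^ 2] (q ^ 2)
    / qpochs_inf [k * q; q * a / k] q
    * phi num7 den7 q (- (q * a / k))
  = qpochs_inf [k ^ 2 * q / (a * b); b * q; a ^ 2 * b * q ^ 2 / k ^ 2;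
                q ^ 2 * a / b] (q ^ 2)
      * W rt a par1 (q ^ 2) (q ^ 2)
    - q * ((1 - a * q ^ 2) * (1 - q * a ^ 2 / k) * (1 - q ^ 2 * a ^ 2 / k)
             * (1 - k / (a * q))
           / ((1 - q) * (1 - k) * (1 - k * q) * (1 - a ^ 2 * q ^ 2 / k)))
      * qpochs_inf [k ^ 2 / (a * b); b; a ^ 2 * b * q ^ 3 / k ^ 2;
                    q ^ 3 * a / b] (q ^ 2)
      * W rt (a * q ^ 2) par2 (q ^ 2) (q ^ 2).
Proof.
  intros num7 den7 par1 par2 Hq0 Ha0 Hb0 Hk0 Hq Hpre Hden HW1 HW2
    H1q H1k H1kq H1m Cphi CW1 CW2.
  assert (Hq2 := Cmod_sqr_lt_1 q Hq).
  assert (HK : forall j, 1 - k * q ^ j <> 0).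
  { intros [|j].
    - change (q ^ 0) with (RtoC 1). now rewrite Cmult_1_r.
    - rewrite Cpow_S, Cmult_assoc. apply Hpre. in_list. }
  assert (Hzj : forall j, 1 - q * a / k * q ^ j <> 0)
    by (intros j; apply Hpre; in_list).
  assert (HA : forall j, 1 - q * a * b / k * q ^ j <> 0)
    by (intros j; apply Hden; unfold den7; in_list).
  assert (HB : forall j, 1 - q * k / b * q ^ j <> 0)
    by (intros j; apply Hden; unfold den7; in_list).
  assert (HAB : forall j, 1 - k ^ 2 * q / a * (q ^ 2) ^ j <> 0).
  { intros j. apply (no_zero_pair (k * rt (q / a))).
    - rewrite Cpow_mult_l, rt_sqr. unfold Cdiv. ring.
    - apply Hden. unfold den7. in_list.
    - apply Hden. unfold den7. in_list. }
  assert (Haj : forall j, 1 - a * (q ^ 2) ^ j <> 0).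
  { assert (He : forall i, 1 - a * ((q ^ 2) ^ 2) ^ i <> 0).
    { intros i. apply (no_zero_pair (rt a) a); [apply rt_sqr| |];
        apply HW1; unfold par1; in_list. }
    assert (Ho : forall i, 1 - a * q ^ 2 * ((q ^ 2) ^ 2) ^ i <> 0).
    { intros i. apply (no_zero_pair (rt (a * q ^ 2)) (a * q ^ 2));
        [apply rt_sqr| |]; apply HW2; unfold par2; in_list. }
    intros j. destruct (Nat.Even_or_Odd j) as [[i ->]|[i ->]].
    - rewrite Cpow_mult_r. apply He.
    - rewrite Nat.add_1_r, (Cpow_S (q ^ 2)), Cpow_mult_r, Cmult_assoc. apply Ho. }
  assert (H1a : 1 - a <> 0).
  { nz_from (Haj 0%nat). }
  assert (HM : forall j, 1 - a ^ 2 * q ^ 2 / k * q ^ j <> 0).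
  { assert (He : forall i, 1 - a ^ 2 * q ^ 2 / k * (q ^ 2) ^ i <> 0).
    { intros i. replace (a ^ 2 * q ^ 2 / k) with (a * q ^ 2 / (k / a))
        by (field; auto).
      apply HW1. unfold par1. in_list. }
    assert (Ho : forall i, 1 - a ^ 2 * q ^ 2 / k * q * (q ^ 2) ^ i <> 0).
    { intros i. replace (a ^ 2 * q ^ 2 / k * q) with (a * q ^ 2 / (k / (a * q)))
        by (field; auto).
      apply HW1. unfold par1. in_list. }
    intros j. destruct (Nat.Even_or_Odd j) as [[i ->]|[i ->]].
    - rewrite Cpow_mult_r. apply He.
    - rewrite Nat.add_1_r, (Cpow_S q (2 * i)), Cpow_mult_r, Cmult_assoc. apply Ho. }
  assert (Hu1 : forall j, 1 - a ^ 2 * b * q ^ 2 / k ^ 2 * (q ^ 2) ^ j <> 0).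
  { intros j. replace (a ^ 2 * b * q ^ 2 / k ^ 2)
      with (a * q ^ 2 / (k ^ 2 / (a * b))) by (field; auto).
    apply HW1. unfold par1. in_list. }
  assert (Hv1 : forall j, 1 - q ^ 2 * a / b * (q ^ 2) ^ j <> 0).
  { intros j. replace (q ^ 2 * a / b) with (a * q ^ 2 / b) by (field; auto).
    apply HW1. unfold par1. in_list. }
  assert (Hu2 : forall j, 1 - a ^ 2 * b * q ^ 3 / k ^ 2 * (q ^ 2) ^ j <> 0).
  { intros j. replace (a ^ 2 * b * q ^ 3 / k ^ 2)
      with (a * q ^ 2 * q ^ 2 / (k ^ 2 * q / (a * b))) by (field; auto).
    apply HW2. unfold par2. in_list. }
  assert (Hv2 : forall j, 1 - q ^ 3 * a / b * (q ^ 2) ^ j <> 0).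
  { intros j. replace (q ^ 3 * a / b) with (a * q ^ 2 * q ^ 2 / (b * q))
      by (field; auto).
    apply HW2. unfold par2. in_list. }
  assert (Hz : a / k <> 0) by now apply Cdiv_neq_0.
  assert (HA0 : k ^ 2 / (a * b) <> 0)
    by (apply Cdiv_neq_0; [now apply Cpow_nz|now apply Cmult_neq_0]).
  assert (Ek := k_param a b k Ha0 Hb0 Hk0).
  assert (Ea := a_param a b k Ha0 Hb0 Hk0).
  set (z := a / k) in *. set (A := k ^ 2 / (a * b)) in *.
  assert (EzA : q * z * A = q * k / b) by (unfold z, A; field; auto).
  assert (EzB : q * z * b = q * a * b / k) by (unfold z; field; auto).
  assert (EAB : q * (A * b) = k ^ 2 * q / a) by (unfold A; field; auto).
  assert (Eqz : q * z = q * a / k) by (unfold z; field; auto).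
  set (P1 := qpochs_inf [k ^ 2 * q / (a * b); b * q; a ^ 2 * b * q ^ 2 / k ^ 2;
                q ^ 2 * a / b] (q ^ 2)).
  set (coef := q * ((1 - a * q ^ 2) * (1 - q * a ^ 2 / k) * (1 - q ^ 2 * a ^ 2 / k)
             * (1 - k / (a * q))
           / ((1 - q) * (1 - k) * (1 - k * q) * (1 - a ^ 2 * q ^ 2 / k)))
      * qpochs_inf [A; b; a ^ 2 * b * q ^ 3 / k ^ 2; q ^ 3 * a / b] (q ^ 2)).
  assert (Lphi : Clim (csum (lhs_term q z A b)) (phi num7 den7 q (- (q * a / k)))).
  { eapply Clim_ext; [|exact (abs_convergent_Clim _ Cphi)].
    intros n. apply csum_ext. intros i _.
    exact (phi_term_lhs rt rt_sqr q a b k Hq Ha0 Hb0 Hk0 HK HA HB HAB i). }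
  assert (Lrho : Clim (csum (rho q z A b))
                   (watson_norm q z A b * phi num7 den7 q (- (q * a / k)))).
  { apply rho_Clim; auto; rewrite ?Ek, ?Ea; auto; intros j;
      rewrite ?EzA, ?EzB, ?EAB, ?Eqz; auto. }
  assert (E : watson_norm q z A b * phi num7 den7 q (- (q * a / k))
    = P1 * W rt a par1 (q ^ 2) (q ^ 2)
      + - coef * W rt (a * q ^ 2) par2 (q ^ 2) (q ^ 2)).
  { apply (Clim_unique (fun n => csum (rho q z A b) (2 * n))).
    - apply (Clim_subseq (csum (rho q z A b)) (fun n => (2 * n)%nat));
        [intros; lia|exact Lrho].
    - apply Clim_ext with (fun n =>
        P1 * csum (W_term rt a par1 (q ^ 2) (q ^ 2)) n
        + - coef * csum (W_term rt (a * q ^ 2) par2 (q ^ 2) (q ^ 2)) n).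
      + intros n. rewrite csum_even_odd, <- !csum_scal.
        f_equal; apply csum_ext; intros s _; symmetry.
        * exact (rho_even rt rt_sqr q a b k Hq0 Hq Ha0 Hb0 Hk0 H1a Haj HK HM s
                   Hu1 Hv1).
        * exact (rho_odd rt rt_sqr q a b k Hq0 Hq Ha0 Hb0 Hk0 H1a Haj HK HM s
                   H1q H1kq H1m Hu2 Hv2).
      + apply Clim_plus; apply Clim_scal; now apply abs_convergent_Clim. }
  transitivity (watson_norm q z A b * phi num7 den7 q (- (q * a / k))).
  - f_equal. unfold watson_norm, qpochs_inf, Cprod. cbn [map fold_right].
    rewrite Ek, Ea, EzA, EzB, EAB, Eqz.
    replace (q ^ 2 * a ^ 2 / k ^ 2) with ((q * a / k) ^ 2) by (field; auto).
    rewrite <- (qpoch_inf_pm (q * a / k) q Hq).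
    replace (k * q) with (q * k) by ring.
    replace (q ^ 2 * a) with (a * q ^ 2) by ring.
    assert (N1 : qpoch_inf (q * k) q <> 0).
    { apply qpoch_inf_neq_0; [exact Hq|]. intros j.
      nz_from (HK (S j)). }
    assert (N2 : qpoch_inf (q * a / k) q <> 0) by now apply qpoch_inf_neq_0.
    clear E Lrho Lphi. field. auto.
  - rewrite E. unfold coef. ring.
Qed.
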